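(* Let $m$ be a positive integer, let $K \subseteq \mathbb{R}$ be compact with finitely many isolated points, and let $\gamma=(f,g,h): K \to \mathbb{H}$ be continuous. Then $\gamma \in C^m_{\mathbb{H}}(K)$ if and only if (1) the $m$th divided differences of $\gamma$ converge uniformly on $K$, and (2) $\gamma$ satisfies the discrete $A/V$ condition on $K$.
   Context: The Heisenberg group $\mathbb{H}$ is $\mathbb{R}^3$ with group law $(x,y,z)*(x',y',z') = (x+x',\,y+y',\,z+z'+2(yx'-xy'))$. An absolutely continuous curve $\Gamma=(f,g,h):\mathbb{R}\to\mathbb{R}^3$ is horizontal if $h' = 2(f'g - fg')$ almost everywhere. $C^m(\mathbb{R})$ denotes the $m$-times continuously differentiable real functions $f$ with $\sup_{x}|f^{(m)}(x)|<\infty$; $C^m(\mathbb{R},\mathbb{R}^3)$ the curves whose components lie in $C^m(\mathbb{R})$. For compact $K$ and $\gamma:K\to\mathbb{H}$, $\gamma\in C^m_{\mathbb{H}}(K)$ means there is a horizontal $\Gamma\in C^m(\mathbb{R},\mathbb{R}^3)$ with $\Gamma|_K=\gamma$. Divided differences: for $\phi:A\to\mathbb{R}$ and distinct points $x_0,\dots,x_k\in A$, $\phi[x_0]=\phi(x_0)$ and $\phi[x_0,\dots,x_k] = (\phi[x_1,\dots,x_k]-\phi[x_0,\dots,x_{k-1}])/(x_k-x_0)$. For a set $X$ of $m+1$ distinct points, $\phi[X]$ is an $m$th divided difference. The $m$th divided differences of $\phi$ converge uniformly on $K$ if for every $\varepsilon>0$ there is $\delta>0$ with $|\phi[X]-\phi[Y]|<\varepsilon$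 whenever $X,Y$ are sets of $m+1$ distinct points of $K$ with $\operatorname{diam}(X\cup Y)<\delta$. For $\gamma=(f,g,h)$ this means it holds for each of $f,g,h$. For $X=\{x_0,\dots,x_m\}$, $P(X;\phi)$ denotes the Newton interpolation polynomial $\phi[x_0]+(x-x_0)\phi[x_0,x_1]+\cdots+(x-x_0)\cdots(x-x_{m-1})\phi[x_0,\dots,x_m]$, the unique polynomial of degree $\le m$ agreeing with $\phi$ on $X$. Discrete $A/V$ quantities: for $E\subseteq\mathbb{R}$, $\gamma=(f,g,h):E\to\mathbb{R}^3$, $X\subseteq E$ with $\#X=m+1$, $P_f=P(X;f)$, $P_g=P(X;g)$ and $a,b\in X$: $A[X,\gamma;a,b] = h(b)-h(a) - 2\int_a^b (P_f'P_g - P_g'P_f)$, $V[X,\gamma;a,b] = \operatorname{diam}(X)^{2m} + \operatorname{diam}(X)^m\int_a^b(|P_f'|+|P_g'|)$. $\gamma$ satisfies the discrete $A/V$ condition on $E$ if $A[X,\gamma;a,b]/V[X,\gamma;a,b]\to 0$ as $\operatorname{diam}X\to0$, over all $X\subseteq E$ with $\#X=m+1$ and $a,b\in X$ with $a<b$ (i.e. for every $\varepsilon>0$ there is $\delta>0$ such that $|A[X,\gamma;a,b]/V[X,\gamma;a,b]|<\varepsilon$ for all such $X,a,b$ with $\operatorname{diam}X<\delta$). *)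

(* Defs.v *)
From Stdlib Require Import Reals Lra List.
From Stdlib Require Rtopology.
From Coquelicot Require Import Coquelicot.
Open Scope R_scope.

Definition Cm (m : nat) (phi : R -> R) : Prop :=
  (forall k x, (k < m)%nat -> ex_derive (Derive_n phi k) x) /\
  (forall x, continuous (Derive_n phi m) x) /\
  (exists M, forall x, Rabs (Derive_n phi m x) <= M).

(* Horizontality h' = 2 (f' g - f g') (for C^1 curves, a.e. equality of
   continuous functions is equality everywhere). *)
Definition horizontal (f g h : R -> R) : Prop :=
  forall x, Derive h x = 2 * (Derive f x * g x - f x * Derive g x).

Definition CmH (m : nat) (K : R -> Prop) (f g h : R -> R) : Prop :=
  exists F G H : R -> R, Cm m F /\ Cm m G /\ Cm m H /\ horizontal F G H /\
    (forall x, K x -> F x = f x /\ G x = g x /\ H x = h x).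

Fixpoint dd_aux (n : nat) (phi : R -> R) (l : list R) : R :=
  match n with
  | O => phi (hd 0 l)
  | S n' => (dd_aux n' phi (tl l) - dd_aux n' phi (removelast l)) / (last l 0 - hd 0 l)
  end.
Definition dd (phi : R -> R) (l : list R) : R := dd_aux (length l - 1) phi l.

Definition lmax (l : list R) : R := fold_right Rmax (hd 0 l) l.
Definition lmin (l : list R) : R := fold_right Rmin (hd 0 l) l.
Definition diam (l : list R) : R := lmax l - lmin l.

Definition pts_in (E : R -> Prop) (k : nat) (X : list R) : Prop :=
  NoDup X /\ length X = k /\ (forall x, In x X -> E x).

Definition newton (phi : R -> R) (X : list R) (x : R) : R :=
  fold_right Rplus 0
    (map (fun k => fold_right Rmult 1 (map (fun i => x - nth i X 0) (seq 0 k))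
                   * dd phi (firstn (S k) X))
         (seq 0 (length X))).

Definition dd_unif_conv (m : nat) (K : R -> Prop) (phi : R -> R) : Prop :=
  forall eps, 0 < eps -> exists delta, 0 < delta /\
    forall X Y, pts_in K (S m) X -> pts_in K (S m) Y ->
      diam (X ++ Y) < delta -> Rabs (dd phi X - dd phi Y) < eps.

Definition A_q (f g h : R -> R) (X : list R) (a b : R) : R :=
  h b - h a - 2 * RInt (fun t => Derive (newton f X) t * newton g X t
                                 - Derive (newton g X) t * newton f X t) a b.

Definition V_q (m : nat) (f g : R -> R) (X : list R) (a b : R) : R :=
  diam X ^ (2 * m) + diam X ^ m *
    RInt (fun t => Rabs (Derive (newton f X) t) + Rabs (Derive (newton g X) t)) a b.

Definition discrete_AV (m : nat) (E : R -> Prop) (f g h : R -> R) : Prop :=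
  forall eps, 0 < eps -> exists delta, 0 < delta /\
    forall X a b, pts_in E (S m) X -> In a X -> In b X -> a < b ->
      diam X < delta -> Rabs (A_q f g h X a b / V_q m f g X a b) < eps.

Definition isolated_pt (K : R -> Prop) (x : R) : Prop :=
  K x /\ exists e, 0 < e /\ forall y, K y -> Rabs (y - x) < e -> y = x.

Definition cont_on (K : R -> Prop) (phi : R -> R) : Prop :=
  forall x, K x -> forall eps, 0 < eps -> exists delta, 0 < delta /\
    forall y, K y -> Rabs (y - x) < delta -> Rabs (phi y - phi x) < eps.

(* Main.v *)
Require Import Defs.
From Stdlib Require Import Reals List Lra Lia Arith Permutation Classical IndefiniteDescription.
From Stdlib Require Rtopology.
From Coquelicot Require Import Coquelicot.
Open Scope R_scope.

(** Replacing one node of a Newton polynomial by another changes it by a difference of [m]-th divided differences times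
    a product of [m] linear factors. Hence Newton polynomials on nearby nodes are close with all their derivatives,
    those on nodes shrinking to a non-isolated point [a] of [K] converge to a jet at [a], and these jets satisfy
    Whitney's compatibility conditions; isolated points get an arbitrary jet.

    On a short gap [(a,b)] of [K], start from the Newton polynomials of [f] and [g] on [a], [b] and nodes very close to
    [a], correct the end jets by Hermite interpolation, and add a perturbation flat at both ends that makes the enclosed
    area equal to [h b - h a]. After rescaling the gap to [[0,1]], the discrete A/V condition says that the missing area
    is at most [eps (1 + V)], where [V] is the integral of [|P_f'| + |P_g'|]. If [V <= 1], the quadratic part of the area
    can absorb it; otherwise the part linear in the perturbation can, by pairing [P_f'] or [P_g'] with a bump multiple of
    itself. In both cases the [m]-th derivative of the perturbation tends to 0 with [eps], so the pieces fit together to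
    a [C^m] pair, and [h] is recovered by integration.

    Conversely, if [F], [G] have remainders [r], [s] over their Newton polynomials, then integration by parts removes the
    terms of the area that involve [r'] and [s'] linearly, as [r] and [s] vanish at [a] and [b]. *)

(** Jets are controlled only at accumulation points, so short gaps must have accumulation points at
    both ends. Finiteness of the isolated points gives one separation radius for all of them and
    ensures this; longer gaps need a bridge but no estimate. Small bridges are produced for one
    tolerance at a time, whereas each gap must receive a single bridge: [uniform_choice] selects one
    that is as good as the length of the gap permits. [K] is enlarged by two rays on which all jets
    and the height are 0. Then every complementary interval is a bounded gap with prescribed end
    data, and the extension vanishes far out, which bounds its [m]-th derivatives. Rescaling a gap
    of length [d] also multiplies values by [d^-m]: the [m]-th derivatives keep their size, while
    areas are divided by [d^(2m)], which is the first term of [V_q] up to a constant. Only the top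
    derivative is estimated inside the gaps; the lower ones are recovered as primitives
    ([glue_derive]). *)

(** * Calculus of real functions *)

Lemma is_derive_eq (f : R -> R) (x l l' : R) :
  is_derive f x l -> l = l' -> is_derive f x l'.
Proof. now intros H <-. Qed.

Lemma is_derive_add (f g : R -> R) (x a b : R) :
  is_derive f x a -> is_derive g x b -> is_derive (fun t => f t + g t) x (a + b).
Proof. intros Hf Hg; exact (is_derive_plus f g x a b Hf Hg). Qed.

Lemma is_derive_sub (f g : R -> R) (x a b : R) :
  is_derive f x a -> is_derive g x b -> is_derive (fun t => f t - g t) x (a - b).
Proof. intros Hf Hg; exact (is_derive_minus f g x a b Hf Hg). Qed.

Lemma is_derive_mul (f g : R -> R) (x a b : R) :
  is_derive f x a -> is_derive g x b ->
  is_derive (fun t => f t * g t) x (a * g x + f x * b).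
Proof. intros Hf Hg; exact (is_derive_mult f g x a b Hf Hg Rmult_comm). Qed.

Lemma is_derive_affine (f : R -> R) (u v x l : R) :
  is_derive f (u * x + v) l -> is_derive (fun t => f (u * t + v)) x (u * l).
Proof.
  intros H.
  apply (is_derive_comp f (fun t => u * t + v) x l u H).
  auto_derive; [easy | ring].
Qed.

Lemma continuous_add (f g : R -> R) (x : R) :
  continuous f x -> continuous g x -> continuous (fun t => f t + g t) x.
Proof. intros Hf Hg; exact (continuous_plus f g x Hf Hg). Qed.

Lemma continuous_sub (f g : R -> R) (x : R) :
  continuous f x -> continuous g x -> continuous (fun t => f t - g t) x.
Proof. intros Hf Hg; exact (continuous_minus f g x Hf Hg). Qed.

Lemma continuous_mul (f g : R -> R) (x : R) :
  continuous f x -> continuous g x -> continuous (fun t => f t * g t) x.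
Proof. intros Hf Hg; exact (continuous_mult f g x Hf Hg). Qed.

Lemma continuous_abs (f : R -> R) (x : R) :
  continuous f x -> continuous (fun t => Rabs (f t)) x.
Proof. intros Hf; apply (continuous_comp f Rabs x Hf), continuous_Rabs. Qed.

Lemma continuous_cst (c x : R) : continuous (fun _ : R => c) x.
Proof. apply continuous_const. Qed.

Lemma is_derive_cont (f : R -> R) (x l : R) : is_derive f x l -> continuous f x.
Proof. intros H; apply (ex_derive_continuous (K := R_AbsRing) (V := R_NormedModule) f x); now exists l. Qed.

Lemma mean_value (f df : R -> R) (a b : R) :
  (forall x, is_derive f x (df x)) ->
  exists c, Rmin a b <= c <= Rmax a b /\ f b - f a = df c * (b - a).
Proof.
  intros H.
  destruct (MVT_gen f a b df) as [c Hc]; [now intros; apply H| |now exists c].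
  intros x _. apply continuity_pt_filterlim. exact (is_derive_cont _ _ _ (H x)).
Qed.

Lemma ex_RInt_cont (f : R -> R) (a b : R) :
  (forall x, continuous f x) -> ex_RInt f a b.
Proof. intros H; apply (ex_RInt_continuous (V := R_CompleteNormedModule)); auto. Qed.

Lemma RInt_cong (f g : R -> R) (a b : R) :
  (forall x, f x = g x) -> RInt f a b = RInt g a b :> R.
Proof. intros H; apply RInt_ext; intros; apply H. Qed.

Lemma RInt_add (f g : R -> R) (a b : R) :
  (forall x, continuous f x) -> (forall x, continuous g x) ->
  RInt (fun t => f t + g t) a b = RInt f a b + RInt g a b :> R.
Proof. intros Hf Hg. apply (RInt_plus f g); now apply ex_RInt_cont. Qed.

Lemma RInt_sub (f g : R -> R) (a b : R) :
  (forall x, continuous f x) -> (forall x, continuous g x) ->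
  RInt (fun t => f t - g t) a b = RInt f a b - RInt g a b :> R.
Proof. intros Hf Hg. apply (RInt_minus f g); now apply ex_RInt_cont. Qed.

Lemma RInt_mulc (c : R) (f : R -> R) (a b : R) :
  (forall x, continuous f x) ->
  RInt (fun t => c * f t) a b = c * RInt f a b :> R.
Proof. intros Hf. apply (RInt_scal f); now apply ex_RInt_cont. Qed.

Lemma RInt_der (f df : R -> R) (a b : R) :
  (forall x, is_derive f x (df x)) -> (forall x, continuous df x) ->
  RInt df a b = f b - f a :> R.
Proof.
  intros Hf Hdf. apply is_RInt_unique.
  apply (is_RInt_derive f df); auto.
Qed.

Lemma RInt_le_cont (f g : R -> R) (a b : R) :
  a <= b -> (forall x, continuous f x) -> (forall x, continuous g x) ->
  (forall x, a <= x <= b -> f x <= g x) -> RInt f a b <= RInt g a b.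
Proof.
  intros Hab Hf Hg H.
  apply RInt_le; auto using ex_RInt_cont. intros x Hx; apply H; lra.
Qed.

Lemma RInt_cst (c a b : R) : RInt (fun _ => c) a b = c * (b - a) :> R.
Proof. rewrite RInt_const. apply Rmult_comm. Qed.

Lemma RInt_nonneg (f : R -> R) (a b : R) :
  a <= b -> (forall x, continuous f x) -> (forall x, a <= x <= b -> 0 <= f x) ->
  0 <= RInt f a b.
Proof.
  intros Hab Hf H. apply RInt_ge_0; auto using ex_RInt_cont. intros x Hx; apply H; lra.
Qed.

Lemma RInt_abs_le (f g : R -> R) (a b : R) :
  a <= b -> (forall x, continuous f x) -> (forall x, continuous g x) ->
  (forall x, a <= x <= b -> Rabs (f x) <= g x) -> Rabs (RInt f a b) <= RInt g a b.
Proof.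
  intros Hab Hf Hg H.
  eapply Rle_trans; [apply abs_RInt_le; auto using ex_RInt_cont|].
  apply RInt_le_cont; auto. intros x; apply continuous_abs, Hf.
Qed.

(** * Towers of derivatives *)

(* [p k] plays the role of the [k]-th derivative of [p 0]; nothing is said about [p k] for [k > m]. *)
Definition tower (m : nat) (p : nat -> R -> R) : Prop :=
  (forall k x, (k < m)%nat -> is_derive (p k) x (p (S k) x)) /\
  (forall x, continuous (p m) x).

Lemma tower_cont (m : nat) (p : nat -> R -> R) (k : nat) (x : R) :
  tower m p -> (k <= m)%nat -> continuous (p k) x.
Proof.
  intros [H1 H2] Hk. destruct (Nat.eq_dec k m) as [->|Hn]; [apply H2|].
  eapply is_derive_cont, H1; lia.
Qed.

Lemma tower_der (m : nat) (p : nat -> R -> R) (k : nat) (x : R) :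
  tower m p -> (k < m)%nat -> is_derive (p k) x (p (S k) x).
Proof. intros [H _]; apply H. Qed.

Lemma tower_add (m : nat) (p q : nat -> R -> R) :
  tower m p -> tower m q -> tower m (fun k x => p k x + q k x).
Proof.
  intros [Hp Hp'] [Hq Hq']; split; intros; [apply is_derive_add|apply continuous_add]; auto.
Qed.

Lemma tower_sub (m : nat) (p q : nat -> R -> R) :
  tower m p -> tower m q -> tower m (fun k x => p k x - q k x).
Proof.
  intros [Hp Hp'] [Hq Hq']; split; intros; [apply is_derive_sub|apply continuous_sub]; auto.
Qed.

Lemma tower_scal (m : nat) (c : R) (p : nat -> R -> R) :
  tower m p -> tower m (fun k x => c * p k x).
Proof.
  intros [Hp Hp']; split; intros; [apply is_derive_scal; auto|].
  apply continuous_mul; [apply continuous_cst|auto].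
Qed.

Lemma tower_0 (m : nat) : tower m (fun _ _ => 0).
Proof. split; intros; [apply (is_derive_const 0)|apply continuous_cst]. Qed.

Lemma tower_le (m n : nat) (p : nat -> R -> R) : (n <= m)%nat -> tower m p -> tower n p.
Proof.
  intros Hn Hp; split; intros.
  - apply tower_der with m; auto; lia.
  - apply tower_cont with m; auto.
Qed.

Lemma tower_shift (m : nat) (p : nat -> R -> R) :
  tower (S m) p -> tower m (fun k => p (S k)).
Proof. intros [H1 H2]; split; auto. intros; apply H1; lia. Qed.

Lemma tower_affine (m : nat) (p : nat -> R -> R) (u v : R) :
  tower m p -> tower m (fun k x => u ^ k * p k (u * x + v)).
Proof.
  intros [H1 H2]; split.
  - intros k x Hk. eapply is_derive_eq.
    + apply is_derive_scal. apply is_derive_affine. apply H1, Hk.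
    + simpl; ring.
  - intros x. apply continuous_mul; [apply continuous_cst|].
    apply (continuous_comp (fun t => u * t + v) (p m)); [|apply H2].
    apply continuous_add; [|apply continuous_cst].
    apply continuous_mul; [apply continuous_cst|apply continuous_id].
Qed.

Lemma tower_ext (m : nat) (p q : nat -> R -> R) :
  tower m p -> tower m q -> (forall x, p O x = q O x) ->
  forall k x, (k <= m)%nat -> p k x = q k x.
Proof.
  intros Hp Hq H0 k; induction k; intros x Hk; [apply H0|].
  rewrite <- (is_derive_unique _ _ _ (tower_der m p k x Hp ltac:(lia))).
  rewrite <- (is_derive_unique _ _ _ (tower_der m q k x Hq ltac:(lia))).
  apply Derive_ext; intros t; apply IHk; lia.
Qed.

Lemma tower_Derive_n (m : nat) (p : nat -> R -> R) :
  tower m p -> forall k x, (k <= m)%nat -> Derive_n (p O) k x = p k x.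
Proof.
  intros Hp k; induction k; intros x Hk; [easy|]. simpl.
  rewrite <- (is_derive_unique _ _ _ (tower_der m p k x Hp ltac:(lia))).
  apply Derive_ext; intros t; apply IHk; lia.
Qed.

(** * Rolle's theorem with many zeros *)

(** Node sets are duplicate-free lists in any order; Rolle's theorem needs neighbouring zeros, hence
    this strict order. *)
Fixpoint increasing (l : list R) : Prop :=
  match l with
  | nil => True
  | x :: l' => (forall y, In y l' -> x < y) /\ increasing l'
  end.

Lemma increasing_perm (l : list R) :
  NoDup l -> exists l', Permutation l l' /\ increasing l'.
Proof.
  assert (Hins : forall x l, ~ In x l -> increasing l ->
            exists l', Permutation (x :: l) l' /\ increasing l').
  { intros x; induction l0 as [|y l0 IH]; intros Hx Hl.
    - exists (x :: nil); simpl; intuition.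
    - destruct Hl as [Hy Hl]. simpl in Hx.
      destruct (Rlt_le_dec x y) as [Hxy|Hxy].
      + exists (x :: y :: l0); split; [easy|]. simpl; split; [|easy].
        intros z [<-|Hz]; [easy|]. specialize (Hy z Hz); lra.
      + destruct IH as [l' [Hp Hl']]; [tauto|easy|].
        exists (y :: l'); split.
        * eapply perm_trans; [apply perm_swap|]. now apply perm_skip.
        * simpl; split; [|easy]. intros z Hz.
          apply (Permutation_in (l' := x :: l0)) in Hz; [|now symmetry].
          destruct Hz as [<-|Hz]; [|auto].
          destruct Hxy; [easy|]. exfalso; apply Hx; auto. }
  induction l as [|x l IH]; intros H; [now exists nil|].
  inversion H; subst. destruct IH as [l' [Hp Hl']]; [easy|].
  destruct (Hins x l') as [l'' [Hp' Hl'']]; [|easy|].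
  - intros Hx. apply (Permutation_in (l' := l)) in Hx; [easy|now symmetry].
  - exists l''; split; [|easy]. eapply perm_trans; [|apply Hp']. now apply perm_skip.
Qed.

(** Each interval between neighbouring zeros gives one new zero. The bound [x < y] on all new zeros
    keeps the list increasing when the zero from the first interval is put in front. *)
Lemma rolle_increasing (f df : R -> R) (lo hi : R) (l : list R) (x : R) :
  (forall t, is_derive f t (df t)) ->
  increasing (x :: l) -> (forall y, In y (x :: l) -> lo <= y <= hi /\ f y = 0) ->
  exists l', increasing l' /\ length l' = length l /\
    forall y, In y l' -> x < y /\ lo <= y <= hi /\ df y = 0.
Proof.
  intros Hd; revert x; induction l as [|y l IH]; intros x Hi Hz.
  - exists nil; simpl; intuition.
  - destruct Hi as [Hxy Hi].
    destruct (IH y Hi) as [l' [H1 [H2 H3]]]; [intros; apply Hz; now right|].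
    assert (Hlt : x < y) by (apply Hxy; now left).
    destruct (MVT_cor2 f df x y Hlt) as [c [Hc Hcxy]].
    { intros; apply is_derive_Reals, Hd. }
    destruct (Hz x) as [Hx1 Hx2]; [now left|].
    destruct (Hz y) as [Hy1 Hy2]; [right; now left|].
    exists (c :: l'). split; [|split].
    + simpl; split; [|easy]. intros z Hz'; apply H3 in Hz'; lra.
    + simpl; now rewrite H2.
    + intros z [<-|Hz'].
      * split; [lra|split; [lra|]]. rewrite Hx2, Hy2 in Hc.
        assert (Hp : df c * (y - x) = 0) by lra.
        apply Rmult_integral in Hp; destruct Hp; lra.
      * apply H3 in Hz'. repeat split; try lra.
Qed.

(** Each derivative loses one zero, so [k + j] zeros leave [j]. They stay in [[lo, hi]], which
    localises the intermediate points of the later remainder estimates. *)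
Lemma rolle_tower (k j m : nat) (p : nat -> R -> R) (lo hi : R) (l : list R) :
  tower m p -> (k <= m)%nat -> length l = (k + j)%nat -> NoDup l ->
  (forall y, In y l -> lo <= y <= hi /\ p O y = 0) ->
  exists l', length l' = j /\ NoDup l' /\ forall y, In y l' -> lo <= y <= hi /\ p k y = 0.
Proof.
  intros Hp Hk Hl Hn Hz.
  assert (Hw : exists l', length l' = j /\ increasing l' /\
            forall y, In y l' -> lo <= y <= hi /\ p k y = 0).
  { destruct (increasing_perm l Hn) as [l0 [Hperm Hinc]].
    rewrite (Permutation_length Hperm) in Hl.
    assert (Hz0 : forall y, In y l0 -> lo <= y <= hi /\ p O y = 0).
    { intros y Hy; apply Hz. apply (Permutation_in (l := l0)); [now symmetry|easy]. }
    clear Hperm Hz Hn. revert m p l0 Hp Hk Hl Hinc Hz0.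
    induction k as [|k IH]; intros m p l0 Hp Hk Hl Hinc Hz0; [now exists l0|].
    destruct l0 as [|x l0]; [easy|]. destruct m as [|m]; [lia|].
    destruct (rolle_increasing (p O) (p 1%nat) lo hi l0 x) as [l1 [H1 [H2 H3]]]; auto.
    { intros t; apply (tower_der (S m) p); [easy|lia]. }
    destruct (IH m (fun i => p (S i)) l1) as [l' H'].
    - now apply tower_shift.
    - lia.
    - simpl in Hl; lia.
    - easy.
    - intros y Hy; apply H3 in Hy; tauto.
    - now exists l'. }
  destruct Hw as [l' [H1 [H2 H3]]]. exists l'; repeat split; auto; try now apply H3.
  clear - H2. induction l' as [|x l' IH]; constructor.
  - intros Hx. destruct H2 as [H2 _]. specialize (H2 x Hx); lra.
  - apply IH, H2.
Qed.

Lemma in_lmin_lmax (l : list R) (x : R) : In x l -> lmin l <= x <= lmax l.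
Proof.
  unfold lmin, lmax. generalize (hd 0 l); intros z.
  induction l as [|u l IH]; [easy|]. simpl. intros [->|Hy].
  - split; [apply Rmin_l|apply Rmax_l].
  - specialize (IH Hy). split.
    + eapply Rle_trans; [apply Rmin_r|apply IH].
    + eapply Rle_trans; [apply IH|apply Rmax_r].
Qed.

(** As [p m = 0], [p 0] is a polynomial of degree below [m], and one with [m] zeros is 0: from the
    top down, each [p k] is constant and Rolle's theorem gives it a zero. This is the uniqueness of
    interpolation. *)
Lemma tower_vanish (m : nat) (p : nat -> R -> R) (l : list R) :
  tower m p -> (forall x, p m x = 0) -> length l = m -> NoDup l ->
  (forall y, In y l -> p O y = 0) -> forall x, p O x = 0.
Proof.
  intros Hp Hm Hl Hn Hz.
  assert (H : forall j, (j <= m)%nat -> forall x, p (m - j)%nat x = 0).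
  { induction j as [|j IH]; intros Hj x; [rewrite Nat.sub_0_r; apply Hm|].
    destruct (rolle_tower (m - S j) (S j) m p (lmin l) (lmax l) l) as [l' [H1 [_ H3]]]; auto.
    - lia.
    - lia.
    - intros y Hy; split; auto. now apply in_lmin_lmax.
    - destruct l' as [|y l']; [easy|].
      destruct (H3 y) as [_ Hy]; [now left|].
      destruct (mean_value (p (m - S j)%nat) (p (m - j)%nat) y x) as [c [_ Hc]].
      + intros t. replace (m - j)%nat with (S (m - S j)) by lia. apply (tower_der m); auto; lia.
      + rewrite IH in Hc by lia. lra. }
  intros x. specialize (H m (Nat.le_refl m) x). now rewrite Nat.sub_diag in H.
Qed.

(** * Newton interpolation *)

Fixpoint rsum (n : nat) (a : nat -> R) : R :=
  match n with
  | O => 0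
  | S n' => rsum n' a + a n'
  end.

Lemma rsum_ext (n : nat) (a b : nat -> R) :
  (forall j, (j < n)%nat -> a j = b j) -> rsum n a = rsum n b.
Proof.
  induction n as [|n IH]; intros H; [easy|]. simpl. rewrite H by lia.
  now rewrite IH by (intros; apply H; lia).
Qed.

Lemma rsum_mulc (n : nat) (c : R) (a : nat -> R) :
  rsum n (fun j => c * a j) = c * rsum n a.
Proof. induction n as [|n IH]; simpl; [ring|]. rewrite IH; ring. Qed.

Lemma tower_rsum (m n : nat) (p : nat -> nat -> R -> R) :
  (forall j, tower m (p j)) -> tower m (fun k x => rsum n (fun j => p j k x)).
Proof.
  intros Hp; induction n as [|n IH]; simpl; [apply tower_0|]. now apply tower_add.
Qed.

(* [pt Z k x] is the [k]-th derivative at [x] of the product of the [x - z], [z] in [Z]. *)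
Fixpoint pt (Z : list R) (k : nat) (x : R) : R :=
  match Z with
  | nil => match k with O => 1 | S _ => 0 end
  | z :: Z' => (x - z) * pt Z' k x + INR k * pt Z' (pred k) x
  end.

(** Leibniz's rule with a linear factor has only two terms. At [k = 0] the junk value [pred 0] is
    multiplied by [INR 0]. *)
Lemma pt_der (Z : list R) (k : nat) (x : R) : is_derive (pt Z k) x (pt Z (S k) x).
Proof.
  revert k x; induction Z as [|z Z IH]; intros k x.
  - destruct k; [apply (is_derive_const 1)|apply (is_derive_const 0)].
  - eapply is_derive_eq.
    + apply is_derive_add.
      * apply is_derive_mul; [apply is_derive_sub; [apply is_derive_id|apply (is_derive_const z)]|].
        apply IH.
      * apply is_derive_scal, IH.
    + unfold one, zero; cbn -[INR]. destruct k; cbn [pred]; rewrite ?S_INR; change (INR 0) with 0; fold (pt Z); ring.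
Qed.

Lemma tower_pt (m : nat) (Z : list R) : tower m (pt Z).
Proof. split; intros; [apply pt_der|eapply is_derive_cont, pt_der]. Qed.

Lemma pt_high (Z : list R) (k : nat) (x : R) : (length Z < k)%nat -> pt Z k x = 0.
Proof.
  revert k; induction Z as [|z Z IH]; intros k Hk; simpl in *.
  - destruct k; [lia|easy].
  - rewrite !IH by lia. ring.
Qed.

Lemma pt_top (Z : list R) (x : R) : pt Z (length Z) x = INR (fact (length Z)).
Proof.
  induction Z as [|z Z IH]; [easy|]. cbn [length pt]. rewrite pt_high by lia.
  cbn [pred]. rewrite IH, fact_simpl, mult_INR. ring.
Qed.

Lemma pt_app_0 (A B : list R) (x : R) : pt (A ++ B) 0 x = pt A 0 x * pt B 0 x.
Proof. induction A as [|z A IH]; cbn [app pt INR pred]; [ring|]. rewrite IH; ring. Qed.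

Lemma pt_0_root (Z : list R) (z : R) : In z Z -> pt Z 0 z = 0.
Proof.
  induction Z as [|y Z IH]; [easy|]. intros [->|H]; cbn [pt INR]; [ring|].
  rewrite (IH H); simpl; ring.
Qed.

(** A new linear factor replaces the bound by at most [k + 1] copies of the old one, with the
    exponent moved along, and the next factorial absorbs them. For [k] beyond the degree the
    truncated exponent is 0, but there the derivative vanishes. *)
Lemma pt_bound (Z : list R) (x D : R) :
  (forall z, In z Z -> Rabs (x - z) <= D) -> 0 <= D -> forall k,
  Rabs (pt Z k x) <= INR (fact (S (length Z))) * D ^ (length Z - k).
Proof.
  intros HZ HD. induction Z as [|z Z IH]; intros k.
  - destruct k; simpl; rewrite ?Rabs_R1, ?Rabs_R0; lra.
  - specialize (IH ltac:(intros; apply HZ; now right)).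
    assert (Hz := HZ z (or_introl eq_refl)). cbn [length pt].
    set (n := length Z) in *.
    destruct (le_lt_dec k (S n)) as [Hk|Hk].
    2: { rewrite !pt_high by lia. replace (_ + _) with 0 by ring. rewrite Rabs_R0.
         apply Rmult_le_pos; [apply pos_INR|now apply pow_le]. }
    assert (Hkp : INR k * Rabs (pt Z (pred k) x)
                  <= INR k * (INR (fact (S n)) * D ^ (S n - k))).
    { destruct k; [simpl; lra|]. apply Rmult_le_compat_l; [apply pos_INR|]. apply (IH k). }
    assert (Hk0 : Rabs (x - z) * Rabs (pt Z k x) <= INR (fact (S n)) * D ^ (S n - k)).
    { destruct (Nat.eq_dec k (S n)) as [->|Hk'].
      - rewrite (pt_high Z) by (unfold n; lia). rewrite Rabs_R0, Rmult_0_r.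
        apply Rmult_le_pos; [apply pos_INR|now apply pow_le].
      - replace (S n - k)%nat with (S (n - k)) by lia. simpl pow.
        eapply Rle_trans; [apply Rmult_le_compat; [apply Rabs_pos|apply Rabs_pos|apply Hz|apply IH]|].
        lra. }
    eapply Rle_trans; [apply Rabs_triang|]. rewrite !Rabs_mult, (Rabs_pos_eq (INR k)) by apply pos_INR.
    rewrite (fact_simpl (S n)), mult_INR.
    assert (Hkn : INR k + 1 <= INR (S (S n))) by (rewrite (S_INR (S n)); apply le_INR in Hk; lra).
    assert (Hpos : 0 <= INR (fact (S n)) * D ^ (S n - k)).
    { apply Rmult_le_pos; [apply pos_INR|now apply pow_le]. }
    nra.
Qed.

(* The [k]-th derivative of the product of the [x - w], [w] in [W], with the Newton polynomial of [phi] on [X]. *)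
Definition nt (W : list R) (phi : R -> R) (X : list R) (k : nat) (x : R) : R :=
  rsum (length X) (fun j => dd phi (firstn (S j) X) * pt (W ++ firstn j X) k x).

Lemma tower_nt (m : nat) (W : list R) (phi : R -> R) (X : list R) : tower m (nt W phi X).
Proof.
  apply (tower_rsum m (length X) (fun j k x => dd phi (firstn (S j) X) * pt (W ++ firstn j X) k x)).
  intros j; apply tower_scal, tower_pt.
Qed.

Lemma nt_snoc (W : list R) (phi : R -> R) (X : list R) (y : R) (k : nat) (x : R) :
  nt W phi (X ++ y :: nil) k x = nt W phi X k x + dd phi (X ++ y :: nil) * pt (W ++ X) k x.
Proof.
  unfold nt. rewrite length_app, Nat.add_1_r. cbn [rsum]. f_equal.
  - apply rsum_ext; intros j Hj. rewrite !firstn_app.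
    replace (S j - length X)%nat with O by lia. replace (j - length X)%nat with O by lia.
    now rewrite !firstn_O, !app_nil_r.
  - rewrite (firstn_all2 (n := S (length X))) by (rewrite length_app; simpl; lia).
    now rewrite firstn_app, Nat.sub_diag, firstn_O, app_nil_r, firstn_all.
Qed.

Lemma nt_prod (W : list R) (phi : R -> R) (X : list R) (x : R) :
  nt W phi X 0 x = pt W 0 x * nt nil phi X 0 x.
Proof.
  unfold nt. rewrite <- rsum_mulc. apply rsum_ext; intros j _.
  rewrite !pt_app_0. cbn [pt]. ring.
Qed.

Lemma nt_high (phi : R -> R) (X : list R) (k : nat) (x : R) :
  (length X <= k)%nat -> nt nil phi X k x = 0.
Proof.
  intros Hk. unfold nt. rewrite <- (Rmult_0_l (rsum (length X) (fun _ => 1))), <- rsum_mulc.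
  apply rsum_ext; intros j Hj. rewrite pt_high; [ring|]. simpl. rewrite length_firstn. lia.
Qed.

Lemma nt_top (phi : R -> R) (X : list R) (n : nat) (x : R) :
  length X = S n -> nt nil phi X n x = INR (fact n) * dd phi X.
Proof.
  intros HX. destruct (exists_last (l := X)) as [Y [y ->]]; [now destruct X|].
  rewrite length_app, Nat.add_1_r in HX. injection HX as HX.
  rewrite nt_snoc, nt_high by lia. simpl. rewrite <- HX, pt_top. ring.
Qed.

Lemma newton_nt (phi : R -> R) (X : list R) (x : R) : newton phi X x = nt nil phi X 0 x.
Proof.
  (* [seq] grows at its end, where [fold_right] starts, so the folds are first generalised over
     their initial value. *)
  assert (Hs : forall n a, fold_right Rplus 0 (map a (seq 0 n)) = rsum n a).
  { intros n a. assert (Hg : forall l c, fold_right Rplus c l = fold_right Rplus 0 l + c).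
    { induction l as [|u l IH]; intros c; simpl; [ring|]. rewrite IH; ring. }
    induction n as [|n IH]; [easy|].
    rewrite seq_S, map_app, fold_right_app. simpl. rewrite Hg, IH. ring. }
  assert (Hp : forall k, (k <= length X)%nat ->
    fold_right Rmult 1 (map (fun i => x - nth i X 0) (seq 0 k)) = pt (firstn k X) 0 x).
  { assert (Hg : forall l c, fold_right Rmult c l = fold_right Rmult 1 l * c).
    { induction l as [|u l IH]; intros c; simpl; [ring|]. rewrite IH; ring. }
    induction k as [|k IH]; intros Hk; [easy|].
    rewrite seq_S, map_app, fold_right_app. simpl fold_right. rewrite Hg, IH by lia.
    rewrite <- (firstn_skipn k (firstn (S k) X)), firstn_firstn, Nat.min_l by lia.
    rewrite pt_app_0. f_equal. rewrite skipn_firstn_comm.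
    replace (S k - k)%nat with 1%nat by lia.
    destruct (skipn k X) as [|u l] eqn:E.
    - assert (length (skipn k X) = O) by now rewrite E. rewrite length_skipn in H; lia.
    - rewrite <- (firstn_skipn k X) at 1. rewrite app_nth2; rewrite length_firstn; [|lia].
      rewrite Nat.min_l by lia. rewrite Nat.sub_diag, E. cbn. ring. }
  unfold newton, nt. rewrite Hs. apply rsum_ext; intros j Hj.
  rewrite Hp by lia. cbn [app]. ring.
Qed.

Lemma Derive_newton (phi : R -> R) (X : list R) (x : R) :
  Derive (newton phi X) x = nt nil phi X 1 x.
Proof.
  rewrite (Derive_ext _ (nt nil phi X 0)) by apply newton_nt.
  apply is_derive_unique, (tower_der 1); [apply tower_nt|lia].
Qed.

Lemma dd_step (phi : R -> R) (x : R) (Y : list R) (y : R) :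
  dd phi (x :: Y ++ y :: nil) = (dd phi (Y ++ y :: nil) - dd phi (x :: Y)) / (y - x).
Proof.
  unfold dd. cbn [length]. rewrite !length_app, Nat.add_1_r, !Nat.sub_succ, !Nat.sub_0_r.
  cbn [dd_aux tl hd].
  replace (removelast (x :: Y ++ y :: nil)) with (x :: Y)
    by (symmetry; apply (removelast_last (x :: Y))).
  now replace (last (x :: Y ++ y :: nil) 0) with y by (symmetry; apply (last_last (x :: Y))).
Qed.

Lemma dd_ext (phi psi : R -> R) (X : list R) :
  X <> nil -> (forall x, In x X -> phi x = psi x) -> dd phi X = dd psi X.
Proof.
  unfold dd. intros HX. assert (Hl : length X = S (length X - 1)) by (destruct X; simpl; [easy|lia]).
  revert X Hl HX; intros X. generalize (length X - 1)%nat; intros n; revert X.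
  induction n as [|n IH]; intros X Hl HX H.
  - destruct X as [|x X]; [easy|]. simpl. apply H; now left.
  - destruct X as [|x X]; [easy|]. cbn [dd_aux].
    destruct (exists_last (l := x :: X)) as [Y [y HY]]; [easy|].
    f_equal. f_equal.
    + apply IH; simpl in *; [lia|intros ->; simpl in Hl; lia|intros; apply H; now right].
    + rewrite HY in *. rewrite removelast_last. rewrite length_app, Nat.add_1_r in Hl. apply IH.
      * lia.
      * intros ->; simpl in Hl; lia.
      * intros z Hz; apply H, in_or_app; now left.
Qed.

Lemma nt_ext (W : list R) (phi psi : R -> R) (X : list R) (k : nat) (x : R) :
  (forall y, In y X -> phi y = psi y) -> nt W phi X k x = nt W psi X k x.
Proof.
  intros H. apply rsum_ext; intros j Hj. f_equal. apply dd_ext.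
  - destruct X; [simpl in Hj; lia|easy].
  - intros y Hy; apply H. rewrite <- (firstn_skipn (S j) X). apply in_or_app; now left.
Qed.

Lemma NoDup_snoc (X : list R) (y : R) : NoDup (X ++ y :: nil) <-> NoDup (y :: X).
Proof.
  split; apply Permutation_NoDup; [symmetry|]; apply Permutation_cons_append.
Qed.

(** At the older nodes the new term vanishes. For the last node [y], let [x0] be the first node and
    [Y] the nodes between: the interpolants on [Y ++ y :: nil] and on [x0 :: Y] agree on [Y], so
    they differ by [c] times the product over [Y], where [c] is the difference of their leading
    coefficients. By [dd_step], [c] is [y - x0] times the new divided difference, so at [y] the new
    term is exactly this difference. *)
Lemma nt_interp (phi : R -> R) (X : list R) (x : R) :
  NoDup X -> In x X -> nt nil phi X 0 x = phi x.
Proof.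
  remember (length X) as n eqn:Hn. revert X x Hn.
  induction n as [|n IH]; intros X x Hn HX Hx; [now destruct X|].
  destruct (exists_last (l := X)) as [Z [y HZ]]; [now destruct X|]. subst X.
  rewrite nt_snoc. cbn [app].
  rewrite length_app, Nat.add_1_r in Hn; injection Hn as Hn.
  destruct (proj1 (NoDup_cons_iff y Z) (proj1 (NoDup_snoc Z y) HX)) as [HyZ HZ].
  apply in_app_or in Hx. destruct Hx as [Hx|[<-|[]]].
  { rewrite (pt_0_root Z x Hx), Rmult_0_r, Rplus_0_r. now apply IH. }
  destruct Z as [|x0 Y].
  { cbn. ring. }
  cbn [app] in HX |- *. apply NoDup_cons_iff in HX as [Hx0 HYy].
  apply NoDup_cons_iff in HZ as HZ'; destruct HZ' as [Hx0Y HY].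
  assert (Hyx : y - x0 <> 0).
  { intros E. apply HyZ. left. lra. }
  cbn [length] in Hn.
  set (c := (dd phi (Y ++ y :: nil) - dd phi (x0 :: Y))).
  assert (HS : forall t, nt nil phi (Y ++ y :: nil) 0 t - nt nil phi (x0 :: Y) 0 t
                         - c * pt Y 0 t = 0).
  { apply (tower_vanish (length Y)
      (fun k t => nt nil phi (Y ++ y :: nil) k t - nt nil phi (x0 :: Y) k t - c * pt Y k t) Y);
      auto.
    - apply tower_sub; [apply tower_sub; apply tower_nt|apply tower_scal, tower_pt].
    - intros t. rewrite !(nt_top phi _ (length Y)), pt_top; [|easy|now rewrite length_app, Nat.add_1_r].
      unfold c; ring.
    - intros z Hz. rewrite (pt_0_root Y z Hz), !IH; auto.
      + ring.
      + now right.
      + now rewrite length_app, Nat.add_1_r.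
      + apply in_or_app; now left. }
  specialize (HS y). rewrite (IH (Y ++ y :: nil) y) in HS; auto.
  - rewrite dd_step. cbn [pt INR]. fold c. 
    replace (c / (y - x0) * ((y - x0) * pt Y 0 y + 0 * pt Y (pred 0) y)) with (c * pt Y 0 y)
      by (field; exact Hyx). lra.
  - now rewrite length_app, Nat.add_1_r.
  - apply in_or_app; right; now left.
Qed.

(** A polynomial is its own interpolant: this expresses it through its values at fixed nodes and
    makes interpolants independent of the order of the nodes. *)
Lemma nt_unique (n : nat) (p : nat -> R -> R) (X : list R) :
  tower (S n) p -> (forall x, p (S n) x = 0) -> length X = S n -> NoDup X ->
  forall x, p O x = nt nil (p O) X 0 x.
Proof.
  intros Hp Hn HX HN x. apply Rminus_diag_uniq.
  apply (tower_vanish (S n) (fun k t => p k t - nt nil (p O) X k t) X); auto.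
  - apply tower_sub; [easy|apply tower_nt].
  - intros t. rewrite Hn, nt_high; [ring|lia].
  - intros y Hy. rewrite nt_interp; auto. ring.
Qed.

(** * Dependence of Newton polynomials on their nodes *)

(** Symmetry in the nodes comes from uniqueness, not from algebra with divided differences; the
    derivatives follow from order 0 by [tower_ext]. *)
Lemma nt_perm (phi : R -> R) (X Y : list R) (k : nat) (x : R) :
  NoDup X -> Permutation X Y -> nt nil phi X k x = nt nil phi Y k x.
Proof.
  intros HX HP. apply (tower_ext k); auto using tower_nt. intros t.
  destruct X as [|u X'] eqn:E; [apply Permutation_nil in HP; now subst|]. rewrite <- E in *.
  assert (HY : NoDup Y) by now apply Permutation_NoDup with X.
  rewrite (nt_unique (length X') (nt nil phi X) Y); auto using tower_nt.
  - apply nt_ext; intros y Hy. apply nt_interp; auto.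
    apply Permutation_in with Y; [now symmetry|easy].
  - intros z; apply nt_high. now rewrite E.
  - rewrite <- (Permutation_length HP), E; easy.
Qed.

(** The two interpolants agree on [Z], so their difference is a multiple of the product over [Z];
    the top derivative gives the factor. *)
Lemma nt_swap (phi : R -> R) (u v : R) (Z : list R) (k : nat) (x : R) :
  NoDup (u :: v :: Z) ->
  nt nil phi (u :: Z) k x - nt nil phi (v :: Z) k x
  = (dd phi (u :: Z) - dd phi (v :: Z)) * pt Z k x.
Proof.
  intros HN. apply NoDup_cons_iff in HN as [Hu HN']. apply NoDup_cons_iff in HN' as HN''.
  destruct HN'' as [Hv HZ].
  assert (HuZ : NoDup (u :: Z)) by (constructor; auto; intros H; apply Hu; now right).
  apply Rminus_diag_uniq. set (c := dd phi (u :: Z) - dd phi (v :: Z)).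
  set (D := fun i t => nt nil phi (u :: Z) i t - nt nil phi (v :: Z) i t - c * pt Z i t).
  assert (HD : forall n, tower n D).
  { intros n; apply tower_sub; [apply tower_sub; apply tower_nt|apply tower_scal, tower_pt]. }
  apply (tower_ext k D (fun _ _ => 0)); auto using tower_0.
  apply (tower_vanish (length Z) D Z); auto.
  - intros t. unfold D. rewrite !(nt_top phi _ (length Z)), pt_top; auto. unfold c; ring.
  - intros z Hz. unfold D. rewrite (pt_0_root Z z Hz), !nt_interp; auto; try (now right). ring.
Qed.

(* Exchanging the points of [A] for those of [B] one at a time: each exchange changes the Newton
   polynomial by a difference of divided differences times a product of linear factors. *)
Lemma nt_close_disjoint (m : nat) (phi : R -> R) (S0 : R -> Prop) (e D x : R) (k : nat) :
  (forall X Y, pts_in S0 (S m) X -> pts_in S0 (S m) Y -> Rabs (dd phi X - dd phi Y) <= e) ->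
  (forall z, S0 z -> Rabs (x - z) <= D) -> 0 <= D -> 0 <= e ->
  forall A B C, length A = length B -> NoDup (A ++ B ++ C) -> length (A ++ C) = S m ->
    (forall z, In z (A ++ B ++ C) -> S0 z) ->
    Rabs (nt nil phi (A ++ C) k x - nt nil phi (B ++ C) k x)
    <= INR (length A) * (e * (INR (fact (S m)) * D ^ (m - k))).
Proof.
  intros Hosc HD HD0 He. induction A as [|u A IH]; intros B C Hl HN Hm HS.
  - destruct B; [|easy]. unfold Rminus. rewrite Rplus_opp_r, Rabs_R0. simpl; lra.
  - destruct B as [|v B]; [easy|]. cbn [app] in *.
    assert (Hi : forall z, In z (A ++ v :: B ++ C) <-> z = v \/ In z A \/ In z B \/ In z C).
    { intros z. rewrite in_app_iff; simpl. rewrite in_app_iff. intuition. }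
    apply NoDup_cons_iff in HN as [Hu HN].
    assert (HN2 : NoDup (v :: A ++ B ++ C)).
    { eapply Permutation_NoDup; [|exact HN]. symmetry; apply Permutation_middle. }
    apply NoDup_cons_iff in HN2 as HN2'; destruct HN2' as [Hv HN3].
    assert (HAC : NoDup (A ++ C)).
    { apply NoDup_app_remove_l with B.
      eapply Permutation_NoDup; [|exact HN3].
      rewrite !app_assoc. apply Permutation_app_tail, Permutation_app_comm. }
    assert (HvA : ~ In v (A ++ C)) by (intros H; apply Hv; rewrite !in_app_iff in *; tauto).
    assert (HuA : ~ In u (v :: A ++ C)).
    { intros H; apply Hu, Hi. simpl in H; rewrite in_app_iff in H; intuition. }
    assert (HuA' : ~ In u (A ++ C)) by (intros H; apply HuA; now right).
    cbn [length] in *. injection Hm as Hm. injection Hl as Hl.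
    rewrite S_INR, Rmult_plus_distr_r, Rmult_1_l, Rplus_comm.
    replace (nt nil phi (u :: A ++ C) k x - nt nil phi (v :: B ++ C) k x)
      with ((nt nil phi (u :: A ++ C) k x - nt nil phi (v :: A ++ C) k x)
            + (nt nil phi (A ++ v :: C) k x - nt nil phi (B ++ v :: C) k x)).
    2: { rewrite <- (nt_perm phi (v :: A ++ C) (A ++ v :: C)), <- (nt_perm phi (v :: B ++ C) (B ++ v :: C)).
         - ring.
         - apply NoDup_cons_iff; split.
           + intros H; apply Hv; rewrite !in_app_iff in *; tauto.
           + now apply NoDup_app_remove_l in HN3.
         - apply Permutation_middle.
         - now apply NoDup_cons_iff.
         - apply Permutation_middle. }
    eapply Rle_trans; [apply Rabs_triang|]. apply Rplus_le_compat.
    + rewrite nt_swap by (apply NoDup_cons_iff; split; [easy|now apply NoDup_cons_iff]).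
      rewrite Rabs_mult. apply Rmult_le_compat; try apply Rabs_pos.
      * apply Hosc; repeat split; simpl; try (now rewrite Hm).
        -- now apply NoDup_cons_iff.
        -- intros z [<-|Hz]; apply HS; [now left|]. right; apply Hi. rewrite in_app_iff in Hz; tauto.
        -- now apply NoDup_cons_iff.
        -- intros z [<-|Hz]; apply HS; right; apply Hi; [tauto|]. rewrite in_app_iff in Hz; tauto.
      * rewrite <- Hm. apply pt_bound; auto. intros z Hz; apply HD, HS; right; apply Hi.
        rewrite in_app_iff in Hz; tauto.
    + apply IH; auto.
      * eapply Permutation_NoDup; [|exact HN2].
        rewrite !app_assoc. apply Permutation_middle.
      * rewrite length_app in *. cbn [length]. lia.
      * intros z Hz; apply HS; right. apply Hi. rewrite !in_app_iff in Hz. simpl in Hz. intuition.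
Qed.

(** The exchange argument needs all nodes distinct, so nodes common to [X] and [Y] are set aside in
    [C] and never moved. *)
Lemma common_part (X Y : list R) :
  NoDup X -> NoDup Y -> length X = length Y ->
  exists A B C, Permutation X (A ++ C) /\ Permutation Y (B ++ C) /\
    NoDup (A ++ B ++ C) /\ length A = length B.
Proof.
  intros HX HY Hl.
  set (inb := fun L z => if in_dec Req_dec_T z L then true else false).
  assert (Hb : forall L z, inb L z = true <-> In z L).
  { intros L z; unfold inb; destruct (in_dec Req_dec_T z L); intuition; discriminate. }
  assert (Hb' : forall L z, negb (inb L z) = true <-> ~ In z L).
  { intros L z; unfold inb; destruct (in_dec Req_dec_T z L); simpl; intuition; discriminate. }
  set (A := filter (fun z => negb (inb Y z)) X).
  set (B := filter (fun z => negb (inb X z)) Y).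
  set (C := filter (inb Y) X).
  assert (HA : forall z, In z A <-> In z X /\ ~ In z Y) by (intros z; unfold A; now rewrite filter_In, Hb').
  assert (HB : forall z, In z B <-> In z Y /\ ~ In z X) by (intros z; unfold B; now rewrite filter_In, Hb').
  assert (HC : forall z, In z C <-> In z X /\ In z Y) by (intros z; unfold C; now rewrite filter_In, Hb).
  assert (NA : NoDup A) by now apply NoDup_filter.
  assert (NB : NoDup B) by now apply NoDup_filter.
  assert (NC : NoDup C) by now apply NoDup_filter.
  assert (NBC : NoDup (B ++ C)).
  { apply NoDup_app; auto. intros z; rewrite HB, HC; tauto. }
  assert (PX : Permutation X (A ++ C)).
  { apply NoDup_Permutation; auto.
    - apply NoDup_app; auto. intros z; rewrite HA, HC; tauto.
    - intros z; rewrite in_app_iff, HA, HC. destruct (in_dec Req_dec_T z Y); tauto. }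
  assert (PY : Permutation Y (B ++ C)).
  { apply NoDup_Permutation; auto.
    intros z; rewrite in_app_iff, HB, HC. destruct (in_dec Req_dec_T z X); tauto. }
  exists A, B, C; repeat split; auto.
  - apply NoDup_app; auto. intros z; rewrite in_app_iff, HA, HB, HC; tauto.
  - apply Permutation_length in PX, PY. rewrite length_app in PX, PY. lia.
Qed.

(** At most [m + 1] exchanges, each costing the factorial of [pt_bound]. *)
Definition close_const (m : nat) : R := INR (S m) * INR (fact (S m)).

Lemma close_const_ge_1 (m : nat) : 1 <= close_const m.
Proof.
  unfold close_const. assert (1 <= INR (S m)) by (apply (le_INR 1); lia).
  assert (1 <= INR (fact (S m))) by (apply (le_INR 1), lt_O_fact). nra.
Qed.

Lemma nt_close (m : nat) (phi : R -> R) (S0 : R -> Prop) (e D x : R) (k : nat) (X Y : list R) :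
  (forall X Y, pts_in S0 (S m) X -> pts_in S0 (S m) Y -> Rabs (dd phi X - dd phi Y) <= e) ->
  (forall z, S0 z -> Rabs (x - z) <= D) -> 0 <= D -> 0 <= e ->
  pts_in S0 (S m) X -> pts_in S0 (S m) Y ->
  Rabs (nt nil phi X k x - nt nil phi Y k x) <= close_const m * (e * D ^ (m - k)).
Proof.
  intros Hosc HD HD0 He [NX [LX SX]] [NY [LY SY]].
  destruct (common_part X Y) as [A [B [C [PX [PY [HN HL]]]]]]; auto; [congruence|].
  rewrite (nt_perm phi X _ k x NX PX), (nt_perm phi Y _ k x NY PY).
  assert (HAC : length (A ++ C) = S m) by (apply Permutation_length in PX; congruence).
  eapply Rle_trans; [apply (nt_close_disjoint m phi S0 e D); auto|].
  - intros z Hz. rewrite !in_app_iff in Hz. destruct Hz as [Hz|[Hz|Hz]].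
    + apply SX. apply (Permutation_in (l := A ++ C)); [now symmetry|]. apply in_or_app; now left.
    + apply SY. apply (Permutation_in (l := B ++ C)); [now symmetry|]. apply in_or_app; now left.
    + apply SX. apply (Permutation_in (l := A ++ C)); [now symmetry|]. apply in_or_app; now right.
  - unfold close_const. rewrite length_app in HAC.
    assert (Hp : 0 <= D ^ (m - k)) by now apply pow_le.
    assert (Hq : 0 <= e * (INR (fact (S m)) * D ^ (m - k))).
    { apply Rmult_le_pos; auto. apply Rmult_le_pos; auto. apply pos_INR. }
    assert (Hr : INR (length A) <= INR (S m)) by (apply le_INR; lia).
    nra.
Qed.

(** * Diameters and node sets near accumulation points *)

Lemma diam_between (l : list R) (lo hi : R) :
  l <> nil -> (forall x, In x l -> lo <= x <= hi) -> lo <= lmin l /\ lmax l <= hi.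
Proof.
  intros Hl H. assert (Hh : lo <= hd 0 l <= hi) by (destruct l; [easy|]; apply H; now left).
  unfold lmin, lmax. revert H Hh. generalize (hd 0 l); intros z H Hz. clear Hl.
  induction l as [|u l IH]; simpl; [lra|].
  assert (Hu := H u (or_introl eq_refl)).
  specialize (IH ltac:(intros; apply H; now right)).
  split; [apply Rmin_glb|apply Rmax_lub]; lra.
Qed.

Lemma diam_le (l : list R) (lo hi : R) :
  l <> nil -> (forall x, In x l -> lo <= x <= hi) -> diam l <= hi - lo.
Proof. intros Hl H. destruct (diam_between l lo hi Hl H). unfold diam; lra. Qed.

Lemma diam_ge (l : list R) (x y : R) : In x l -> In y l -> y - x <= diam l.
Proof.
  intros Hx Hy. apply in_lmin_lmax in Hx, Hy. unfold diam; lra.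
Qed.

Definition accum (K : R -> Prop) (a : R) : Prop := K a /\ ~ isolated_pt K a.

(** [av] holds points to be avoided: the induction adds the points found so far, and a prescribed
    far node can be excluded as well. *)
Lemma accum_points (K : R -> Prop) (a rho : R) (n : nat) (av : list R) :
  accum K a -> 0 < rho -> exists X, length X = n /\ NoDup X /\
    forall x, In x X -> K x /\ x <> a /\ ~ In x av /\ Rabs (x - a) <= rho.
Proof.
  intros [Ka Hni]. revert rho av. 
  assert (Hone : forall rho av, 0 < rho ->
     exists y, K y /\ y <> a /\ ~ In y av /\ Rabs (y - a) <= rho).
  { intros rho av Hr.
    assert (Hmin : exists r, 0 < r <= rho /\ forall y, In y av -> y <> a -> r <= Rabs (y - a)).
    { induction av as [|z av [r [Hr1 Hr2]]]; [exists rho; split; [lra|easy]|].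
      destruct (Req_dec z a) as [->|Hz].
      - exists r; split; [lra|]. intros y [<-|Hy] Hya; [easy|auto].
      - assert (0 < Rabs (z - a)) by (apply Rabs_pos_lt; lra).
        exists (Rmin r (Rabs (z - a))); split.
        + split; [apply Rmin_pos; lra|]. eapply Rle_trans; [apply Rmin_l|lra].
        + intros y [<-|Hy] Hya; [apply Rmin_r|]. eapply Rle_trans; [apply Rmin_l|auto]. }
    destruct Hmin as [r [Hr1 Hr2]].
    apply NNPP; intros Hno. apply Hni. split; [easy|]. exists r; split; [lra|].
    intros y Ky Hya. apply NNPP; intros Hne. apply Hno. exists y; repeat split; auto.
    - intros Hav. specialize (Hr2 y Hav Hne). lra.
    - lra. }
  induction n as [|n IH]; intros rho av Hr.
  - exists nil; repeat split; [constructor|easy|easy|easy|easy].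
  - destruct (Hone rho av Hr) as [y [H1 [H2 [H3 H4]]]].
    destruct (IH rho (y :: av) Hr) as [X [L [N H]]].
    exists (y :: X); repeat split.
    + simpl; now rewrite L.
    + constructor; auto. intros Hy. apply H in Hy. apply Hy; now left.
    + destruct H0 as [<-|Hx]; [easy|apply H, Hx].
    + destruct H0 as [<-|Hx]; [easy|apply H, Hx].
    + destruct H0 as [<-|Hx]; [easy|]. intros Hav. apply (H x Hx). now right.
    + destruct H0 as [<-|Hx]; [easy|apply H, Hx].
Qed.

(** All nodes but [b] cluster at [a], so one Newton polynomial can be compared with the jets at both
    points: this is how Whitney's conditions between [a] and [b] are obtained. *)
Lemma accum_config (K : R -> Prop) (a b rho : R) (m : nat) :
  accum K a -> K b -> a <> b -> 0 < rho -> (0 < m)%nat ->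
  exists X, pts_in K (S m) X /\ In a X /\ In b X /\
    forall x, In x X -> x = b \/ Rabs (x - a) <= rho.
Proof.
  intros Ha Kb Hab Hr Hm.
  destruct (accum_points K a rho (m - 1) (b :: nil) Ha Hr) as [X [L [N H]]].
  exists (a :: b :: X). split; [|split; [now left|split; [right; now left|]]].
  - repeat split.
    + constructor; [intros [E|E]; [congruence|apply H in E; tauto]|].
      constructor; auto. intros E; apply H in E; simpl in E; tauto.
    + simpl; lia.
    + intros x [<-|[<-|Hx]]; [apply Ha|easy|apply H, Hx].
  - intros x [<-|[<-|Hx]]; [right|now left|right; apply H, Hx].
    rewrite Rminus_diag, Rabs_R0. lra.
Qed.

Lemma accum_config1 (K : R -> Prop) (a rho : R) (m : nat) :
  accum K a -> 0 < rho ->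
  exists X, pts_in K (S m) X /\ In a X /\ forall x, In x X -> Rabs (x - a) <= rho.
Proof.
  intros Ha Hr.
  destruct (accum_points K a rho m nil Ha Hr) as [X [L [N H]]].
  exists (a :: X). split; [|split; [now left|]].
  - repeat split.
    + constructor; auto. intros E; apply H in E; tauto.
    + simpl; lia.
    + intros x [<-|Hx]; [apply Ha|apply H, Hx].
  - intros x [<-|Hx]; [|apply H, Hx]. rewrite Rminus_diag, Rabs_R0. lra.
Qed.

(** * Jets on the accumulation points *)

Definition in_ball (X : list R) (c rho : R) : Prop := forall x, In x X -> Rabs (x - c) <= rho.

Lemma Rabs_le_between (x c r : R) : Rabs (x - c) <= r <-> c - r <= x <= c + r.
Proof. unfold Rabs; destruct Rcase_abs; lra. Qed.

Lemma nt_close_ball (m : nat) (K : R -> Prop) (phi : R -> R) :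
  dd_unif_conv m K phi ->
  forall e, 0 < e -> exists delta, 0 < delta /\ forall c rho X Y x k,
    0 < rho < delta -> pts_in K (S m) X -> pts_in K (S m) Y ->
    in_ball X c rho -> in_ball Y c rho -> Rabs (x - c) <= rho ->
    Rabs (nt nil phi X k x - nt nil phi Y k x) <= e * rho ^ (m - k).
Proof.
  intros Hdd e He. assert (HC := close_const_ge_1 m).
  assert (H2 : 0 < 2 ^ m) by (apply pow_lt; lra).
  (* Inside the ball, [x] is within [2 rho] of every node; [2^m] absorbs the powers of 2. *)
  set (e' := e / (close_const m * 2 ^ m)).
  assert (He' : 0 < e').
  { apply Rdiv_lt_0_compat; [easy|]. apply Rmult_lt_0_compat; lra. }
  destruct (Hdd e' He') as [delta [Hd H]].
  exists (delta / 2); split; [lra|]. intros c rho X Y x k Hr HX HY BX BY Hx.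
  eapply Rle_trans.
  - apply (nt_close m phi (fun z => K z /\ Rabs (z - c) <= rho) e' (2 * rho)); try lra.
    + intros X0 Y0 [N1 [L1 S1]] [N2 [L2 S2]]. apply Rlt_le, H.
      * repeat split; auto. intros z Hz; apply S1, Hz.
      * repeat split; auto. intros z Hz; apply S2, Hz.
      * eapply Rle_lt_trans; [apply (diam_le _ (c - rho) (c + rho))|lra].
        -- destruct X0; easy.
        -- intros z Hz. apply Rabs_le_between. apply in_app_or in Hz.
           destruct Hz as [Hz|Hz]; [apply S1, Hz|apply S2, Hz].
    + intros z [_ Hz]. apply Rabs_le_between in Hx, Hz. apply Rabs_le; lra.
    + destruct HX as [N1 [L1 S1]]; split; [|split]; auto.
    + destruct HY as [N1 [L1 S1]]; split; [|split]; auto.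
  - rewrite Rpow_mult_distr.
    assert (Hp : 2 ^ (m - k) <= 2 ^ m) by (apply Rle_pow; [lra|lia]).
    assert (Hq : 0 <= rho ^ (m - k)) by (apply pow_le; lra).
    assert (Hee : close_const m * (e' * 2 ^ m) = e) by (unfold e'; field; lra).
    rewrite <- Hee, <- !Rmult_assoc. apply Rmult_le_compat_r; auto.
    apply Rmult_le_compat_l; auto. apply Rmult_le_pos; lra.
Qed.

(** The rate [rho^(m - k)] is Whitney's, uniform over the accumulation points; [j] is free
    elsewhere. *)
Definition jet_of (m : nat) (K : R -> Prop) (phi : R -> R) (j : nat -> R -> R) : Prop :=
  forall e, 0 < e -> exists delta, 0 < delta /\ forall a rho X k,
    accum K a -> 0 < rho < delta -> pts_in K (S m) X -> in_ball X a rho -> (k <= m)%nat ->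
    Rabs (nt nil phi X k a - j k a) <= e * rho ^ (m - k).

Lemma pow_le_1 (x : R) (n : nat) : 0 <= x <= 1 -> x ^ n <= 1.
Proof. intros Hx. rewrite <- (pow1 n). now apply pow_incr. Qed.

Lemma jet_exists (m : nat) (K : R -> Prop) (phi : R -> R) :
  dd_unif_conv m K phi -> exists j, jet_of m K phi j.
Proof.
  intros Hdd.
  (* The limit [v] is described only along some shrinking node sets; [nt_close_ball] then transfers
     it to all of them. Orders and points are paired so that one choice gives the whole jet. *)
  assert (Hlim : forall ka : nat * R, exists v, accum K (snd ka) ->
    forall eta, 0 < eta -> forall rho, 0 < rho -> exists X, pts_in K (S m) X /\
      in_ball X (snd ka) rho /\ Rabs (nt nil phi X (fst ka) (snd ka) - v) <= eta).
  { intros [k a]; simpl. destruct (classic (accum K a)) as [Ha|Ha]; [|now exists 0].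
    assert (Hseq : forall n : nat, exists X, pts_in K (S m) X /\ in_ball X a (/ INR (S n))).
    { intros n. destruct (accum_config1 K a (/ INR (S n)) m Ha) as [X [H1 [_ H2]]].
      - apply Rinv_0_lt_compat, lt_0_INR; lia.
      - now exists X. }
    destruct (functional_choice _ Hseq) as [X HX].
    destruct (Rcomplete.R_complete (fun n => nt nil phi (X n) k a)) as [v Hv].
    - intros e He.
      destruct (nt_close_ball m K phi Hdd (e / 2) ltac:(lra)) as [d [Hd H]].
      destruct (archimed_cor1 (Rmin (d / 2) 1)) as [N [HN1 HN2]].
      { apply Rmin_pos; lra. }
      assert (HN : 0 < / INR N) by (apply Rinv_0_lt_compat, lt_0_INR; lia).
      assert (HNd : / INR N < d) by (eapply Rlt_le_trans; [apply HN1|]; pose proof (Rmin_l (d/2) 1); lra).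
      assert (HN1' : / INR N <= 1) by (pose proof (Rmin_r (d/2) 1); lra).
      assert (Hb : forall n, (n >= N)%nat -> in_ball (X n) a (/ INR N)).
      { intros n Hn x Hx. eapply Rle_trans; [apply (HX n), Hx|].
        apply Rinv_le_contravar; [apply lt_0_INR; lia|apply le_INR; lia]. }
      exists N. intros n p Hn Hp. unfold Rdist. eapply Rle_lt_trans.
      + apply (H a (/ INR N)); try apply HX; auto. rewrite Rminus_diag, Rabs_R0; lra.
      + assert ((/ INR N) ^ (m - k) <= 1) by (apply pow_le_1; lra). nra.
    - exists v. intros _ eta Heta rho Hrho.
      destruct (Hv eta Heta) as [N1 HN1].
      destruct (archimed_cor1 rho Hrho) as [N [HN2 HN3]].
      exists (X (N1 + N)%nat). split; [apply HX|split].
      + intros x Hx. eapply Rle_trans; [apply (HX (N1 + N)%nat), Hx|].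
        apply Rlt_le, Rle_lt_trans with (/ INR N); [|easy].
        apply Rinv_le_contravar; [apply lt_0_INR; lia|apply le_INR; lia].
      + apply Rlt_le, HN1. lia. }
  destruct (functional_choice _ Hlim) as [j Hj].
  exists (fun k a => j (k, a)). intros e He.
  destruct (nt_close_ball m K phi Hdd e He) as [d [Hd H]].
  exists d; split; [easy|]. intros a rho X k Ha Hr HX BX _.
  apply Rle_plus_epsilon. intros eta Heta.
  destruct (Hj (k, a) Ha eta Heta rho ltac:(lra)) as [Y [HY [BY HYv]]]. simpl in HYv, BY.
  replace (nt nil phi X k a - j (k, a)) with
    ((nt nil phi X k a - nt nil phi Y k a) + (nt nil phi Y k a - j (k, a))) by ring.
  eapply Rle_trans; [apply Rabs_triang|]. apply Rplus_le_compat; [|easy].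
  apply (H a rho); auto. rewrite Rminus_diag, Rabs_R0; lra.
Qed.

Lemma cont_eps (f : R -> R) (x e : R) :
  continuous f x -> 0 < e -> exists d, 0 < d /\ forall y, Rabs (y - x) < d -> Rabs (f y - f x) < e.
Proof.
  intros Hf He. apply continuity_pt_filterlim in Hf.
  destruct (Hf e He) as [d [Hd H]]. exists d; split; [easy|].
  intros y Hy. destruct (Req_dec y x) as [->|Hn].
  - now rewrite Rminus_diag, Rabs_R0.
  - apply H. split; [|easy]. split; [constructor|congruence].
Qed.

(** Nodes and evaluation point vary together. A reference node set [X0] is fixed before [delta], so
    that only the continuity of one polynomial is used. *)
Lemma jet_local (m : nat) (K : R -> Prop) (phi : R -> R) (j : nat -> R -> R) (a e : R) (k : nat) :
  dd_unif_conv m K phi -> jet_of m K phi j -> accum K a -> (k <= m)%nat -> 0 < e ->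
  exists delta, 0 < delta /\ forall X x, pts_in K (S m) X -> in_ball X a delta ->
    Rabs (x - a) <= delta -> Rabs (nt nil phi X k x - j k a) <= e.
Proof.
  intros Hdd Hj Ha Hk He.
  destruct (nt_close_ball m K phi Hdd (e / 3) ltac:(lra)) as [d1 [Hd1 H1]].
  destruct (Hj (e / 3) ltac:(lra)) as [d2 [Hd2 H2]].
  set (rho := Rmin (Rmin (d1 / 2) (d2 / 2)) 1).
  assert (Hr : 0 < rho) by (repeat apply Rmin_pos; lra).
  assert (Hr1 : rho < d1).
  { eapply Rle_lt_trans; [apply Rmin_l|]. eapply Rle_lt_trans; [apply Rmin_l|]. lra. }
  assert (Hr2 : rho < d2).
  { eapply Rle_lt_trans; [apply Rmin_l|]. eapply Rle_lt_trans; [apply Rmin_r|]. lra. }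
  assert (Hr3 : rho <= 1) by apply Rmin_r.
  assert (Hp : rho ^ (m - k) <= 1) by (apply pow_le_1; lra).
  destruct (accum_config1 K a rho m Ha Hr) as [X0 [HX0 [_ BX0]]].
  destruct (cont_eps (nt nil phi X0 k) a (e / 3)) as [d3 [Hd3 H3]]; [|lra|].
  { apply (tower_cont m); [apply tower_nt|easy]. }
  set (d := Rmin rho (d3 / 2)).
  assert (Hdr : d <= rho) by apply Rmin_l. assert (Hd3' : d <= d3 / 2) by apply Rmin_r.
  assert (Hd : 0 < d) by (apply Rmin_pos; lra).
  exists d; split; [easy|]. intros X x HX BX Hx.
  assert (BX' : in_ball X a rho) by (intros y Hy; specialize (BX y Hy); lra).
  specialize (H1 a rho X X0 x k (conj Hr Hr1) HX HX0 BX' BX0 ltac:(lra)).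
  specialize (H2 a rho X0 k Ha (conj Hr Hr2) HX0 BX0 Hk).
  specialize (H3 x ltac:(lra)).
  replace (nt nil phi X k x - j k a) with ((nt nil phi X k x - nt nil phi X0 k x)
    + (nt nil phi X0 k x - nt nil phi X0 k a) + (nt nil phi X0 k a - j k a)) by ring.
  eapply Rle_trans; [apply Rabs_triang|].
  eapply Rle_trans; [apply Rplus_le_compat_r, Rabs_triang|]. nra.
Qed.

Lemma jet_0 (m : nat) (K : R -> Prop) (phi : R -> R) (j : nat -> R -> R) (a : R) :
  jet_of m K phi j -> accum K a -> j O a = phi a.
Proof.
  intros Hj Ha. apply cond_eq. intros e He.
  destruct (Hj (e / 2) ltac:(lra)) as [d [Hd H]].
  set (rho := Rmin (d / 2) 1).
  assert (Hr : 0 < rho) by (apply Rmin_pos; lra).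
  assert (Hr1 : rho <= d / 2) by apply Rmin_l. assert (Hr2 : rho <= 1) by apply Rmin_r.
  destruct (accum_config1 K a rho m Ha Hr) as [X [HX [Hin BX]]].
  specialize (H a rho X O Ha ltac:(lra) HX BX ltac:(lia)).
  rewrite nt_interp in H; [|apply HX|easy]. rewrite Rabs_minus_sym in H.
  assert (rho ^ (m - 0) <= 1) by (apply pow_le_1; lra). nra.
Qed.

Lemma config_balls (X : list R) (a b : R) :
  (forall x, In x X -> x = b \/ Rabs (x - a) <= Rabs (b - a)) ->
  in_ball X a (Rabs (b - a)) /\ in_ball X b (2 * Rabs (b - a)).
Proof.
  intros H; split; intros x Hx; destruct (H x Hx) as [->|Hxa]; try lra.
  - rewrite Rminus_diag, Rabs_R0. pose proof (Rabs_pos (b - a)); lra.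
  - replace (x - b) with ((x - a) - (b - a)) by ring.
    eapply Rle_trans; [apply Rabs_triang|]. rewrite Rabs_Ropp; lra.
Qed.

Lemma between_abs (a b c : R) : Rmin a b <= c <= Rmax a b -> Rabs (c - a) <= Rabs (b - a).
Proof.
  unfold Rmin, Rmax; destruct Rle_dec; intros H; unfold Rabs; repeat destruct Rcase_abs; lra.
Qed.

(** A Newton polynomial on [a], [b] and nodes near [a] obeys the mean value theorem, and it matches
    both jets up to a multiple of [e t^(m-k)] with [t = |b - a|], which is of order [e t] because
    [k < m]. *)
Lemma jet_derivative (m : nat) (K : R -> Prop) (phi : R -> R) (j : nat -> R -> R) (a e : R) (k : nat) :
  dd_unif_conv m K phi -> jet_of m K phi j -> accum K a -> (k < m)%nat -> 0 < e ->
  exists delta, 0 < delta /\ forall b, accum K b -> Rabs (b - a) < delta ->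
    Rabs (j k b - j k a - j (S k) a * (b - a)) <= e * Rabs (b - a).
Proof.
  intros Hdd Hj Ha Hk He.
  (* The errors at [a], at [b] (where the radius doubles) and in the slope add up to
     [e/6 + e/3 + e/2 = e] times [t]. *)
  destruct (Hj (e / 6) ltac:(lra)) as [d1 [Hd1 H1]].
  destruct (jet_local m K phi j a (e / 2) (S k) Hdd Hj Ha ltac:(lia) ltac:(lra)) as [d2 [Hd2 H2]].
  set (d := Rmin (Rmin (d1 / 2) d2) (1 / 2)).
  assert (Hd : 0 < d) by (repeat apply Rmin_pos; lra).
  assert (Ed1 : d <= d1 / 2) by (eapply Rle_trans; [apply Rmin_l|apply Rmin_l]).
  assert (Ed2 : d <= d2) by (eapply Rle_trans; [apply Rmin_l|apply Rmin_r]).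
  assert (Ed3 : d <= 1 / 2) by apply Rmin_r.
  exists d; split; [easy|]. intros b Hb Hbd.
  destruct (Req_dec a b) as [<-|Hab].
  { rewrite !Rminus_diag, Rmult_0_r, Rminus_diag, Rabs_R0. lra. }
  set (t := Rabs (b - a)) in *.
  assert (Ht : 0 < t) by (apply Rabs_pos_lt; lra).
  destruct (accum_config K a b t m Ha (proj1 Hb) Hab Ht ltac:(lia)) as [X [HX [_ [_ HXb]]]].
  destruct (config_balls X a b HXb) as [Ba Bb]. fold t in Ba, Bb.
  assert (Q1 := H1 a t X k Ha ltac:(lra) HX Ba ltac:(lia)).
  assert (Q2 := H1 b (2 * t) X k Hb ltac:(lra) HX Bb ltac:(lia)).
  assert (P1 : t ^ (m - k) <= t).
  { replace (m - k)%nat with (S (m - k - 1)) by lia. simpl.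
    assert (t ^ (m - k - 1) <= 1) by (apply pow_le_1; lra).
    nra. }
  assert (P2 : (2 * t) ^ (m - k) <= 2 * t).
  { replace (m - k)%nat with (S (m - k - 1)) by lia. simpl.
    assert ((2 * t) ^ (m - k - 1) <= 1) by (apply pow_le_1; lra).
    nra. }
  destruct (mean_value (nt nil phi X k) (nt nil phi X (S k)) a b) as [c [Hc Hcv]].
  { intros x. apply (tower_der (S k)); [apply tower_nt|lia]. }
  apply between_abs in Hc. fold t in Hc.
  assert (Q3 := H2 X c HX ltac:(intros z Hz; specialize (Ba z Hz); lra) ltac:(lra)).
  replace (j k b - j k a - j (S k) a * (b - a)) with
    ((nt nil phi X k a - j k a) + ((nt nil phi X (S k) c - j (S k) a) * (b - a)
     + - (nt nil phi X k b - j k b))) by lra.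
  eapply Rle_trans; [apply Rabs_triang|]. eapply Rle_trans; [apply Rplus_le_compat_l, Rabs_triang|].
  rewrite Rabs_Ropp, Rabs_mult. fold t.
  assert (Rabs (nt nil phi X (S k) c - j (S k) a) * t <= e / 2 * t) by (apply Rmult_le_compat_r; lra).
  nra.
Qed.

(** Needed for the top order [m], which the derivative relation does not reach. *)
Lemma jet_continuous (m : nat) (K : R -> Prop) (phi : R -> R) (j : nat -> R -> R) (a e : R) (k : nat) :
  (0 < m)%nat ->
  dd_unif_conv m K phi -> jet_of m K phi j -> accum K a -> (k <= m)%nat -> 0 < e ->
  exists delta, 0 < delta /\ forall b, accum K b -> Rabs (b - a) < delta ->
    Rabs (j k b - j k a) <= e.
Proof.
  intros Hm Hdd Hj Ha Hk He.
  destruct (Hj (e / 2) ltac:(lra)) as [d1 [Hd1 H1]].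
  destruct (jet_local m K phi j a (e / 2) k Hdd Hj Ha Hk ltac:(lra)) as [d2 [Hd2 H2]].
  set (d := Rmin (Rmin (d1 / 2) d2) (1 / 2)).
  assert (Hd : 0 < d) by (repeat apply Rmin_pos; lra).
  assert (Ed1 : d <= d1 / 2) by (eapply Rle_trans; [apply Rmin_l|apply Rmin_l]).
  assert (Ed2 : d <= d2) by (eapply Rle_trans; [apply Rmin_l|apply Rmin_r]).
  assert (Ed3 : d <= 1 / 2) by apply Rmin_r.
  exists d; split; [easy|]. intros b Hb Hbd.
  destruct (Req_dec a b) as [<-|Hab].
  { rewrite Rminus_diag, Rabs_R0. lra. }
  set (t := Rabs (b - a)) in *.
  assert (Ht : 0 < t) by (apply Rabs_pos_lt; lra).
  destruct (accum_config K a b t m Ha (proj1 Hb) Hab Ht Hm) as [X [HX [_ [_ HXb]]]].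
  destruct (config_balls X a b HXb) as [Ba Bb]. fold t in Ba, Bb.
  assert (Q2 := H1 b (2 * t) X k Hb ltac:(lra) HX Bb Hk).
  assert (P2 : (2 * t) ^ (m - k) <= 1) by (apply pow_le_1; lra).
  assert (Q3 := H2 X b HX ltac:(intros z Hz; specialize (Ba z Hz); lra) ltac:(fold t; lra)).
  replace (j k b - j k a) with
    ((nt nil phi X k b - j k a) + - (nt nil phi X k b - j k b)) by lra.
  eapply Rle_trans; [apply Rabs_triang|]. rewrite Rabs_Ropp. nra.
Qed.

(** * Corrections on the unit interval *)

Lemma pt_repeat_low (z : R) (n : nat) (W : list R) (k : nat) :
  (k < n)%nat -> pt (repeat z n ++ W) k z = 0.
Proof.
  revert k; induction n as [|n IH]; intros k Hk; [lia|].
  cbn [repeat app pt]. destruct k as [|k]; [simpl; ring|].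
  cbn [pred]. rewrite (IH k) by lia. ring.
Qed.

Lemma pt_repeat_eq (z : R) (n : nat) (W : list R) :
  pt (repeat z n ++ W) n z = INR (fact n) * pt W 0 z.
Proof.
  induction n as [|n IH]; [cbn; ring|].
  cbn [repeat app pt pred]. rewrite IH, fact_simpl, mult_INR. ring.
Qed.

Lemma pt_prefix_0 (m : nat) (A W : list R) (x : R) :
  (forall k, (k <= m)%nat -> pt W k x = 0) ->
  forall k, (k <= m)%nat -> pt (A ++ W) k x = 0.
Proof.
  intros H; induction A as [|z A IH]; intros k Hk; [now apply H|].
  cbn [app pt]. rewrite !IH by lia. ring.
Qed.

Lemma pt_repeat_0 (z : R) (n : nat) (x : R) : pt (repeat z n) 0 x = (x - z) ^ n.
Proof. induction n as [|n IH]; cbn [repeat pt pow INR]; [easy|]. rewrite IH; ring. Qed.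

Lemma pt_unit_bound (Z : list R) (x : R) (k : nat) :
  (forall z, In z Z -> 0 <= z <= 1) -> 0 <= x <= 1 ->
  Rabs (pt Z k x) <= INR (fact (S (length Z))).
Proof.
  intros HZ Hx. eapply Rle_trans; [apply (pt_bound Z x 1); [|lra]|].
  - intros z Hz; specialize (HZ z Hz); apply Rabs_le; lra.
  - rewrite pow1; lra.
Qed.

(* The coefficients of [(x - p)^n (x - q)^(m+1)], [n = 0, ..., m], solve a triangular system for the jet at [p]. *)
Lemma hermite_side (m : nat) (p q : R) :
  0 <= p <= 1 -> 0 <= q <= 1 -> Rabs (p - q) = 1 ->
  exists C, 0 <= C /\ forall e al, (forall k, (k <= m)%nat -> Rabs (al k) <= e) ->
    exists r, tower m r /\ forall k, (k <= m)%nat ->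
      r k p = al k /\ r k q = 0 /\ forall x, 0 <= x <= 1 -> Rabs (r k x) <= C * e.
Proof.
  intros Hp Hq Hpq.
  (* Induction on the number [i] of orders, counted from [m] down, at which the jet may be nonzero.
     The lowest of them, [n = m - i] in the step, is cancelled by a multiple of one basis
     polynomial, which affects only higher orders besides. *)
  assert (Hind : forall i, exists C, 0 <= C /\ forall e al,
    (forall k, (k <= m)%nat -> Rabs (al k) <= e) ->
    (forall k, (k + i <= m)%nat -> al k = 0) ->
    exists r, tower m r /\ forall k, (k <= m)%nat ->
      r k p = al k /\ r k q = 0 /\ forall x, 0 <= x <= 1 -> Rabs (r k x) <= C * e).
  { induction i as [|i [C [HC IH]]].
    - exists 0; split; [lra|]. intros e al _ Hz. exists (fun _ _ => 0); split; [apply tower_0|].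
      intros k Hk; repeat split; [symmetry; apply Hz; lia|]. intros; rewrite Rabs_R0; lra.
    - destruct (le_lt_dec i m) as [Hi|Hi].
      2: { exists C; split; [easy|]. intros e al He Hz. apply IH; auto. intros; lia. }
      set (n := (m - i)%nat). set (B := repeat p n ++ repeat q (S m)).
      set (Fb := INR (fact (S (length B)))).
      assert (HF : 0 <= Fb) by apply pos_INR.
      assert (HB : forall k x, 0 <= x <= 1 -> Rabs (pt B k x) <= Fb).
      { intros k x Hx; apply pt_unit_bound; auto. intros z Hz. apply in_app_or in Hz.
        destruct Hz as [Hz|Hz]; apply repeat_spec in Hz; subst; auto. }
      assert (Hden : Rabs (pt B n p) = INR (fact n)).
      { unfold B. rewrite pt_repeat_eq, pt_repeat_0, Rabs_mult, <- RPow_abs, Hpq, pow1.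
        rewrite Rabs_pos_eq by apply pos_INR. ring. }
      assert (Hfn : 1 <= INR (fact n)) by (apply (le_INR 1), lt_O_fact).
      (* The jet that remains is bounded by [(1 + Fb) e], and the added polynomial by [Fb e]. *)
      exists (C * (1 + Fb) + Fb); split; [nra|].
      intros e al He Hz.
      assert (He0 : 0 <= e) by (eapply Rle_trans; [apply Rabs_pos|apply (He O); lia]).
      set (c := al n / pt B n p).
      assert (Hn0 : pt B n p <> 0) by (intros E; rewrite E, Rabs_R0 in Hden; lra).
      assert (Hc : Rabs c <= e).
      { unfold c, Rdiv. rewrite Rabs_mult, Rabs_inv, Hden.
        assert (0 < / INR (fact n) <= 1).
        { split; [apply Rinv_0_lt_compat; lra|]. rewrite <- Rinv_1. apply Rinv_le_contravar; lra. }
        pose proof (He n ltac:(lia)). pose proof (Rabs_pos (al n)). nra. }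
      destruct (IH ((1 + Fb) * e) (fun k => al k - c * pt B k p)) as [r [Hr Hrk]].
      + intros k Hk. eapply Rle_trans; [apply Rabs_triang|]. rewrite Rabs_Ropp, Rabs_mult.
        specialize (He k Hk). specialize (HB k p Hp). pose proof (Rabs_pos (pt B k p)).
        pose proof (Rabs_pos c). nra.
      + intros k Hk. destruct (Nat.eq_dec k n) as [->|Hkn].
        * unfold c. field. exact Hn0.
        * rewrite Hz by lia. unfold B. rewrite pt_repeat_low by lia. ring.
      + exists (fun k x => r k x + c * pt B k x). split.
        { apply tower_add; [easy|apply tower_scal, tower_pt]. }
        intros k Hk. destruct (Hrk k Hk) as [H1 [H2 H3]]. repeat split.
        * rewrite H1. ring.
        * rewrite H2. unfold B. rewrite (pt_prefix_0 m) with (k := k); [ring| |easy].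
          intros k' Hk'. rewrite <- (app_nil_r (repeat q (S m))). apply pt_repeat_low; lia.
        * intros x Hx. eapply Rle_trans; [apply Rabs_triang|]. rewrite Rabs_mult.
          specialize (H3 x Hx). specialize (HB k x Hx).
          pose proof (Rabs_pos (pt B k x)). pose proof (Rabs_pos c). nra. }
  destruct (Hind (S m)) as [C [HC H]]. exists C; split; [easy|].
  intros e al He. apply H; auto. intros; lia.
Qed.

(** The bound is linear in the data, so small errors in the end jets cost small corrections in every
    derivative up to [m]. *)
Lemma hermite (m : nat) :
  exists C, 0 <= C /\ forall e al be,
    (forall k, (k <= m)%nat -> Rabs (al k) <= e /\ Rabs (be k) <= e) ->
    exists r, tower m r /\ forall k, (k <= m)%nat ->
      r k 0 = al k /\ r k 1 = be k /\ forall x, 0 <= x <= 1 -> Rabs (r k x) <= C * e.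
Proof.
  destruct (hermite_side m 0 1) as [C0 [HC0 H0]]; try lra.
  { rewrite Rminus_0_l, Rabs_Ropp, Rabs_R1; easy. }
  destruct (hermite_side m 1 0) as [C1 [HC1 H1]]; try lra.
  { rewrite Rminus_0_r, Rabs_R1; easy. }
  exists (C0 + C1); split; [lra|]. intros e al be H.
  destruct (H0 e al) as [r0 [T0 R0]]; [apply H|].
  destruct (H1 e be) as [r1 [T1 R1]]; [apply H|].
  exists (fun k x => r0 k x + r1 k x); split; [now apply tower_add|].
  intros k Hk. destruct (R0 k Hk) as [A1 [A2 A3]]. destruct (R1 k Hk) as [B1 [B2 B3]].
  repeat split; try lra. intros x Hx. eapply Rle_trans; [apply Rabs_triang|].
  specialize (A3 x Hx); specialize (B3 x Hx); lra.
Qed.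

(** * Weights flat at both ends, and bumps *)

Definition flat (m : nat) (p : nat -> R -> R) : Prop :=
  forall k, (k <= m)%nat -> p k 0 = 0 /\ p k 1 = 0.

Definition unit_le (m : nat) (p : nat -> R -> R) (c : R) : Prop :=
  forall k x, (k <= m)%nat -> 0 <= x <= 1 -> Rabs (p k x) <= c.

(* Even multiplicities make the product nonnegative. *)
Definition weight (m : nat) : list R :=
  repeat 0 (S m + S m) ++ repeat 1 (S m + S m).

Lemma weight_in (m : nat) (z : R) : In z (weight m) -> 0 <= z <= 1.
Proof.
  intros Hz; apply in_app_or in Hz; destruct Hz as [Hz|Hz]; apply repeat_spec in Hz; lra.
Qed.

Lemma weight_flat (m : nat) (Z : list R) : flat m (pt (weight m ++ Z)).
Proof.
  intros k Hk; unfold weight. rewrite <- app_assoc. split.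
  - apply pt_repeat_low; lia.
  - apply (pt_prefix_0 m); [|easy]. intros i Hi; apply pt_repeat_low; lia.
Qed.

Lemma weight_0 (m : nat) (x : R) :
  pt (weight m) 0 x = (x ^ S m) ^ 2 * ((1 - x) ^ S m) ^ 2.
Proof.
  unfold weight. rewrite pt_app_0, !pt_repeat_0, !pow_add, Rminus_0_r.
  assert (E : (x - 1) ^ S m * (x - 1) ^ S m = (1 - x) ^ S m * (1 - x) ^ S m).
  { rewrite <- !Rpow_mult_distr. f_equal; ring. }
  rewrite E; ring.
Qed.

(** The constant depends on the nodes alone; it will be used for a fixed grid. *)
Lemma dd_bound (X : list R) :
  X <> nil -> NoDup X -> exists C, 0 <= C /\
    forall phi M, (forall x, In x X -> Rabs (phi x) <= M) -> Rabs (dd phi X) <= C * M.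
Proof.
  remember (length X) as n eqn:Hn. revert X Hn.
  induction n as [|n IH]; intros X Hn HX HN; [now destruct X|].
  destruct X as [|x X]; [easy|]. cbn in Hn. injection Hn as Hn.
  destruct X as [|y0 X0] eqn:EX.
  { exists 1; split; [lra|]. intros phi M H. unfold dd; cbn. rewrite Rmult_1_l. apply H; now left. }
  rewrite <- EX in *. destruct (exists_last (l := X)) as [Y [y HY]]; [now subst|].
  rewrite HY in *. clear EX y0 X0 X HY.
  rewrite length_app, Nat.add_1_r in Hn.
  destruct (IH (Y ++ y :: nil)) as [C1 [HC1 H1]].
  { now rewrite length_app, Nat.add_1_r. }
  { intros E; now apply app_eq_nil in E as [_ E]. }
  { now apply NoDup_cons_iff in HN. }
  destruct (IH (x :: Y)) as [C2 [HC2 H2]]; [easy|easy| |].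
  { rewrite app_comm_cons in HN. apply NoDup_snoc, NoDup_cons_iff in HN. apply HN. }
  assert (Hxy : y - x <> 0).
  { intros E. apply NoDup_cons_iff in HN as [HN _]. apply HN, in_or_app; right; left; lra. }
  assert (Hi : 0 < / Rabs (y - x)) by now apply Rinv_0_lt_compat, Rabs_pos_lt.
  exists ((C1 + C2) * / Rabs (y - x)); split; [apply Rmult_le_pos; lra|].
  intros phi M H. rewrite dd_step. unfold Rdiv. rewrite Rabs_mult, Rabs_inv.
  assert (Q1 := H1 phi M ltac:(intros; apply H; now right)).
  assert (Q2 : Rabs (dd phi (x :: Y)) <= C2 * M).
  { apply H2. intros z [<-|Hz]; apply H; [now left|right; apply in_or_app; now left]. }
  replace ((C1 + C2) * / Rabs (y - x) * M) with ((C1 * M + C2 * M) * / Rabs (y - x)) by ring.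
  apply Rmult_le_compat_r; [lra|]. eapply Rle_trans; [apply Rabs_triang|]. rewrite Rabs_Ropp; lra.
Qed.

(** On fixed nodes the values bound every derivative of the interpolant; with [nt_unique] this is a
    Markov inequality for polynomials. [W] admits the weighted polynomial too, and [1 <= C] keeps
    the length [l] in [bump] at most 1/2. *)
Lemma nt_unit_bound (W X : list R) :
  NoDup X -> (forall x, In x (W ++ X) -> 0 <= x <= 1) ->
  exists C, 1 <= C /\ forall phi M, 0 <= M -> (forall x, In x X -> Rabs (phi x) <= M) ->
    forall k x, 0 <= x <= 1 -> Rabs (nt W phi X k x) <= C * M.
Proof.
  induction X as [|y X IH] using rev_ind; intros HN HX.
  - exists 1; split; [lra|]. intros; unfold nt; cbn. rewrite Rabs_R0. lra.
  - destruct IH as [C [HC H]].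
    { now apply NoDup_snoc, NoDup_cons_iff in HN. }
    { intros x Hx; apply HX. rewrite app_assoc; apply in_or_app; now left. }
    destruct (dd_bound (X ++ y :: nil)) as [C1 [HC1 H1]]; [intros E; now apply app_eq_nil in E as [_ E]|easy|].
    set (Fb := INR (fact (S (length (W ++ X))))).
    assert (HF : 0 <= Fb) by apply pos_INR.
    exists (C + C1 * Fb); split; [nra|]. intros phi M HM Hphi k x Hx.
    rewrite nt_snoc. eapply Rle_trans; [apply Rabs_triang|]. rewrite Rabs_mult, Rmult_plus_distr_r.
    apply Rplus_le_compat.
    + apply H; auto. intros z Hz; apply Hphi, in_or_app; now left.
    + replace (C1 * Fb * M) with ((C1 * M) * Fb) by ring.
      apply Rmult_le_compat; try apply Rabs_pos; [now apply H1|].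
      apply pt_unit_bound; auto. intros z Hz; apply HX. rewrite app_assoc; apply in_or_app; now left.
Qed.

Lemma RInt_ge_part (g : R -> R) (u v c : R) :
  0 <= u <= v -> v <= 1 -> (forall x, continuous g x) ->
  (forall x, 0 <= x <= 1 -> 0 <= g x) -> (forall x, u <= x <= v -> c <= g x) ->
  c * (v - u) <= RInt g 0 1.
Proof.
  intros Hu Hv Hc Hg Hgc.
  rewrite <- (RInt_Chasles g 0 u 1), <- (RInt_Chasles g u v 1) by now apply ex_RInt_cont.
  assert (H1 := RInt_nonneg g 0 u ltac:(lra) Hc ltac:(intros; apply Hg; lra)).
  assert (H3 := RInt_nonneg g v 1 ltac:(lra) Hc ltac:(intros; apply Hg; lra)).
  assert (H2 := RInt_le_cont (fun _ => c) g u v ltac:(lra) (fun x => continuous_cst c x) Hc Hgc).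
  rewrite RInt_cst in H2. unfold plus; simpl. lra.
Qed.

Definition grid (m : nat) : list R := map (fun i => INR i / INR m) (seq 0 m).

Lemma grid_NoDup (m : nat) : NoDup (grid m).
Proof.
  apply NoDup_map_NoDup_ForallPairs; [|apply seq_NoDup].
  intros i j Hi Hj E. apply in_seq in Hi, Hj.
  apply INR_eq. assert (0 < INR m) by (apply lt_0_INR; lia).
  apply Rmult_eq_reg_r with (/ INR m); [exact E|]. apply Rinv_neq_0_compat; lra.
Qed.

Lemma grid_in (m : nat) (x : R) : In x (grid m) -> 0 <= x <= 1.
Proof.
  intros H; apply in_map_iff in H. destruct H as [i [<- Hi]]. apply in_seq in Hi.
  assert (0 < INR m) by (apply lt_0_INR; lia).
  assert (INR i <= INR m) by (apply le_INR; lia). pose proof (pos_INR i). split.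
  - apply Rmult_le_pos; [easy|]. apply Rlt_le, Rinv_0_lt_compat; lra.
  - apply Rmult_le_reg_r with (INR m); [easy|]. unfold Rdiv. rewrite Rmult_assoc, Rinv_l; lra.
Qed.

(* A polynomial stays above half its maximum [M] on an interval of fixed length, because its derivative is at most
   a constant times [M]; so it pairs well with itself times the weight. *)
Lemma bump (m : nat) :
  (0 < m)%nat -> exists c, 0 < c /\ forall p, tower m p -> (forall x, p m x = 0) ->
    exists psi, tower m psi /\ flat m psi /\ unit_le m psi 1 /\
      c * RInt (fun t => Rabs (p O t)) 0 1 <= RInt (fun t => p O t * psi O t) 0 1.
Proof.
  intros Hm. set (X := grid m). set (W := weight m).
  assert (HXm : length X = m) by (unfold X, grid; now rewrite length_map, length_seq).
  destruct (nt_unit_bound nil X (grid_NoDup m)) as [C1 [HC1 HB1]].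
  { intros x; apply grid_in. }
  destruct (nt_unit_bound W X (grid_NoDup m)) as [C2 [HC2 HB2]].
  { intros x Hx; apply in_app_or in Hx. destruct Hx as [Hx|Hx]; [now apply weight_in in Hx|now apply grid_in in Hx]. }
  (* The derivative is at most [C1 M], so within distance [l] of the maximum the polynomial loses at
     most [M / 2]. *)
  set (l := / (2 * C1)).
  assert (Hl : 0 < l <= 1 / 2).
  { unfold l; split; [apply Rinv_0_lt_compat; lra|].
    unfold Rdiv. rewrite Rmult_1_l. apply Rinv_le_contravar; lra. }
  (* Lower bound of the weight at distance at least [l / 4] from both 0 and 1. *)
  set (w0 := ((l / 4) ^ S m) ^ 2 * ((l / 4) ^ S m) ^ 2).
  assert (Hw0 : 0 < w0) by (apply Rmult_lt_0_compat; repeat apply pow_lt; lra).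
  (* The integrand is at least [w0 (M/2)^2] on a segment of length [l / 2]; dividing by the
     normalisation [C2 M] leaves [c M]. *)
  set (c := w0 / 4 * (l / 2) / C2).
  assert (Hc : 0 < c).
  { apply Rdiv_lt_0_compat; [|lra]. apply Rmult_lt_0_compat; lra. }
  exists c; split; [easy|]. intros p Hp Hpm.
  assert (Hp0 : forall x, continuous (p O) x) by (intros; apply (tower_cont m); auto; lia).
  assert (HpX : forall x, p O x = nt nil (p O) X 0 x).
  { destruct m as [|n]; [lia|]. apply (nt_unique n); auto. apply grid_NoDup. }
  destruct (continuity_ab_maj (fun t => Rabs (p O t)) 0 1) as [x0 [Hmax Hx0]]; [lra| |].
  { intros t _. apply continuity_pt_filterlim, continuous_abs, Hp0. }
  set (M := Rabs (p O x0)). assert (HM : 0 <= M) by apply Rabs_pos.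
  assert (HI : RInt (fun t => Rabs (p O t)) 0 1 <= M).
  { eapply Rle_trans; [apply (RInt_le_cont _ (fun _ => M)); auto; [lra| |]|].
    - intros x; now apply continuous_abs.
    - intros x; apply continuous_cst.
    - rewrite RInt_cst; lra. }
  destruct (Req_dec M 0) as [HM0|HM0].
  { exists (fun _ _ => 0); split; [apply tower_0|split; [easy|split]].
    - intros k x _ _. rewrite Rabs_R0; lra.
    - rewrite (RInt_cong (fun t => p O t * 0) (fun _ => 0)) by (intros; apply Rmult_0_r).
      rewrite RInt_cst. nra. }
  assert (HXM : forall x, In x X -> Rabs (p O x) <= M) by (intros x Hx; apply Hmax, grid_in with m, Hx).
  (* This is [p] times the weight, since [p] equals its interpolant; in this form [nt_unit_bound]
     bounds all its derivatives. *)
  set (psi := fun k x => / (C2 * M) * nt W (p O) X k x).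
  assert (HCM : 0 < C2 * M) by (apply Rmult_lt_0_compat; lra).
  assert (HCi : 0 < / (C2 * M)) by now apply Rinv_0_lt_compat.
  exists psi. split; [apply tower_scal, tower_nt|split; [|split]].
  - assert (Hz : forall k x, (forall j, pt (W ++ firstn j X) k x = 0) -> psi k x = 0).
    { intros k x Hj. unfold psi, nt.
      rewrite (rsum_ext _ _ (fun _ => 0 * 0)) by (intros; rewrite Hj; ring).
      rewrite rsum_mulc; ring. }
    intros k Hk; split; apply Hz; intros j; now apply weight_flat.
  - intros k x _ Hx. unfold psi. rewrite Rabs_mult, (Rabs_pos_eq (/ _)) by lra.
    apply Rmult_le_reg_l with (C2 * M); [easy|]. rewrite <- Rmult_assoc, Rinv_r, Rmult_1_l by lra.
    rewrite Rmult_1_r. now apply HB2.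
  - rewrite (RInt_cong (fun t => p O t * psi O t) (fun t => / (C2 * M) * (pt W 0 t * (p O t * p O t)))).
    2: { intros t. unfold psi; cbv beta. rewrite nt_prod, <- HpX. ring. }
    assert (Hcont : forall x, continuous (fun t => pt W 0 t * (p O t * p O t)) x).
    { intros x; apply continuous_mul; [|apply continuous_mul; auto].
      apply (tower_cont O); [apply tower_pt|easy]. }
    rewrite RInt_mulc by easy.
    (* A segment of length [l] inside [[0, 1]] with [x0] at one end; its middle half stays away from
       the zeros of the weight. *)
    set (s := if Rle_dec x0 (1 / 2) then x0 else x0 - l).
    assert (Hs : 0 <= s /\ s + l <= 1 /\ forall x, s <= x <= s + l -> Rabs (x - x0) <= l).
    { unfold s; destruct Rle_dec; repeat split; try lra; intros x Hx; apply Rabs_le; lra. }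
    destruct Hs as [Hs1 [Hs2 Hs3]].
    assert (HL := RInt_ge_part (fun t => pt W 0 t * (p O t * p O t)) (s + l / 4) (s + 3 * l / 4)
                    (w0 * (M / 2 * (M / 2))) ltac:(lra) ltac:(lra) Hcont).
    assert (HL' : w0 * (M / 2 * (M / 2)) * (s + 3 * l / 4 - (s + l / 4))
                  <= RInt (fun t => pt W 0 t * (p O t * p O t)) 0 1).
    { apply HL.
      - intros x Hx. unfold W. rewrite weight_0.
        apply Rmult_le_pos; [apply Rmult_le_pos; apply pow2_ge_0|]. nra.
      - intros x Hx. apply Rmult_le_compat; [lra|nra| |].
        + unfold W, w0. rewrite weight_0.
          assert (Hlp : 0 <= (l / 4) ^ S m) by (apply pow_le; lra).
          apply Rmult_le_compat; try apply pow2_ge_0; apply pow_incr; (split; [easy|apply pow_incr; lra]).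
        + assert (HpM : M / 2 <= Rabs (p O x)).
          { destruct (mean_value (p O) (nt nil (p O) X 1) x x0) as [ct [Hct Hcv]].
            { intros t. apply (is_derive_ext (nt nil (p O) X 0)); [intros; now rewrite <- HpX|].
              apply (tower_der 1); [apply tower_nt|lia]. }
            assert (Hct' : 0 <= ct <= 1).
            { unfold Rmin, Rmax in Hct; destruct (Rle_dec x x0); lra. }
            assert (Hd := HB1 (p O) M HM HXM 1%nat ct Hct').
            assert (Hxl : Rabs (x0 - x) <= l) by (rewrite Rabs_minus_sym; apply Hs3; lra).
            assert (Hq : Rabs (p O x0 - p O x) <= M / 2).
            { rewrite Hcv, Rabs_mult. replace (M / 2) with (C1 * M * l) by (unfold l; field; lra).
              apply Rmult_le_compat; auto using Rabs_pos. }
            pose proof (Rabs_triang_inv (p O x0) (p O x)) as Ht. fold M in Ht. lra. }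
          replace (p O x * p O x) with (Rabs (p O x) * Rabs (p O x))
            by (rewrite <- Rabs_mult; apply Rabs_pos_eq; nra).
          apply Rmult_le_compat; lra. }
    eapply Rle_trans; [apply Rmult_le_compat_l; [lra|apply HI]|].
    apply Rmult_le_reg_l with (C2 * M); [easy|]. rewrite <- (Rmult_assoc _ (/ _)), Rinv_r, Rmult_1_l by lra.
    eapply Rle_trans; [|apply HL']. apply Req_le. unfold c. field. lra.
Qed.

(** * Adjusting the area on the unit interval *)

(** Half the height that a horizontal lift of [(F, G)] gains from [a] to [b]. *)
Definition area (F G : nat -> R -> R) (a b : R) : R :=
  RInt (fun t => F 1%nat t * G O t - F O t * G 1%nat t) a b.

(** Change of the area under a perturbation [(r, s)] vanishing at [a] and [b]: the linear part,
    after integration by parts, plus the area of [(r, s)] itself. *)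
Definition cross (F G r s : nat -> R -> R) (a b : R) : R :=
  RInt (fun t => 2 * (F 1%nat t * s O t - r O t * G 1%nat t)
                 + (r 1%nat t * s O t - r O t * s 1%nat t)) a b.

Ltac cont_tower :=
  lazymatch goal with
  | |- continuous (fun t => @?u t - @?v t) _ => apply (continuous_sub u v); cont_tower
  | |- continuous (fun t => @?u t + @?v t) _ => apply (continuous_add u v); cont_tower
  | |- continuous (fun t => @?u t * @?v t) _ => apply (continuous_mul u v); cont_tower
  | |- continuous (fun t => Rabs (@?u t)) _ => apply (continuous_abs u); cont_tower
  | |- _ =>
    cbv beta; first
      [ solve [auto]
      | apply continuous_cst
      | eapply tower_cont; [eassumption|lia]
      | eapply tower_cont; [apply tower_pt|apply Nat.le_refl] ]
  end.

(* Integration by parts: the two integrands differ by the derivative of [r G - F s]. *)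
Lemma area_perturb (F G r s : nat -> R -> R) (a b : R) :
  tower 1 F -> tower 1 G -> tower 1 r -> tower 1 s ->
  r O a = 0 -> r O b = 0 -> s O a = 0 -> s O b = 0 ->
  area (fun k x => F k x + r k x) (fun k x => G k x + s k x) a b
  = area F G a b + cross F G r s a b.
Proof.
  intros HF HG Hr Hs ra rb sa sb. unfold area, cross.
  rewrite <- RInt_add by (intros; cont_tower).
  set (d := fun t => (r 1%nat t * G O t + r O t * G 1%nat t)
                     - (F 1%nat t * s O t + F O t * s 1%nat t)).
  assert (Hd : RInt d a b = 0 :> R).
  { unfold d. rewrite (RInt_der (fun t => r O t * G O t - F O t * s O t)).
    - rewrite ra, rb, sa, sb; ring.
    - intros t. apply is_derive_sub; apply is_derive_mul; apply (tower_der 1); auto.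
    - intros; cont_tower. }
  match goal with |- ?y = ?z => enough (y = z + RInt d a b) by lra end.
  rewrite <- RInt_add by (intros; unfold d; cont_tower).
  apply RInt_cong. intros t. unfold d. ring.
Qed.

(** The linear coefficient [L] is not controlled. But [sg] carries the sign of [D] and the sign of
    [t] is free: choosing it so that the linear term helps, the intermediate value theorem attains
    every amount up to [q T^2]. *)
Lemma quad_solve (L D q T : R) :
  0 <= T -> Rabs D <= q * T ^ 2 -> 0 <= q ->
  forall sg, (sg = 1 /\ 0 <= D) \/ (sg = -1 /\ D <= 0) ->
  exists t, Rabs t <= T /\ t * L + sg * (t ^ 2 * q) = D.
Proof.
  intros HT HD Hq.
  assert (Hpos : forall L' D', 0 <= D' -> Rabs D' <= q * T ^ 2 ->
    exists t, Rabs t <= T /\ t * L' + t ^ 2 * q = D').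
  { clear L D HD. intros L D HD HDq. rewrite Rabs_pos_eq in HDq by easy.
    set (T' := if Rle_dec 0 L then T else - T).
    assert (HT' : Rabs T' = T).
    { unfold T'; destruct (Rle_dec 0 L); [|rewrite Rabs_Ropp]; now apply Rabs_pos_eq. }
    assert (HLT : 0 <= T' * L) by (unfold T'; destruct (Rle_dec 0 L); nra).
    assert (HTT : T' ^ 2 = T ^ 2) by (unfold T'; destruct (Rle_dec 0 L); ring).
    destruct (IVT_gen (fun t => t * L + t ^ 2 * q) 0 T' D) as [t [Ht HtD]].
    - intros t. apply continuity_pt_filterlim.
      change (continuous (fun t => t * L + t ^ 2 * q) t).
      apply (continuous_ext (fun t => t * L + t * t * q)); [intros; simpl; ring|].
      repeat first [apply continuous_add|apply continuous_mul|apply continuous_cst|apply continuous_id].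
    - rewrite HTT. split.
      + eapply Rle_trans; [apply Rmin_l|]. lra.
      + eapply Rle_trans; [|apply Rmax_r]. lra.
    - exists t; split; [|easy]. apply between_abs in Ht. rewrite !Rminus_0_r, HT' in Ht. easy. }
  intros sg [[-> HD0]|[-> HD0]].
  - destruct (Hpos L D HD0 HD) as [t [Ht E]]. exists t; split; [easy|lra].
  - destruct (Hpos (- L) (- D)) as [t [Ht E]]; [lra|now rewrite Rabs_Ropp|].
    exists t; split; [easy|lra].
Qed.

(* With [r = t w] and [s = - sg t x w], [w] the weight, the quadratic term of the area is [sg t^2] times the integral
   of [w^2]. *)
Lemma fix_area_quadratic (m : nat) :
  (0 < m)%nat -> exists q C, 0 < q /\ 0 < C /\ forall F G D T,
    tower m F -> tower m G -> 0 <= T -> Rabs D <= q * T ^ 2 ->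
    exists r s, tower m r /\ tower m s /\ flat m r /\ flat m s /\
      unit_le m r (C * T) /\ unit_le m s (C * T) /\ cross F G r s 0 1 = D.
Proof.
  intros Hm. set (W := weight m). set (V := 0 :: W).
  assert (HWc : forall x, continuous (fun t => pt W 0 t * pt W 0 t) x) by (intros; cont_tower).
  set (q := RInt (fun t => pt W 0 t * pt W 0 t) 0 1).
  assert (Hq : 0 < q).
  { apply RInt_gt_0; [lra| |auto]. intros x Hx. unfold W. rewrite weight_0.
    assert (0 < x ^ S m) by (apply pow_lt; lra).
    assert (0 < (1 - x) ^ S m) by (apply pow_lt; lra).
    assert (0 < (x ^ S m) ^ 2 * ((1 - x) ^ S m) ^ 2) by (apply Rmult_lt_0_compat; now apply pow_lt).
    now apply Rmult_lt_0_compat. }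
  set (C := INR (fact (S (length V)))).
  assert (HCW : INR (fact (S (length W))) <= C) by (apply le_INR, fact_le; simpl; lia).
  assert (HC : 0 < C) by apply INR_fact_lt_0.
  exists q, C; split; [easy|split; [easy|]]. intros F G D T HF HG HT HD.
  assert (HF1 := tower_le _ 1 _ Hm HF). assert (HG1 := tower_le _ 1 _ Hm HG).
  assert (Hsg : exists sg, (sg = 1 /\ 0 <= D) \/ (sg = -1 /\ D <= 0)).
  { destruct (Rle_dec 0 D); [exists 1|exists (-1)]; [left|right]; lra. }
  destruct Hsg as [sg Hsg].
  (* [L] depends on [F] and [G] and may be large, which [quad_solve] tolerates. *)
  set (L := RInt (fun t => 2 * (F 1%nat t * (- sg * pt V 0 t) - pt W 0 t * G 1%nat t)) 0 1).
  destruct (quad_solve L D q T HT HD (Rlt_le _ _ Hq) sg Hsg) as [t [Ht HtD]].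
  assert (Hsga : Rabs (t * - sg) = Rabs t).
  { destruct Hsg as [[-> _]|[-> _]]; [rewrite <- (Rabs_Ropp t)|]; f_equal; ring. }
  exists (fun k x => t * pt W k x), (fun k x => t * - sg * pt V k x).
  split; [apply tower_scal, tower_pt|split; [apply tower_scal, tower_pt|]].
  assert (HW := weight_flat m nil). rewrite app_nil_r in HW. fold W in HW.
  split; [|split; [|split; [|split]]].
  - intros k Hk. destruct (HW k Hk) as [E1 E2]. rewrite E1, E2; lra.
  - assert (E1 := pt_prefix_0 m (0 :: nil) W 0 (fun k Hk => proj1 (HW k Hk))).
    assert (E2 := pt_prefix_0 m (0 :: nil) W 1 (fun k Hk => proj2 (HW k Hk))).
    intros k Hk; unfold V. cbn [app] in E1, E2. rewrite E1, E2 by easy. lra.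
  - intros k x _ Hx. rewrite Rabs_mult, Rmult_comm.
    apply Rmult_le_compat; auto using Rabs_pos.
    eapply Rle_trans; [apply pt_unit_bound; auto|exact HCW]. intros z; apply weight_in.
  - intros k x _ Hx. rewrite Rabs_mult, Hsga, Rmult_comm.
    apply Rmult_le_compat; auto using Rabs_pos.
    apply pt_unit_bound; auto. intros z [<-|Hz]; [lra|]. now apply weight_in in Hz.
  - rewrite <- HtD. unfold cross, L, q.
    assert (HcL : forall x, continuous (fun t => 2 * (F 1%nat t * (- sg * pt V 0 t) - pt W 0 t * G 1%nat t)) x)
      by (intros; cont_tower).
    rewrite <- (RInt_mulc t) by easy.
    rewrite <- (RInt_mulc (t ^ 2)), <- (RInt_mulc sg) by (intros; cont_tower).
    rewrite <- RInt_add by (intros; cont_tower).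
    apply RInt_cong; intros x. unfold V; cbn [pt pred INR]. ring.
Qed.

(** One of the integrals of [|P'|] and [|Q'|] is at least [V0 / 2]. The bump of that derivative,
    added to the other component, has a linear effect of order [V0]; as only one component is
    perturbed, the quadratic term vanishes and a multiple of the bump solves the equation exactly.
    [r] and [s] stand for earlier corrections, too small to spoil the pairing. *)
Lemma fix_area_linear (m : nat) :
  (0 < m)%nat -> exists c, 0 < c /\ forall P Q r s D V0,
    tower (S m) P -> (forall x, P (S m) x = 0) -> tower (S m) Q -> (forall x, Q (S m) x = 0) ->
    tower m r -> tower m s -> unit_le m r c -> unit_le m s c ->
    V0 = RInt (fun t => Rabs (P 1%nat t) + Rabs (Q 1%nat t)) 0 1 -> 1 <= V0 ->
    exists phi psi, tower m phi /\ tower m psi /\ flat m phi /\ flat m psi /\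
      unit_le m phi (Rabs D / (c * V0)) /\ unit_le m psi (Rabs D / (c * V0)) /\
      cross (fun k x => P k x + r k x) (fun k x => Q k x + s k x) phi psi 0 1 = D.
Proof.
  intros Hm. destruct (bump m Hm) as [cb [Hcb HB]].
  (* The pairing is at least [cb V0 / 2], doubled to [cb V0]; corrections of size [cb / 4] take away
     at most [cb / 2], and [V0 >= 1] leaves more than [cb V0 / 4]. *)
  exists (cb / 4); split; [lra|].
  intros P Q r s D V0 HP HPm HQ HQm Hr Hs Hrc Hsc HV0 HV1.
  assert (Hhalf : forall P r, tower (S m) P -> (forall x, P (S m) x = 0) -> tower m r ->
    unit_le m r (cb / 4) -> V0 / 2 <= RInt (fun t => Rabs (P 1%nat t)) 0 1 ->
    forall D, exists th, tower m th /\ flat m th /\ unit_le m th (Rabs D / (cb / 4 * V0)) /\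
      RInt (fun t => 2 * ((P 1%nat t + r 1%nat t) * th O t)) 0 1 = D :> R).
  { clear P Q r s D HV0 HP HPm HQ HQm Hr Hs Hrc Hsc.
    intros P r HP HPm Hr Hrc HV D.
    destruct (HB (fun k => P (S k))) as [ps [Tps [Fps [Ups Ips]]]]; auto using tower_shift.
    set (J := RInt (fun t => 2 * ((P 1%nat t + r 1%nat t) * ps O t)) 0 1).
    assert (HP1 : forall x, continuous (P 1%nat) x) by (intros; cont_tower).
    assert (Hr1 : forall x, continuous (r 1%nat) x) by (intros; cont_tower).
    assert (Hp0 : forall x, continuous (ps 0%nat) x) by (intros; cont_tower).
    assert (HJ : cb / 4 * V0 <= J).
    { assert (E : J = 2 * RInt (fun t => P 1%nat t * ps O t) 0 1 + 2 * RInt (fun t => r 1%nat t * ps O t) 0 1).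
      { unfold J. rewrite <- Rmult_plus_distr_l, <- RInt_add by (intros; cont_tower).
        rewrite <- RInt_mulc by (intros; cont_tower). apply RInt_cong; intros; ring. }
      assert (Hb : Rabs (RInt (fun t => r 1%nat t * ps O t) 0 1) <= cb / 4).
      { eapply Rle_trans; [apply (RInt_abs_le _ (fun _ => cb / 4))|]; [lra|intros; cont_tower|intros; cont_tower| |].
        - intros x Hx. rewrite Rabs_mult. specialize (Hrc 1%nat x ltac:(lia) Hx).
          specialize (Ups O x ltac:(lia) Hx). pose proof (Rabs_pos (r 1%nat x)).
          pose proof (Rabs_pos (ps O x)). nra.
        - rewrite RInt_cst; lra. }
      assert (Hb' := Rle_abs (- RInt (fun t => r 1%nat t * ps O t) 0 1)). rewrite Rabs_Ropp in Hb'.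
      assert (cb * (V0 / 2) <= cb * RInt (fun t => Rabs (P 1%nat t)) 0 1) by (apply Rmult_le_compat_l; lra).
      nra. }
    assert (HJ0 : 0 < cb / 4 * V0) by nra.
    exists (fun k x => D / J * ps k x). split; [now apply tower_scal|split; [|split]].
    - intros k Hk. destruct (Fps k Hk) as [-> ->]. lra.
    - intros k x Hk Hx. rewrite Rabs_mult, Rabs_div, (Rabs_pos_eq J) by lra.
      specialize (Ups k x Hk Hx). pose proof (Rabs_pos (ps k x)). pose proof (Rabs_pos D).
      assert (/ J <= / (cb / 4 * V0)) by (apply Rinv_le_contravar; lra).
      assert (0 < / J) by (apply Rinv_0_lt_compat; lra).
      assert (0 <= Rabs D * / J) by (apply Rmult_le_pos; lra).
      apply Rle_trans with (Rabs D * / J); [unfold Rdiv; nra|].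
      now apply Rmult_le_compat_l.
    - rewrite (RInt_cong _ (fun t => D / J * (2 * ((P 1%nat t + r 1%nat t) * ps O t)))) by (intros; ring).
      rewrite RInt_mulc by (intros; cont_tower). fold J. field. lra. }
  assert (HPQ : V0 = RInt (fun t => Rabs (P 1%nat t)) 0 1 + RInt (fun t => Rabs (Q 1%nat t)) 0 1).
  { rewrite HV0. apply RInt_add; intros; cont_tower. }
  assert (Hpos : 0 <= Rabs D / (cb / 4 * V0)).
  { apply Rmult_le_pos; [apply Rabs_pos|]. apply Rlt_le, Rinv_0_lt_compat. nra. }
  assert (Hz : unit_le m (fun _ _ => 0) (Rabs D / (cb / 4 * V0))).
  { intros k x _ _. now rewrite Rabs_R0. }
  destruct (Rle_dec (V0 / 2) (RInt (fun t => Rabs (P 1%nat t)) 0 1)) as [HV|HV].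
  - destruct (Hhalf P r HP HPm Hr Hrc HV D) as [th [T1 [T2 [T3 T4]]]].
    exists (fun _ _ => 0), th. do 6 (split; [first [assumption|apply tower_0|easy]|]).
    rewrite <- T4 at 1. apply RInt_cong; intros; ring.
  (* A perturbation of the first component enters [cross] with a minus sign, hence [- D]. *)
  - destruct (Hhalf Q s HQ HQm Hs Hsc ltac:(lra) (- D)) as [th [T1 [T2 [T3 T4]]]].
    rewrite Rabs_Ropp in T3.
    exists th, (fun _ _ => 0). do 6 (split; [first [assumption|apply tower_0|easy]|]).
    rewrite <- (Ropp_involutive D), <- T4.
    rewrite <- (Rmult_1_l (RInt _ 0 1)) at 1. rewrite Ropp_mult_distr_l, <- RInt_mulc by (intros; cont_tower).
    unfold cross. rewrite (RInt_cong _ (fun t => 1 * (-1 * (2 * ((Q 1%nat t + s 1%nat t) * th O t))))) by (intros; ring).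
    rewrite RInt_mulc by (intros; cont_tower). rewrite Rmult_1_l. apply RInt_cong; intros; ring.
Qed.

Lemma finite_bound (m : nat) (a : nat -> R) :
  exists e, 0 <= e /\ forall k, (k <= m)%nat -> Rabs (a k) <= e.
Proof.
  induction m as [|m [e [He H]]].
  - exists (Rabs (a O)); split; [apply Rabs_pos|]. intros k Hk; replace k with O by lia; lra.
  - exists (Rmax e (Rabs (a (S m)))); split; [eapply Rle_trans; [apply He|apply Rmax_l]|].
    intros k Hk. destruct (Nat.eq_dec k (S m)) as [->|Hn]; [apply Rmax_r|].
    eapply Rle_trans; [apply H; lia|apply Rmax_l].
Qed.

Lemma hermite_exists (m : nat) (al be : nat -> R) :
  exists r, tower m r /\ forall k, (k <= m)%nat -> r k 0 = al k /\ r k 1 = be k.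
Proof.
  destruct (hermite m) as [C [_ H]].
  destruct (finite_bound m al) as [e1 [He1 H1]]. destruct (finite_bound m be) as [e2 [He2 H2]].
  destruct (H (e1 + e2) al be) as [r [Tr Hr]].
  - intros k Hk; specialize (H1 k Hk); specialize (H2 k Hk); lra.
  - exists r; split; [easy|]. intros k Hk; now destruct (Hr k Hk) as [? [? _]].
Qed.

Lemma tower_add_jets (m : nat) (F r : nat -> R -> R) (k : nat) :
  flat m r -> (k <= m)%nat -> F k 0 + r k 0 = F k 0 /\ F k 1 + r k 1 = F k 1.
Proof. intros Hr Hk. destruct (Hr k Hk) as [-> ->]. lra. Qed.

(** Serves the gaps that need no estimate. *)
Lemma unit_exists (m : nat) (al be al' be' : nat -> R) (A : R) :
  (0 < m)%nat -> exists F G, tower m F /\ tower m G /\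
    (forall k, (k <= m)%nat -> F k 0 = al k /\ F k 1 = be k /\ G k 0 = al' k /\ G k 1 = be' k) /\
    area F G 0 1 = A.
Proof.
  intros Hm.
  destruct (hermite_exists m al be) as [F [HF JF]].
  destruct (hermite_exists m al' be') as [G [HG JG]].
  destruct (fix_area_quadratic m Hm) as [q [C [Hq [HC H]]]].
  set (D := A - area F G 0 1).
  (* With [y = |D| / q], the radius [1 + y] satisfies [(1 + y)^2 >= y]. *)
  destruct (H F G D (1 + Rabs D / q)) as [r [s [Tr [Ts [Fr [Fs [_ [_ HD]]]]]]]]; auto.
  { assert (0 <= Rabs D / q) by (apply Rmult_le_pos; [apply Rabs_pos|apply Rlt_le, Rinv_0_lt_compat, Hq]). lra. }
  { set (y := Rabs D / q). assert (E : Rabs D = q * y) by (unfold y; field; lra). rewrite E.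
    assert (0 <= y) by (apply Rmult_le_pos; [apply Rabs_pos|apply Rlt_le, Rinv_0_lt_compat, Hq]).
    apply Rmult_le_compat_l; [lra|]. nra. }
  exists (fun k x => F k x + r k x), (fun k x => G k x + s k x).
  split; [now apply tower_add|split; [now apply tower_add|split]].
  - intros k Hk. destruct (tower_add_jets m F r k Fr Hk) as [-> ->].
    destruct (tower_add_jets m G s k Fs Hk) as [-> ->].
    destruct (JF k Hk), (JG k Hk). auto.
  - destruct (Fr O ltac:(lia)), (Fs O ltac:(lia)).
    rewrite area_perturb, HD; eauto using tower_le. unfold D; ring.
Qed.

(** For bounded [c] this is at most a multiple of [c (1 + V)], with [V] the integral: the Hermite
    corrections cost an area of the same form as the A/V condition allows. *)
Lemma cross_bound (P Q r s : nat -> R -> R) (c : R) :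
  tower 1 P -> tower 1 Q -> tower 1 r -> tower 1 s -> 0 <= c ->
  unit_le 1 r c -> unit_le 1 s c ->
  Rabs (cross P Q r s 0 1) <= 2 * c * RInt (fun t => Rabs (P 1%nat t) + Rabs (Q 1%nat t)) 0 1 + 2 * c ^ 2.
Proof.
  intros HP HQ Hr Hs Hc Hrc Hsc. unfold cross.
  eapply Rle_trans.
  - apply (RInt_abs_le _ (fun t => 2 * c * (Rabs (P 1%nat t) + Rabs (Q 1%nat t)) + 2 * c ^ 2));
      [lra|intros; cont_tower|intros; cont_tower|].
    intros x Hx.
    assert (R0 := Hrc O x ltac:(lia) Hx). assert (R1 := Hrc 1%nat x ltac:(lia) Hx).
    assert (S0 := Hsc O x ltac:(lia) Hx). assert (S1 := Hsc 1%nat x ltac:(lia) Hx).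
    assert (E1 : Rabs (P 1%nat x * s O x) <= Rabs (P 1%nat x) * c)
      by (rewrite Rabs_mult; apply Rmult_le_compat_l; auto using Rabs_pos).
    assert (E2 : Rabs (r O x * Q 1%nat x) <= c * Rabs (Q 1%nat x))
      by (rewrite Rabs_mult; apply Rmult_le_compat_r; auto using Rabs_pos).
    assert (E3 : Rabs (r 1%nat x * s O x) <= c * c)
      by (rewrite Rabs_mult; apply Rmult_le_compat; auto using Rabs_pos).
    assert (E4 : Rabs (r O x * s 1%nat x) <= c * c)
      by (rewrite Rabs_mult; apply Rmult_le_compat; auto using Rabs_pos).
    revert E1 E2 E3 E4. generalize (P 1%nat x * s O x) (r O x * Q 1%nat x) (r 1%nat x * s O x) (r O x * s 1%nat x).
    intros y1 y2 y3 y4 E1 E2 E3 E4.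
    assert (Rabs (2 * (y1 - y2) + (y3 - y4)) <= 2 * Rabs y1 + 2 * Rabs y2 + Rabs y3 + Rabs y4)
      by (unfold Rabs; repeat destruct Rcase_abs; lra).
    nra.
  - rewrite RInt_add, RInt_mulc, RInt_cst by (intros; cont_tower). lra.
Qed.

Lemma unit_small (m : nat) (eta : R) :
  (0 < m)%nat -> 0 < eta -> exists e, 0 < e /\
  forall P Q al be al' be' A,
    tower (S m) P -> (forall x, P (S m) x = 0) -> tower (S m) Q -> (forall x, Q (S m) x = 0) ->
    (forall k, (k <= m)%nat -> Rabs (al k - P k 0) <= e /\ Rabs (be k - P k 1) <= e /\
                               Rabs (al' k - Q k 0) <= e /\ Rabs (be' k - Q k 1) <= e) ->
    al O = P O 0 -> be O = P O 1 -> al' O = Q O 0 -> be' O = Q O 1 ->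
    Rabs (A - area P Q 0 1) <= e * (1 + RInt (fun t => Rabs (P 1%nat t) + Rabs (Q 1%nat t)) 0 1) ->
    exists F G, tower m F /\ tower m G /\
      (forall k, (k <= m)%nat -> F k 0 = al k /\ F k 1 = be k /\ G k 0 = al' k /\ G k 1 = be' k) /\
      area F G 0 1 = A /\
      unit_le m (fun k x => F k x - P k x) eta /\ unit_le m (fun k x => G k x - Q k x) eta.
Proof.
  intros Hm Heta.
  destruct (hermite m) as [Ch [HCh HH]].
  destruct (fix_area_quadratic m Hm) as [q [Cq [Hq [HCq HQd]]]].
  destruct (fix_area_linear m Hm) as [c [Hc HLn]].
  (* Chosen so that [|D| <= C2 e (1 + V0)]: the given area error contributes 1, the Hermite
     corrections the terms in [Ch]. *)
  set (C2 := 1 + 2 * Ch + 2 * Ch ^ 2).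
  assert (HC2 : 1 <= C2) by (unfold C2; pose proof (pow2_ge_0 Ch); lra).
  (* The quadratic correction then has size [Cq T = eta / 2]; the Hermite correction gets the other
     half. *)
  set (T := eta / (2 * Cq)).
  assert (HT : 0 < T) by (apply Rdiv_lt_0_compat; lra).
  (* In this order the bounds give: [e^2 <= e]; Hermite corrections at most [eta / 2]; area error at
     most [q T^2] when [V0 <= 1]; Hermite corrections at most [c]; linear corrections at most
     [eta / 2] when [V0 >= 1]. *)
  set (e := Rmin (Rmin 1 (eta / (2 * (Ch + 1)))) (Rmin (q * T ^ 2 / (2 * C2)) (Rmin (c / (Ch + 1)) (c * eta / (4 * C2))))).
  assert (He : 0 < e).
  { repeat apply Rmin_pos; try lra; apply Rdiv_lt_0_compat; try lra.
    - apply Rmult_lt_0_compat; [easy|now apply pow_lt].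
    - now apply Rmult_lt_0_compat. }
  assert (He1 : e <= 1) by (eapply Rle_trans; [apply Rmin_l|apply Rmin_l]).
  assert (He2 : Ch * e <= eta / 2).
  { assert (e <= eta / (2 * (Ch + 1))) by (eapply Rle_trans; [apply Rmin_l|apply Rmin_r]).
    assert (eta / (2 * (Ch + 1)) * (Ch + 1) = eta / 2) by (field; lra). nra. }
  assert (He3 : 2 * C2 * e <= q * T ^ 2).
  { assert (e <= q * T ^ 2 / (2 * C2)) by (eapply Rle_trans; [apply Rmin_r|apply Rmin_l]).
    assert (q * T ^ 2 / (2 * C2) * (2 * C2) = q * T ^ 2) by (field; lra). nra. }
  assert (He4 : Ch * e <= c).
  { assert (e <= c / (Ch + 1)).
    { eapply Rle_trans; [apply Rmin_r|]. eapply Rle_trans; [apply Rmin_r|apply Rmin_l]. }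
    assert (c / (Ch + 1) * (Ch + 1) = c) by (field; lra). nra. }
  assert (He5 : 4 * C2 * e <= c * eta).
  { assert (e <= c * eta / (4 * C2)).
    { eapply Rle_trans; [apply Rmin_r|]. eapply Rle_trans; [apply Rmin_r|apply Rmin_r]. }
    assert (c * eta / (4 * C2) * (4 * C2) = c * eta) by (field; lra). nra. }
  clearbody e. exists e; split; [easy|].
  intros P Q al be al' be' A HP HPm HQ HQm HJ E1 E2 E3 E4 HA.
  set (V0 := RInt (fun t => Rabs (P 1%nat t) + Rabs (Q 1%nat t)) 0 1) in *.
  assert (HPm' := tower_le (S m) m P ltac:(lia) HP). assert (HQm' := tower_le (S m) m Q ltac:(lia) HQ).
  assert (HP1 := tower_le _ 1 _ Hm HPm'). assert (HQ1 := tower_le _ 1 _ Hm HQm').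
  destruct (HH e (fun k => al k - P k 0) (fun k => be k - P k 1)) as [r [Tr Hr]].
  { intros k Hk; destruct (HJ k Hk); tauto. }
  destruct (HH e (fun k => al' k - Q k 0) (fun k => be' k - Q k 1)) as [s [Ts Hs]].
  { intros k Hk; destruct (HJ k Hk); tauto. }
  assert (Tr1 := tower_le _ 1 _ Hm Tr). assert (Ts1 := tower_le _ 1 _ Hm Ts).
  assert (Ur : unit_le m r (Ch * e)) by (intros k x Hk; now apply Hr).
  assert (Us : unit_le m s (Ch * e)) by (intros k x Hk; now apply Hs).
  set (F0 := fun k x => P k x + r k x). set (G0 := fun k x => Q k x + s k x).
  assert (TF0 : tower m F0) by now apply tower_add.
  assert (TG0 : tower m G0) by now apply tower_add.
  assert (HV : 0 <= V0).
  { apply RInt_nonneg; [lra|intros; cont_tower|]. intros x _.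
    pose proof (Rabs_pos (P 1%nat x)); pose proof (Rabs_pos (Q 1%nat x)); lra. }
  set (D := A - area F0 G0 0 1).
  assert (HD : Rabs D <= C2 * e * (1 + V0)).
  { assert (Ea : area F0 G0 0 1 = area P Q 0 1 + cross P Q r s 0 1).
    { destruct (Hr O ltac:(lia)) as [r0 [r1 _]]. destruct (Hs O ltac:(lia)) as [s0 [s1 _]].
      apply area_perturb; auto; lra. }
    assert (Hx := cross_bound P Q r s (Ch * e) HP1 HQ1 Tr1 Ts1 ltac:(nra)
      ltac:(intros k x Hk; apply Ur; lia) ltac:(intros k x Hk; apply Us; lia)). fold V0 in Hx.
    unfold D. rewrite Ea. replace (A - (area P Q 0 1 + cross P Q r s 0 1))
      with ((A - area P Q 0 1) + - cross P Q r s 0 1) by ring.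
    eapply Rle_trans; [apply Rabs_triang|]. rewrite Rabs_Ropp.
    assert ((Ch * e) ^ 2 <= Ch ^ 2 * e).
    { rewrite Rpow_mult_distr. apply Rmult_le_compat_l; [apply pow2_ge_0|]. nra. }
    assert (0 <= Ch ^ 2 * e * V0).
    { apply Rmult_le_pos; [|easy]. apply Rmult_le_pos; [apply pow2_ge_0|lra]. }
    assert (0 <= Ch * e) by nra.
    unfold C2. nra. }
  assert (Hfix : exists phi psi, tower m phi /\ tower m psi /\ flat m phi /\ flat m psi /\
    unit_le m phi (eta / 2) /\ unit_le m psi (eta / 2) /\ cross F0 G0 phi psi 0 1 = D).
  { destruct (Rle_dec 1 V0) as [HV1|HV1].
    - destruct (HLn P Q r s D V0) as [phi [psi [T1 [T2 [T3 [T4 [T5 [T6 T7]]]]]]]]; auto.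
      + intros k x Hk Hx; eapply Rle_trans; [now apply Ur|easy].
      + intros k x Hk Hx; eapply Rle_trans; [now apply Us|easy].
      + assert (Hle : Rabs D / (c * V0) <= eta / 2).
        { assert (0 < c * V0) by nra. apply Rmult_le_reg_r with (c * V0); [easy|].
          unfold Rdiv at 1. rewrite Rmult_assoc, Rinv_l, Rmult_1_r by lra.
          eapply Rle_trans; [apply HD|].
          assert (0 <= C2 * e * (V0 - 1)) by (apply Rmult_le_pos; [nra|lra]).
          assert (0 <= (c * eta - 4 * C2 * e) * V0) by (apply Rmult_le_pos; lra). lra. }
        exists phi, psi. do 4 (split; [assumption|]). split; [|split; [|assumption]].
        * intros k x Hk Hx; eapply Rle_trans; [now apply T5|easy].
        * intros k x Hk Hx; eapply Rle_trans; [now apply T6|easy].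
    - destruct (HQd F0 G0 D T) as [phi [psi [T1 [T2 [T3 [T4 [T5 [T6 T7]]]]]]]]; auto; [lra| |].
      + eapply Rle_trans; [apply HD|]. eapply Rle_trans; [|apply He3].
        assert (0 <= C2 * e * (1 - V0)) by (apply Rmult_le_pos; [nra|lra]). lra.
      + assert (Hle : Cq * T = eta / 2) by (unfold T; field; lra). rewrite Hle in T5, T6.
        exists phi, psi. do 6 (split; [assumption|]). assumption. }
  destruct Hfix as [phi [psi [T1 [T2 [T3 [T4 [T5 [T6 T7]]]]]]]].
  exists (fun k x => F0 k x + phi k x), (fun k x => G0 k x + psi k x).
  split; [now apply tower_add|split; [now apply tower_add|split; [|split; [|split]]]].
  - intros k Hk. destruct (tower_add_jets m F0 phi k T3 Hk) as [-> ->].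
    destruct (tower_add_jets m G0 psi k T4 Hk) as [-> ->].
    destruct (Hr k Hk) as [Q1 [Q2 _]]. destruct (Hs k Hk) as [Q3 [Q4 _]].
    unfold F0, G0. lra.
  - destruct (T3 O ltac:(lia)), (T4 O ltac:(lia)).
    rewrite area_perturb, T7; eauto using tower_le. unfold D; ring.
  - intros k x Hk Hx. specialize (T5 k x Hk Hx). specialize (Ur k x Hk Hx). unfold F0.
    replace (P k x + r k x + phi k x - P k x) with (r k x + phi k x) by ring.
    eapply Rle_trans; [apply Rabs_triang|]. lra.
  - intros k x Hk Hx. specialize (T6 k x Hk Hx). specialize (Us k x Hk Hx). unfold G0.
    replace (Q k x + s k x + psi k x - Q k x) with (s k x + psi k x) by ring.
    eapply Rle_trans; [apply Rabs_triang|]. lra.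
Qed.

(** * Bridging a gap *)

Lemma area_affine (p q : nat -> R -> R) (u v a b : R) :
  tower 1 p -> tower 1 q ->
  area (fun k x => u ^ k * p k (u * x + v)) (fun k x => u ^ k * q k (u * x + v)) a b
  = area p q (u * a + v) (u * b + v).
Proof.
  intros Hp Hq. unfold area.
  rewrite <- (RInt_comp_lin (V := R_CompleteNormedModule)) by (apply ex_RInt_cont; intros; cont_tower).
  apply RInt_cong; intros t. unfold scal; simpl; unfold mult; simpl. ring.
Qed.

Lemma area_scal (p q : nat -> R -> R) (c a b : R) :
  tower 1 p -> tower 1 q ->
  area (fun k x => c * p k x) (fun k x => c * q k x) a b = c ^ 2 * area p q a b.
Proof.
  intros Hp Hq. unfold area. rewrite <- RInt_mulc by (intros; cont_tower).
  apply RInt_cong; intros t. ring.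
Qed.

(** [c] scales the values, [u] and [v] the variable. With [c = d^-m] and [u = d] the [m]-th
    derivative keeps its size. *)
Definition resc (c u v : R) (p : nat -> R -> R) (k : nat) (x : R) : R :=
  c * (u ^ k * p k (u * x + v)).

Lemma tower_resc (m : nat) (c u v : R) (p : nat -> R -> R) :
  tower m p -> tower m (resc c u v p).
Proof.
  intros Hp. apply (tower_scal m c (fun k x => u ^ k * p k (u * x + v))). now apply tower_affine.
Qed.

Lemma area_resc (p q : nat -> R -> R) (c u v a b : R) :
  tower 1 p -> tower 1 q ->
  area (resc c u v p) (resc c u v q) a b = c ^ 2 * area p q (u * a + v) (u * b + v).
Proof.
  intros Hp Hq. rewrite <- area_affine by easy.
  apply (area_scal (fun k x => u ^ k * p k (u * x + v)) (fun k x => u ^ k * q k (u * x + v)));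
    now apply tower_affine.
Qed.

Definition bridge (m : nat) (jf jg : nat -> R -> R) (a b A : R) (F G : nat -> R -> R) : Prop :=
  tower m F /\ tower m G /\
  (forall k, (k <= m)%nat -> F k a = jf k a /\ F k b = jf k b /\ G k a = jg k a /\ G k b = jg k b) /\
  2 * area F G a b = A.

Lemma affine_ends (a b : R) :
  a < b -> / (b - a) * a + - a / (b - a) = 0 /\ / (b - a) * b + - a / (b - a) = 1.
Proof. intros H; split; field; lra. Qed.

Lemma gap_exists (m : nat) (jf jg : nat -> R -> R) (a b A : R) :
  (0 < m)%nat -> a < b -> exists F G, bridge m jf jg a b A F G.
Proof.
  intros Hm Hab. set (d := b - a). assert (Hd : 0 < d) by (unfold d; lra).
  destruct (unit_exists m (fun k => d ^ k * jf k a) (fun k => d ^ k * jf k b)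
    (fun k => d ^ k * jg k a) (fun k => d ^ k * jg k b) (A / 2) Hm) as [F [G [HF [HG [HJ HA]]]]].
  destruct (affine_ends a b Hab) as [Ea Eb]. fold d in Ea, Eb.
  exists (resc 1 (/ d) (- a / d) F), (resc 1 (/ d) (- a / d) G).
  split; [now apply tower_resc|split; [now apply tower_resc|split]].
  - intros k Hk. destruct (HJ k Hk) as [E1 [E2 [E3 E4]]]. unfold resc.
    rewrite Ea, Eb, E1, E2, E3, E4, pow_inv.
    assert (d ^ k <> 0) by (apply pow_nonzero; lra).
    repeat split; field; auto.
  - rewrite area_resc; eauto using tower_le. rewrite Ea, Eb, HA. field.
Qed.

Lemma A_q_area (f g h : R -> R) (X : list R) (a b : R) :
  A_q f g h X a b = h b - h a - 2 * area (nt nil f X) (nt nil g X) a b.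
Proof.
  unfold A_q, area. do 2 f_equal. apply RInt_cong; intros t.
  rewrite !Derive_newton, !newton_nt. ring.
Qed.

Lemma V_q_nt (m : nat) (f g : R -> R) (X : list R) (a b : R) :
  V_q m f g X a b = diam X ^ (2 * m) + diam X ^ m *
    RInt (fun t => Rabs (nt nil f X 1 t) + Rabs (nt nil g X 1 t)) a b.
Proof. unfold V_q. do 2 f_equal. apply RInt_cong; intros t. now rewrite !Derive_newton. Qed.

Lemma RInt_abs_sum_nonneg (f g : R -> R) (X : list R) (a b : R) :
  a <= b -> 0 <= RInt (fun t => Rabs (nt nil f X 1 t) + Rabs (nt nil g X 1 t)) a b.
Proof.
  intros Hab. apply RInt_nonneg; auto.
  - intros x. apply continuous_add; apply continuous_abs; apply (tower_cont 1); auto using tower_nt.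
  - intros x _. pose proof (Rabs_pos (nt nil f X 1 x)); pose proof (Rabs_pos (nt nil g X 1 x)); lra.
Qed.

Lemma V_q_pos (m : nat) (f g : R -> R) (X : list R) (a b : R) :
  In a X -> In b X -> a < b -> 0 < V_q m f g X a b.
Proof.
  intros Xa Xb Hab. rewrite V_q_nt. assert (HD := diam_ge X a b Xa Xb).
  assert (0 < diam X ^ (2 * m)) by (apply pow_lt; lra).
  assert (HV := RInt_abs_sum_nonneg f g X a b ltac:(lra)).
  assert (0 <= diam X ^ m) by (apply pow_le; lra).
  assert (Hm := Rmult_le_pos _ _ H0 HV). lra.
Qed.

Lemma AV_le (f g h : R -> R) (m : nat) (X : list R) (a b e : R) :
  In a X -> In b X -> a < b -> Rabs (A_q f g h X a b / V_q m f g X a b) < e ->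
  Rabs (A_q f g h X a b) <= e * V_q m f g X a b.
Proof.
  intros Xa Xb Hab H. assert (HV := V_q_pos m f g X a b Xa Xb Hab).
  unfold Rdiv in H. rewrite Rabs_mult, Rabs_inv, (Rabs_pos_eq (V_q m f g X a b)) in H by lra.
  apply Rmult_le_reg_r with (/ V_q m f g X a b); [now apply Rinv_0_lt_compat|].
  rewrite (Rmult_assoc e), Rinv_r by lra. lra.
Qed.

Lemma gap_small (m : nat) (K : R -> Prop) (f g h : R -> R) (jf jg : nat -> R -> R) (eta : R) :
  (0 < m)%nat -> jet_of m K f jf -> jet_of m K g jg -> discrete_AV m K f g h -> 0 < eta ->
  exists delta, 0 < delta /\ forall a b, accum K a -> accum K b -> a < b < a + delta ->
    exists F G, bridge m jf jg a b (h b - h a) F G /\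
      exists X, pts_in K (S m) X /\ in_ball X a (b - a) /\
        forall x, a <= x <= b -> Rabs (F m x - nt nil f X m x) <= eta /\
                                 Rabs (G m x - nt nil g X m x) <= eta.
Proof.
  intros Hm Hf Hg HAV Heta.
  destruct (unit_small m eta Hm Heta) as [e [He HU]].
  assert (H2m : 1 <= 2 ^ m) by (apply pow_R1_Rle; lra).
  (* Seen from [b], the nodes lie in a ball of radius [2 d]; [2^m] pays for this. *)
  destruct (Hf (e / 2 ^ m) ltac:(apply Rdiv_lt_0_compat; lra)) as [d1 [Hd1 J1]].
  destruct (Hg (e / 2 ^ m) ltac:(apply Rdiv_lt_0_compat; lra)) as [d2 [Hd2 J2]].
  assert (H4m : 0 < 4 ^ m) by (apply pow_lt; lra).
  (* As [diam X <= 2 d], [V_q] is at most [4^m d^(2m) (1 + d^-m V)], with [V] the integral over the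
     gap. *)
  destruct (HAV (e / 4 ^ m) ltac:(apply Rdiv_lt_0_compat; lra)) as [d3 [Hd3 HA]].
  exists (Rmin (d1 / 2) (Rmin (d2 / 2) (d3 / 2))). split; [repeat apply Rmin_pos; lra|].
  intros a b Ka Kb Hab. set (d := b - a). assert (Hd : 0 < d) by (unfold d; lra).
  assert (Ed1 : 2 * d < d1) by (pose proof (Rmin_l (d1 / 2) (Rmin (d2 / 2) (d3 / 2))); unfold d; lra).
  assert (Ed23 : d < Rmin (d2 / 2) (d3 / 2))
    by (pose proof (Rmin_r (d1 / 2) (Rmin (d2 / 2) (d3 / 2))); unfold d; lra).
  assert (Ed2 : 2 * d < d2) by (pose proof (Rmin_l (d2 / 2) (d3 / 2)); lra).
  assert (Ed3 : 2 * d < d3) by (pose proof (Rmin_r (d2 / 2) (d3 / 2)); lra).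
  destruct (accum_config K a b d m Ka (proj1 Kb) ltac:(lra) Hd Hm) as [X [HX [Xa [Xb HXb]]]].
  assert (Hdab : Rabs (b - a) = d) by (apply Rabs_pos_eq; lra).
  destruct (config_balls X a b) as [Ba Bb]; [now rewrite Hdab|]. rewrite Hdab in Ba, Bb.
  set (Dm := diam X).
  assert (HD1 : d <= Dm) by now apply diam_ge.
  assert (HD2 : Dm <= 2 * d).
  { replace (2 * d) with ((a + d) - (a - d)) by ring. apply diam_le.
    - intros E; now rewrite E in Xa.
    - intros x Hx; now apply Rabs_le_between, Ba. }
  assert (Hdm : 0 < d ^ m) by now apply pow_lt.
  set (P := nt nil f X). set (Q := nt nil g X).
  assert (TP : forall n, tower n P) by (intros; apply tower_nt).
  assert (TQ : forall n, tower n Q) by (intros; apply tower_nt).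
  assert (HXl : length X = S m) by apply HX. assert (HXn : NoDup X) by apply HX.
  (* This rescaling keeps the [m]-th derivatives and divides areas by [d^(2m)], so the A/V bound
     becomes [e (1 + d^-m V)], where [d^-m V] is the integral for [P'] and [Q']. *)
  set (P' := resc (/ d ^ m) d a P). set (Q' := resc (/ d ^ m) d a Q).
  assert (Eab : d * 0 + a = a /\ d * 1 + a = b) by (unfold d; lra). destruct Eab as [Ea Eb].
  assert (Hjet : forall (phi : R -> R) (j : nat -> R -> R) k, (k <= m)%nat ->
    (forall a rho X k, accum K a -> 0 < rho -> rho <= 2 * d -> pts_in K (S m) X -> in_ball X a rho ->
      (k <= m)%nat -> Rabs (nt nil phi X k a - j k a) <= e / 2 ^ m * rho ^ (m - k)) ->
    Rabs (/ d ^ m * (d ^ k * j k a) - resc (/ d ^ m) d a (nt nil phi X) k 0) <= e /\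
    Rabs (/ d ^ m * (d ^ k * j k b) - resc (/ d ^ m) d a (nt nil phi X) k 1) <= e).
  { intros phi j k Hk HJ. unfold resc. rewrite Ea, Eb.
    assert (Ek : / d ^ m * (d ^ k * d ^ (m - k)) = 1).
    { rewrite <- pow_add. replace (k + (m - k))%nat with m by lia. field. lra. }
    assert (Hkp : 0 < d ^ k) by now apply pow_lt.
    assert (Hmk : 0 < d ^ (m - k)) by now apply pow_lt.
    assert (Hc : 0 <= / d ^ m * d ^ k) by (apply Rmult_le_pos; [apply Rlt_le, Rinv_0_lt_compat|]; lra).
    assert (Hgen : forall y z, Rabs (z - y) <= e * d ^ (m - k) ->
      Rabs (/ d ^ m * (d ^ k * y) - / d ^ m * (d ^ k * z)) <= e).
    { intros y z Hyz. rewrite <- !Rmult_assoc, <- Rmult_minus_distr_l, Rabs_mult, (Rabs_pos_eq _ Hc).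
      rewrite Rabs_minus_sym. replace e with (/ d ^ m * d ^ k * (e * d ^ (m - k)))
        by (rewrite <- (Rmult_1_r e) at 2; rewrite <- Ek; ring).
      now apply Rmult_le_compat_l. }
    assert (Hpp : forall n, 0 < 2 ^ n) by (intros; apply pow_lt; lra).
    assert (He2 : e / 2 ^ m <= e).
    { apply Rmult_le_reg_r with (2 ^ m); [lra|]. unfold Rdiv. rewrite Rmult_assoc, Rinv_l by lra. nra. }
    split; apply Hgen.
    - eapply Rle_trans; [apply (HJ a d); auto; lra|]. apply Rmult_le_compat_r; lra.
    - eapply Rle_trans; [apply (HJ b (2 * d)); auto; lra|]. rewrite Rpow_mult_distr, <- Rmult_assoc.
      apply Rmult_le_compat_r; [lra|].
      assert (2 ^ (m - k) <= 2 ^ m) by (apply Rle_pow; [lra|lia]).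
      replace e with (e / 2 ^ m * 2 ^ m) at 2 by (field; lra).
      apply Rmult_le_compat_l; [|easy]. apply Rlt_le, Rdiv_lt_0_compat; lra. }
  (* [a] and [b] are nodes, so the end values match exactly and only higher orders need Hermite
     corrections. These corrections therefore vanish at the ends, as the integration by parts
     requires. *)
  assert (Hzero : forall phi j, jet_of m K phi j ->
    / d ^ m * (d ^ 0 * j O a) = resc (/ d ^ m) d a (nt nil phi X) 0 0 /\
    / d ^ m * (d ^ 0 * j O b) = resc (/ d ^ m) d a (nt nil phi X) 0 1).
  { intros phi j Hj. unfold resc. rewrite Ea, Eb, !nt_interp by easy.
    now rewrite (jet_0 m K phi j a Hj Ka), (jet_0 m K phi j b Hj Kb). }
  destruct (Hzero f jf Hf) as [Z1 Z2]. destruct (Hzero g jg Hg) as [Z3 Z4].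
  assert (HaPQ : area P' Q' 0 1 = (/ d ^ m) ^ 2 * area P Q a b).
  { unfold P', Q'. rewrite area_resc by easy. now rewrite Ea, Eb. }
  set (V := RInt (fun t => Rabs (P 1%nat t) + Rabs (Q 1%nat t)) a b).
  assert (HV : RInt (fun t => Rabs (P' 1%nat t) + Rabs (Q' 1%nat t)) 0 1 = / d ^ m * V :> R).
  { unfold V. rewrite <- Ea at 1. rewrite <- Eb.
    assert (HcP : forall x, continuous (P 1%nat) x) by (intros; apply (tower_cont 1); auto).
    assert (HcQ : forall x, continuous (Q 1%nat) x) by (intros; apply (tower_cont 1); auto).
    rewrite <- (RInt_comp_lin (V := R_CompleteNormedModule)) by (apply ex_RInt_cont; intros; cont_tower).
    rewrite <- RInt_mulc.
    - apply RInt_cong; intros t. unfold scal; simpl; unfold mult; simpl. unfold P', Q', resc.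
      rewrite !Rabs_mult, pow_1, (Rabs_pos_eq d), (Rabs_pos_eq (/ d ^ m)); try lra.
      apply Rlt_le, Rinv_0_lt_compat; lra.
    - intros x. apply (continuous_mul (fun _ => d)); [apply continuous_cst|].
      apply (continuous_comp (fun y => d * y + a) (fun t => Rabs (P 1%nat t) + Rabs (Q 1%nat t))).
      + apply continuous_add; [|apply continuous_cst].
        apply continuous_mul; [apply continuous_cst|apply continuous_id].
      + cont_tower. }
  assert (HV0 : 0 <= V) by (apply RInt_abs_sum_nonneg; lra).
  assert (HAq : A_q f g h X a b = h b - h a - 2 * area P Q a b) by apply A_q_area.
  assert (HVq : V_q m f g X a b = Dm ^ (2 * m) + Dm ^ m * V) by apply V_q_nt.
  assert (HVle : V_q m f g X a b <= 4 ^ m * ((d ^ m) ^ 2 * (1 + / d ^ m * V))).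
  { rewrite HVq. replace (4 ^ m * ((d ^ m) ^ 2 * (1 + / d ^ m * V)))
      with (4 ^ m * (d ^ m) ^ 2 + 4 ^ m * d ^ m * V) by (field; lra).
    assert (E4 : 4 ^ m = 2 ^ m * 2 ^ m) by (rewrite <- Rpow_mult_distr; f_equal; ring).
    assert (HDm : 0 <= Dm ^ m <= 2 ^ m * d ^ m).
    { split; [apply pow_le; lra|]. rewrite <- Rpow_mult_distr. apply pow_incr; lra. }
    apply Rplus_le_compat.
    - replace (2 * m)%nat with (m + m)%nat by lia. rewrite pow_add, E4.
      replace (2 ^ m * 2 ^ m * (d ^ m) ^ 2) with ((2 ^ m * d ^ m) * (2 ^ m * d ^ m)) by ring.
      apply Rmult_le_compat; lra.
    - apply Rmult_le_compat_r; [easy|]. rewrite E4, Rmult_assoc. nra. }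
  assert (HAle : Rabs (A_q f g h X a b) <= e * ((d ^ m) ^ 2 * (1 + / d ^ m * V))).
  { apply Rle_trans with (e / 4 ^ m * V_q m f g X a b).
    - apply AV_le; auto; [lra|]. apply HA; auto; [lra|]. fold Dm; lra.
    - replace (e * ((d ^ m) ^ 2 * (1 + / d ^ m * V)))
        with (e / 4 ^ m * (4 ^ m * ((d ^ m) ^ 2 * (1 + / d ^ m * V)))) by (field; lra).
      apply Rmult_le_compat_l; [|easy]. apply Rlt_le, Rdiv_lt_0_compat; lra. }
  destruct (HU P' Q' (fun k => / d ^ m * (d ^ k * jf k a)) (fun k => / d ^ m * (d ^ k * jf k b))
      (fun k => / d ^ m * (d ^ k * jg k a)) (fun k => / d ^ m * (d ^ k * jg k b))
      ((/ d ^ m) ^ 2 * ((h b - h a) / 2))) as [F [G [TF [TG [HJ [HAr [HF HG]]]]]]]; auto.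
  - now apply tower_resc.
  - intros x. unfold P', resc, P. rewrite nt_high by lia. ring.
  - now apply tower_resc.
  - intros x. unfold Q', resc, Q. rewrite nt_high by lia. ring.
  - intros k Hk. destruct (Hjet f jf k Hk) as [? ?].
    { intros; apply J1; auto; lra. }
    destruct (Hjet g jg k Hk) as [? ?]; [|auto]. intros; apply J2; auto; lra.
  - rewrite HaPQ, HV, <- Rmult_minus_distr_l, Rabs_mult, Rabs_pos_eq by apply pow2_ge_0.
    apply Rmult_le_reg_l with ((d ^ m) ^ 2); [now apply pow_lt|].
    rewrite <- Rmult_assoc. replace ((d ^ m) ^ 2 * (/ d ^ m) ^ 2) with 1 by (field; lra).
    rewrite HAq in HAle.
    replace ((h b - h a) / 2 - area P Q a b) with (/ 2 * (h b - h a - 2 * area P Q a b)) by field.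
    rewrite Rabs_mult, (Rabs_pos_eq (/ 2)) by lra.
    pose proof (Rabs_pos (h b - h a - 2 * area P Q a b)). lra.
  - destruct (affine_ends a b ltac:(lra)) as [Ea' Eb']. fold d in Ea', Eb'.
    exists (resc (d ^ m) (/ d) (- a / d) F), (resc (d ^ m) (/ d) (- a / d) G). split.
    + split; [now apply tower_resc|split; [now apply tower_resc|split]].
      * intros k Hk. destruct (HJ k Hk) as [E1 [E2 [E3 E4]]]. unfold resc.
        rewrite Ea', Eb', E1, E2, E3, E4, pow_inv.
        assert (d ^ k <> 0) by (apply pow_nonzero; lra).
        repeat split; field; split; auto; lra.
      * rewrite area_resc; eauto using tower_le. rewrite Ea', Eb', HAr. field. lra.
    + exists X; split; [easy|split; [easy|]]. intros x Hx.
      set (t := / d * x + - a / d).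
      assert (Ht : 0 <= t <= 1).
      { rewrite <- Ea' at 1. rewrite <- Eb'. assert (0 < / d) by now apply Rinv_0_lt_compat.
        unfold t; split; apply Rplus_le_compat_r, Rmult_le_compat_l; lra. }
      assert (Etx : d * t + a = x) by (unfold t; field; lra).
      assert (Edd : d ^ m * (/ d) ^ m = 1) by (rewrite <- Rpow_mult_distr, Rinv_r, pow1; lra).
      specialize (HF m t (Nat.le_refl m) Ht). specialize (HG m t (Nat.le_refl m) Ht).
      assert (Hgen : forall p, / d ^ m * (d ^ m * p) = p) by (intros; field; lra).
      unfold P', Q', resc in HF, HG. rewrite Etx, Hgen in HF, HG.
      unfold resc. fold t. rewrite <- !Rmult_assoc, Edd, !Rmult_1_l. now split.
Qed.

(** * Gluing along a closed set *)

Definition gap (E : R -> Prop) (a b : R) : Prop :=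
  E a /\ E b /\ a < b /\ forall x, a < x < b -> ~ E x.

Definition closed_R (E : R -> Prop) : Prop :=
  forall x, ~ E x -> exists e, 0 < e /\ forall y, Rabs (y - x) < e -> ~ E y.

Lemma last_before (E : R -> Prop) (x y0 : R) :
  closed_R E -> ~ E x -> E y0 -> y0 < x -> exists a, E a /\ a < x /\ forall t, a < t <= x -> ~ E t.
Proof.
  intros HE Hx Hy0 Hlt.
  destruct (completeness (fun y => E y /\ y <= x)) as [a [Ha1 Ha2]].
  - exists x. intros y [_ Hy]; easy.
  - exists y0; split; [easy|lra].
  - assert (Hax : a <= x) by (apply Ha2; intros y [_ Hy]; easy).
    assert (HEa : E a).
    { apply NNPP; intros Hn. destruct (HE a Hn) as [e [He H]].
      assert (a <= a - e / 2); [|lra]. apply Ha2. intros y [Hy1 Hy2].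
      destruct (Rle_lt_dec y (a - e / 2)) as [|Hya]; [easy|].
      exfalso. apply (H y); [|easy]. assert (y <= a) by (apply Ha1; split; easy).
      apply Rabs_def1; lra. }
    exists a; split; [easy|split].
    + destruct Hax as [| ->]; easy.
    + intros t [Ht1 Ht2] HEt. assert (t <= a) by (apply Ha1; split; easy). lra.
Qed.

Lemma closed_opp (E : R -> Prop) : closed_R E -> closed_R (fun x => E (- x)).
Proof.
  intros HE x Hx. destruct (HE _ Hx) as [e [He H]]. exists e; split; [easy|].
  intros y Hy. apply H. replace (- y - - x) with (- (y - x)) by ring. now rewrite Rabs_Ropp.
Qed.

Lemma gap_around (E : R -> Prop) (p q x : R) :
  closed_R E -> (forall y, y <= p -> E y) -> (forall y, q <= y -> E y) -> ~ E x ->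
  exists a b, gap E a b /\ a < x < b.
Proof.
  intros HE Hp Hq Hx.
  destruct (last_before E x p HE Hx) as [a [Ha1 [Ha2 Ha3]]].
  { apply Hp; lra. }
  { apply Rnot_le_lt; intros H; apply Hx, Hp, H. }
  destruct (last_before (fun x => E (- x)) (- x) (- q)) as [b [Hb1 [Hb2 Hb3]]].
  { now apply closed_opp. }
  { now rewrite Ropp_involutive. }
  { rewrite Ropp_involutive; apply Hq; lra. }
  { apply Ropp_lt_contravar, Rnot_le_lt; intros H; apply Hx, Hq, H. }
  exists a, (- b). split; [|lra]. repeat split; auto; [lra|].
  intros t Ht. destruct (Rle_dec t x) as [H|H].
  - apply Ha3; lra.
  - rewrite <- (Ropp_involutive t). apply Hb3; lra.
Qed.

Lemma gap_unique (E : R -> Prop) (a b a' b' x : R) :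
  gap E a b -> gap E a' b' -> a < x < b -> a' < x < b' -> a = a' /\ b = b'.
Proof.
  intros [Ha [Hb [Hab H]]] [Ha' [Hb' [Hab' H']]] Hx Hx'. split.
  - destruct (Rtotal_order a a') as [Hl|[He|Hl]]; [|easy|]; exfalso.
    + apply (H a'); [lra|easy].
    + apply (H' a); [lra|easy].
  - destruct (Rtotal_order b b') as [Hl|[He|Hl]]; [|easy|]; exfalso.
    + apply (H' b); [lra|easy].
    + apply (H b'); [lra|easy].
Qed.

Lemma gap_side (E : R -> Prop) (c d x a : R) :
  gap E c d -> c < x < d -> E a -> (a <= x -> a <= c) /\ (x <= a -> d <= a).
Proof.
  intros [_ [_ [_ H]]] Hx Ha. split; intros Hax; apply Rnot_lt_le; intros Hlt.
  - apply (H a); [lra|easy].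
  - apply (H a); [lra|easy].
Qed.

Lemma glue_exists (E : R -> Prop) (u : R -> R) (v : R -> R -> R -> R) :
  (forall a b, gap E a b -> v a b a = u a /\ v a b b = u b) ->
  exists w : R -> R, (forall x, E x -> w x = u x) /\
    forall a b x, gap E a b -> a <= x <= b -> w x = v a b x.
Proof.
  intros Huv.
  assert (Hx : forall x, exists y, (E x -> y = u x) /\ forall a b, gap E a b -> a < x < b -> y = v a b x).
  { intros x. destruct (classic (E x)) as [HE|HE].
    - exists (u x); split; [easy|]. intros a b [_ [_ [_ H]]] Hx; exfalso; now apply (H x).
    - destruct (classic (exists a b, gap E a b /\ a < x < b)) as [[a [b [Hg Hx]]]|Hn].
      + exists (v a b x); split; [easy|]. intros a' b' Hg' Hx'.
        now destruct (gap_unique E a b a' b' x Hg Hg' Hx Hx') as [-> ->].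
      + exists 0; split; [easy|]. intros a b Hg Hx; exfalso; apply Hn; now exists a, b. }
  destruct (functional_choice _ Hx) as [w Hw]. exists w; split; [apply Hw|].
  intros a b x Hg Hx'. destruct (Huv a b Hg) as [Ea Eb].
  destruct (Req_dec x a) as [->|Hxa]; [|destruct (Req_dec x b) as [->|Hxb]].
  - rewrite Ea; apply Hw, Hg.
  - rewrite Eb; apply Hw, Hg.
  - apply Hw; [easy|lra].
Qed.

(** * Differentiability and continuity of glued functions *)

Lemma is_derive_of_eps (f : R -> R) (x l : R) :
  (forall e, 0 < e -> exists d, 0 < d /\
     forall y, Rabs (y - x) < d -> Rabs (f y - f x - l * (y - x)) <= e * Rabs (y - x)) ->
  is_derive f x l.
Proof.
  intros H. apply is_derive_Reals. intros e He.
  destruct (H (e / 2) ltac:(lra)) as [d [Hd Hf]].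
  exists (mkposreal d Hd). intros t Ht Htd. simpl in Htd.
  specialize (Hf (x + t)). replace (x + t - x) with t in Hf by ring. specialize (Hf Htd).
  replace ((f (x + t) - f x) / t - l) with ((f (x + t) - f x - l * t) / t) by (field; easy).
  assert (0 < Rabs t) by now apply Rabs_pos_lt.
  unfold Rdiv. rewrite Rabs_mult, Rabs_inv.
  apply Rmult_lt_reg_r with (Rabs t); [easy|]. rewrite Rmult_assoc, Rinv_l by lra. nra.
Qed.

Lemma eps_of_is_derive (f : R -> R) (x l : R) :
  is_derive f x l -> forall e, 0 < e -> exists d, 0 < d /\
     forall y, Rabs (y - x) < d -> Rabs (f y - f x - l * (y - x)) <= e * Rabs (y - x).
Proof.
  intros H e He. apply is_derive_Reals in H. destruct (H e He) as [[d Hd] Hf].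
  exists d; split; [easy|]. intros y Hy. destruct (Req_dec y x) as [->|Hyx].
  - rewrite !Rminus_diag, Rmult_0_r, Rminus_diag, Rabs_R0; lra.
  - specialize (Hf (y - x) ltac:(lra) Hy). replace (x + (y - x)) with y in Hf by ring.
    replace (f y - f x - l * (y - x)) with (((f y - f x) / (y - x) - l) * (y - x)) by (field; lra).
    rewrite Rabs_mult. apply Rmult_le_compat_r; [apply Rabs_pos|lra].
Qed.

Definition rel_derive (E : R -> Prop) (f : R -> R) (a l : R) : Prop :=
  forall e, 0 < e -> exists d, 0 < d /\
    forall y, E y -> Rabs (y - a) < d -> Rabs (f y - f a - l * (y - a)) <= e * Rabs (y - a).

(** Holds for a closed set that contains a ray in each direction; every gap then has data at both
    ends. *)
Definition gaps_fill (E : R -> Prop) : Prop :=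
  forall x, ~ E x -> exists a b, gap E a b /\ a < x < b.

(* Extended by constants over the gaps, [W] has derivative 0 everywhere. *)
Lemma rel_constant (E : R -> Prop) (W : R -> R) :
  gaps_fill E -> (forall a b, gap E a b -> W a = W b) ->
  (forall a, E a -> rel_derive E W a 0) -> forall x y, E x -> E y -> W x = W y.
Proof.
  intros Hfill Hgap Hrel.
  destruct (glue_exists E W (fun a _ _ => W a)) as [w [HwE Hwg]].
  { intros a b Hg; split; [easy|now apply Hgap]. }
  assert (Hder : forall x, is_derive w x 0).
  { intros x. destruct (classic (E x)) as [HE|HE].
    - apply is_derive_of_eps. intros e He. destruct (Hrel x HE e He) as [d [Hd H]].
      exists d; split; [easy|]. intros y Hy.
      destruct (classic (E y)) as [HEy|HEy].
      { rewrite !HwE by easy. now apply H. }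
      destruct (Hfill y HEy) as [a [b [Hg Hab]]].
      destruct (gap_side E a b y x Hg Hab HE) as [Hs1 Hs2].
      rewrite (Hwg a b y Hg) by lra. rewrite (HwE x HE), Rmult_0_l, Rminus_0_r.
      (* The end of the gap facing [x] lies between [x] and [y], so it is no farther from [x] than
         [y] is. *)
      assert (Hc : exists c, E c /\ W a = W c /\ Rabs (c - x) <= Rabs (y - x)).
      { destruct (Rle_dec x y) as [Hxy|Hxy].
        - exists a; split; [apply Hg|split; [easy|]]. specialize (Hs1 Hxy).
          rewrite !Rabs_pos_eq; lra.
        - exists b; split; [apply Hg|split; [now apply Hgap|]]. specialize (Hs2 ltac:(lra)).
          rewrite !Rabs_left1; lra. }
      destruct Hc as [c [Ec [-> Hcx]]].
      specialize (H c Ec ltac:(lra)). rewrite Rmult_0_l, Rminus_0_r in H.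
      eapply Rle_trans; [apply H|]. apply Rmult_le_compat_l; lra.
    - destruct (Hfill x HE) as [a [b [Hg Hab]]].
      apply (is_derive_ext_loc (fun _ => W a)); [|apply (is_derive_const (W a))].
      assert (Hr : 0 < Rmin (x - a) (b - x)) by (apply Rmin_pos; lra).
      exists (mkposreal _ Hr). intros y Hy. symmetry; apply (Hwg a b y Hg).
      apply (Rabs_def2 (y - x)) in Hy. simpl in Hy.
      pose proof (Rmin_l (x - a) (b - x)); pose proof (Rmin_r (x - a) (b - x)); lra. }
  intros x y Hx Hy. rewrite <- !HwE by easy.
  destruct (mean_value w (fun _ => 0) y x Hder) as [c [_ Hc]]. lra.
Qed.

(** Differentiating [U] directly at a point of [E] would need estimates inside nearby gaps. Instead
    [U] is compared with a primitive [I] of the continuous [V]: [U - I] is constant on each gap and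
    has relative derivative 0 on [E], hence is constant. *)
Lemma glue_derive (E : R -> Prop) (U V : R -> R) :
  gaps_fill E -> (forall x, continuous V x) ->
  (forall a b, gap E a b -> exists u v : R -> R, (forall x, is_derive u x (v x)) /\
     forall x, a <= x <= b -> U x = u x /\ V x = v x) ->
  (forall a, E a -> rel_derive E U a (V a)) ->
  forall x, is_derive U x (V x).
Proof.
  intros Hfill HV Hgap Hrel.
  set (I := fun x => RInt V 0 x).
  assert (HI : forall x, is_derive I x (V x)).
  { intros x. apply (is_derive_RInt V I 0 x); [|apply HV].
    apply filter_forall; intros y. apply (RInt_correct V), ex_RInt_cont, HV. }
  assert (Hseg : forall a b x, gap E a b -> a <= x <= b -> U x - I x = U a - I a).
  { intros a b x Hg Hx. destruct (Hgap a b Hg) as [u [v [Hu Huv]]].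
    destruct (Huv x Hx) as [-> _]. destruct (Huv a ltac:(lra)) as [-> _].
    destruct (Req_dec x a) as [->|Hxa]; [easy|]. symmetry.
    apply (eq_is_derive (fun t => u t - I t)); [|lra]. intros t Ht.
    eapply is_derive_eq; [apply is_derive_sub; [apply Hu|apply HI]|].
    destruct (Huv t ltac:(lra)) as [_ ->]. unfold zero; simpl; ring. }
  assert (HW : forall x y, E x -> E y -> U x - I x = U y - I y).
  { apply (rel_constant E (fun x => U x - I x)); auto.
    - intros a b Hg. symmetry; apply (Hseg a b b Hg). destruct Hg as [_ [_ [Hab _]]]; lra.
    - intros a Ha e He.
      destruct (Hrel a Ha (e / 2) ltac:(lra)) as [d1 [Hd1 H1]].
      destruct (eps_of_is_derive I a (V a) (HI a) (e / 2) ltac:(lra)) as [d2 [Hd2 H2]].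
      exists (Rmin d1 d2); split; [now apply Rmin_pos|]. intros y Hy Hya.
      specialize (H1 y Hy (Rlt_le_trans _ _ _ Hya (Rmin_l d1 d2))).
      specialize (H2 y (Rlt_le_trans _ _ _ Hya (Rmin_r d1 d2))).
      replace (U y - I y - (U a - I a) - 0 * (y - a)) with
        ((U y - U a - V a * (y - a)) + - (I y - I a - V a * (y - a))) by ring.
      eapply Rle_trans; [apply Rabs_triang|]. rewrite Rabs_Ropp. lra. }
  assert (Hc : exists c, forall x, U x = I x + c).
  { destruct (classic (exists a, E a)) as [[a Ha]|Hn].
    - exists (U a - I a). intros x. destruct (classic (E x)) as [Hx|Hx].
      + rewrite (HW a x Ha Hx); ring.
      + destruct (Hfill x Hx) as [c [d [Hg Hcd]]].
        assert (Hs := Hseg c d x Hg ltac:(lra)). assert (Hw := HW a c Ha (proj1 Hg)). lra.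
    - exfalso. destruct (Hfill 0) as [a [b [[Ha _] _]]]; [intros H0; apply Hn; now exists 0|].
      apply Hn; now exists a. }
  destruct Hc as [c Hc]. intros x.
  apply (is_derive_ext (fun t => I t + c)); [intros; now rewrite Hc|].
  eapply is_derive_eq; [apply is_derive_add; [apply HI|apply (is_derive_const c x)]|].
  unfold zero; simpl; ring.
Qed.

Definition gap_cont (E : R -> Prop) (V : R -> R) : Prop :=
  forall c d, gap E c d -> exists v : R -> R, (forall x, continuous v x) /\
    forall x, c <= x <= d -> V x = v x.

(* If some point of [E] lies just to the right of [a], nearby gaps are short; otherwise [a] itself starts a gap. *)
Lemma glue_right (E : R -> Prop) (V : R -> R) (a e r : R) :
  gaps_fill E -> gap_cont E V -> E a -> 0 < e -> 0 < r ->
  (forall y, E y -> Rabs (y - a) < r -> Rabs (V y - V a) <= e) ->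
  (forall c d x, gap E c d -> Rabs (c - a) < r -> Rabs (d - a) < r -> c <= x <= d ->
     Rabs (V x - V a) <= e) ->
  exists s, 0 < s /\ forall y, a <= y < a + s -> Rabs (V y - V a) <= e.
Proof.
  intros Hfill Hcont Ha He Hr Hrel Hsmall.
  assert (Haa : forall y, y = a -> Rabs (V y - V a) <= e).
  { intros y ->. rewrite Rminus_diag, Rabs_R0; lra. }
  destruct (classic (exists x0, E x0 /\ a < x0 < a + r)) as [[x0 [Ex0 Hx0]]|Hn].
  - exists (x0 - a); split; [lra|]. intros y Hy.
    destruct (classic (E y)) as [HEy|HEy].
    { apply Hrel; auto. apply Rabs_def1; lra. }
    destruct (Hfill y HEy) as [c [d [Hg Hcd]]].
    destruct (gap_side E c d y a Hg Hcd Ha) as [Hs _]. specialize (Hs ltac:(lra)).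
    destruct (gap_side E c d y x0 Hg Hcd Ex0) as [_ Ht]. specialize (Ht ltac:(lra)).
    apply (Hsmall c d); auto; try (apply Rabs_def1; lra); lra.
  - assert (HnE : forall y, a < y < a + r -> ~ E y) by (intros y Hy HEy; apply Hn; now exists y).
    destruct (Hfill (a + r / 2)) as [c [d [Hg Hcd]]]; [apply HnE; lra|].
    destruct (gap_side E c d _ a Hg Hcd Ha) as [Hs _]. specialize (Hs ltac:(lra)).
    assert (Hca : c = a).
    { destruct Hs as [Hs|Hs]; [|easy]. exfalso; apply (HnE c); [lra|apply Hg]. }
    subst c. destruct (Hcont a d Hg) as [v [Hv HVv]].
    destruct (cont_eps v a e (Hv a) He) as [s [Hs' H]].
    exists (Rmin s (r / 2)); split; [apply Rmin_pos; lra|]. intros y Hy.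
    pose proof (Rmin_l s (r / 2)); pose proof (Rmin_r s (r / 2)).
    rewrite (HVv y), (HVv a) by lra. apply Rlt_le, H. rewrite Rabs_pos_eq; lra.
Qed.

Lemma gap_opp (E : R -> Prop) (a b : R) : gap (fun x => E (- x)) a b -> gap E (- b) (- a).
Proof.
  intros [Ha [Hb [Hab H]]]. split; [easy|split; [easy|split; [lra|]]].
  intros x Hx HE. apply (H (- x)); [lra|now rewrite Ropp_involutive].
Qed.

Lemma glue_continuous (E : R -> Prop) (V : R -> R) :
  gaps_fill E -> gap_cont E V ->
  (forall a e, E a -> 0 < e -> exists r, 0 < r /\
    (forall y, E y -> Rabs (y - a) < r -> Rabs (V y - V a) <= e) /\
    (forall c d x, gap E c d -> Rabs (c - a) < r -> Rabs (d - a) < r -> c <= x <= d ->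
       Rabs (V x - V a) <= e)) ->
  forall x, continuous V x.
Proof.
  intros Hfill Hcont Hloc x. destruct (classic (E x)) as [HE|HE].
  - apply continuity_pt_filterlim. intros e He.
    destruct (Hloc x (e / 2) HE ltac:(lra)) as [r [Hr [H1 H2]]].
    destruct (glue_right E V x (e / 2) r) as [s1 [Hs1 Hr1]]; auto; [lra|].
    assert (Habs : forall y, Rabs (- y - x) = Rabs (y - - x)).
    { intros y. replace (- y - x) with (- (y - - x)) by ring. apply Rabs_Ropp. }
    (* Continuity from the left is continuity from the right after reflection. *)
    destruct (glue_right (fun t => E (- t)) (fun t => V (- t)) (- x) (e / 2) r) as [s2 [Hs2 Hr2]].
    + intros y Hy. destruct (Hfill (- y) Hy) as [a [b [Hg Hab]]].
      exists (- b), (- a). split; [|lra]. apply gap_opp.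
      destruct Hg as [Ga [Gb [Gab G]]]; repeat split; rewrite ?Ropp_involutive; auto.
      intros z Hz. rewrite Ropp_involutive; apply G; lra.
    + intros c d Hg. destruct (Hcont _ _ (gap_opp E c d Hg)) as [v [Hv HVv]].
      exists (fun t => v (- t)); split.
      * intros y. apply (continuous_comp (fun t => - t) v); [|apply Hv].
        apply (is_derive_cont _ _ (-1)). auto_derive; [easy|ring].
      * intros y Hy. apply HVv; lra.
    + now rewrite Ropp_involutive.
    + lra.
    + easy.
    + intros y Hy Hyx. rewrite Ropp_involutive. apply H1; auto. now rewrite Habs.
    + intros c d y Hg Hc Hd Hy. rewrite Ropp_involutive.
      apply (H2 (- d) (- c)); [now apply gap_opp|now rewrite Habs|now rewrite Habs|lra].
    + exists (Rmin s1 s2); split; [now apply Rmin_pos|].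
      intros y [_ Hy]. simpl in Hy. unfold Rdist in Hy. simpl. unfold Rdist.
      pose proof (Rmin_l s1 s2); pose proof (Rmin_r s1 s2).
      apply Rle_lt_trans with (e / 2); [|lra]. apply Rabs_def2 in Hy.
      destruct (Rle_dec x y) as [Hxy|Hxy].
      * apply Hr1; lra.
      * specialize (Hr2 (- y) ltac:(lra)). now rewrite !Ropp_involutive in Hr2.
  - destruct (Hfill x HE) as [a [b [Hg Hab]]]. destruct (Hcont a b Hg) as [v [Hv HVv]].
    apply (continuous_ext_loc V v x); [|apply Hv].
    assert (Hr : 0 < Rmin (x - a) (b - x)) by (apply Rmin_pos; lra).
    exists (mkposreal _ Hr). intros y Hy. symmetry; apply HVv.
    apply (Rabs_def2 (y - x)) in Hy. simpl in Hy.
    pose proof (Rmin_l (x - a) (b - x)); pose proof (Rmin_r (x - a) (b - x)); lra.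
Qed.

(* A choice that is good at every scale [1/(n+1) > size i] at which a good choice exists. *)
Lemma uniform_choice (I T : Type) (B : I -> T -> Prop) (Q : I -> T -> R -> Prop) (size : I -> R)
    (S0 : I -> Prop) :
  (forall i, 0 < size i -> exists t, B i t) ->
  (forall i t e e', Q i t e -> e <= e' -> Q i t e') ->
  (forall e, 0 < e -> exists d, 0 < d /\ forall i, S0 i -> 0 < size i < d -> exists t, B i t /\ Q i t e) ->
  inhabited T ->
  exists sel : I -> T, (forall i, 0 < size i -> B i (sel i)) /\
    forall e, 0 < e -> exists d, 0 < d /\ forall i, S0 i -> 0 < size i < d -> Q i (sel i) e.
Proof.
  intros HB HQ Hsm [t0].
  (* The hypothesis gives a good [t] for one tolerance at a time. Only finitely many scales
     [1/(n+1)] exceed [size i], and a choice for the finest attainable one also serves the coarser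
     ones. *)
  assert (HI : forall i, exists t, 0 < size i -> B i t /\
    forall n, size i < / INR (S n) -> (exists t', B i t' /\ Q i t' (/ INR (S n))) -> Q i t (/ INR (S n))).
  { intros i. destruct (classic (0 < size i)) as [Hi|Hi]; [|now exists t0].
    destruct (archimed_cor1 (size i) Hi) as [N [HN HN0]].
    assert (Hle : forall n p, (n <= p)%nat -> / INR (S p) <= / INR (S n)).
    { intros n p Hnp. apply Rinv_le_contravar; [apply lt_0_INR; lia|apply le_INR; lia]. }
    assert (Hind : forall N, exists t, B i t /\ forall n, (n < N)%nat ->
      (exists t', B i t' /\ Q i t' (/ INR (S n))) -> Q i t (/ INR (S n))).
    { clear N HN HN0. induction N as [|N [t [Ht1 Ht2]]].
      - destruct (HB i Hi) as [t Ht]. exists t; split; [easy|]. intros; lia.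
      - destruct (classic (exists t', B i t' /\ Q i t' (/ INR (S N)))) as [[t' [Hb' Hq']]|Hn].
        + exists t'; split; [easy|]. intros n Hn _. apply (HQ i t' (/ INR (S N))); auto.
          apply Hle; lia.
        + exists t; split; [easy|]. intros n Hn' Hex. destruct (Nat.eq_dec n N) as [->|Hne]; [easy|].
          apply Ht2; auto; lia. }
    destruct (Hind N) as [t [Ht1 Ht2]]. exists t. intros _; split; [easy|].
    intros n Hn. apply Ht2. apply Nat.nle_gt. intros HNn.
    assert (/ INR (S n) <= / INR N) by (apply Rinv_le_contravar; [apply lt_0_INR; lia|apply le_INR; lia]).
    lra. }
  destruct (functional_choice _ HI) as [sel Hsel]. exists sel. split; [intros; now apply Hsel|].
  intros e He. destruct (archimed_cor1 e He) as [[|n] [Hn Hn0]]; [lia|].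
  assert (Hp : 0 < / INR (S n)) by (apply Rinv_0_lt_compat, lt_0_INR; lia).
  destruct (Hsm (/ INR (S n)) Hp) as [d [Hd H]].
  exists (Rmin d (/ INR (S n))); split; [now apply Rmin_pos|]. intros i Si Hi.
  pose proof (Rmin_l d (/ INR (S n))); pose proof (Rmin_r d (/ INR (S n))).
  apply (HQ i (sel i) (/ INR (S n))); [|lra]. apply Hsel; [lra|lra|]. apply H; auto. lra.
Qed.

(** * The extension *)

Lemma prod_close (p q u v B e : R) :
  Rabs (p - u) <= e -> Rabs (q - v) <= e -> e <= 1 -> Rabs u + Rabs v + 1 <= B ->
  Rabs (p * q - u * v) <= e * B.
Proof.
  intros Hp Hq He HB. replace (p * q - u * v) with ((p - u) * (q - v) + ((p - u) * v + u * (q - v))) by ring.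
  assert (He0 := Rabs_pos (p - u)).
  eapply Rle_trans; [apply Rabs_triang|]. eapply Rle_trans; [apply Rplus_le_compat_l, Rabs_triang|].
  rewrite !Rabs_mult. pose proof (Rabs_pos (q - v)). pose proof (Rabs_pos u). pose proof (Rabs_pos v).
  assert (Rabs (p - u) * Rabs (q - v) <= e * 1) by (apply Rmult_le_compat; lra).
  assert (Rabs (p - u) * Rabs v <= e * Rabs v) by (apply Rmult_le_compat_r; lra).
  assert (Rabs u * Rabs (q - v) <= Rabs u * e) by (apply Rmult_le_compat_l; lra).
  nra.
Qed.

(* The discrete A/V condition alone already forces the horizontality equation for the first-order jet of [h]. *)
Lemma h_derivative (m : nat) (K : R -> Prop) (f g h : R -> R) (jf jg : nat -> R -> R) (a : R) :
  (0 < m)%nat -> dd_unif_conv m K f -> dd_unif_conv m K g ->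
  jet_of m K f jf -> jet_of m K g jg -> discrete_AV m K f g h -> accum K a ->
  rel_derive K h a (2 * (jf 1%nat a * jg O a - jf O a * jg 1%nat a)).
Proof.
  intros Hm Hdf Hdg Hf Hg HAV Ha e He.
  set (c := jf 1%nat a * jg O a - jf O a * jg 1%nat a).
  set (B := Rabs (jf 1%nat a) + Rabs (jg O a) + Rabs (jf O a) + Rabs (jg 1%nat a) + 1).
  assert (HB : 1 <= B).
  { unfold B. pose proof (Rabs_pos (jf 1%nat a)); pose proof (Rabs_pos (jg O a)).
    pose proof (Rabs_pos (jf O a)); pose proof (Rabs_pos (jg 1%nat a)). lra. }
  set (e' := Rmin 1 (e / (8 * B))).
  assert (He' : 0 < e') by (apply Rmin_pos; [lra|apply Rdiv_lt_0_compat; lra]).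
  assert (He1 : e' <= 1) by apply Rmin_l.
  assert (HeB : e' * B <= e / 8).
  { assert (e' <= e / (8 * B)) by apply Rmin_r.
    replace (e / 8) with (e / (8 * B) * B) by (field; lra). apply Rmult_le_compat_r; lra. }
  destruct (jet_local m K f jf a e' 0 Hdf Hf Ha ltac:(lia) He') as [d1 [Hd1 L1]].
  destruct (jet_local m K f jf a e' 1 Hdf Hf Ha ltac:(lia) He') as [d2 [Hd2 L2]].
  destruct (jet_local m K g jg a e' 0 Hdg Hg Ha ltac:(lia) He') as [d3 [Hd3 L3]].
  destruct (jet_local m K g jg a e' 1 Hdg Hg Ha ltac:(lia) He') as [d4 [Hd4 L4]].
  (* Tolerance 1 is enough: [V_q] is of order [t^2] here, and [d6] makes it at most [e t / 2]. *)
  destruct (HAV 1 ltac:(lra)) as [d5 [Hd5 HA]].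
  set (d6 := e / (2 * (4 + 2 * (B + 2)))).
  assert (Hd6 : 0 < d6) by (apply Rdiv_lt_0_compat; lra).
  set (d := Rmin (Rmin (Rmin d1 d2) (Rmin d3 d4)) (Rmin (Rmin (d5 / 2) (1 / 2)) d6)).
  assert (Hd : 0 < d) by (repeat apply Rmin_pos; lra).
  assert (D1 : d <= d1) by (unfold d; eapply Rle_trans; [apply Rmin_l|]; eapply Rle_trans; [apply Rmin_l|apply Rmin_l]).
  assert (D2 : d <= d2) by (unfold d; eapply Rle_trans; [apply Rmin_l|]; eapply Rle_trans; [apply Rmin_l|apply Rmin_r]).
  assert (D3 : d <= d3) by (unfold d; eapply Rle_trans; [apply Rmin_l|]; eapply Rle_trans; [apply Rmin_r|apply Rmin_l]).
  assert (D4 : d <= d4) by (unfold d; eapply Rle_trans; [apply Rmin_l|]; eapply Rle_trans; [apply Rmin_r|apply Rmin_r]).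
  assert (D5 : d <= d5 / 2) by (unfold d; eapply Rle_trans; [apply Rmin_r|]; eapply Rle_trans; [apply Rmin_l|apply Rmin_l]).
  assert (D7 : d <= 1 / 2) by (unfold d; eapply Rle_trans; [apply Rmin_r|]; eapply Rle_trans; [apply Rmin_l|apply Rmin_r]).
  assert (D6 : d <= d6) by (unfold d; eapply Rle_trans; [apply Rmin_r|apply Rmin_r]).
  clearbody d. exists d; split; [easy|]. intros y Ky Hya.
  destruct (Req_dec a y) as [<-|Hne].
  { rewrite !Rminus_diag, Rmult_0_r, Rminus_diag, Rabs_R0. lra. }
  set (t := Rabs (y - a)) in *. assert (Ht : 0 < t) by (apply Rabs_pos_lt; lra).
  destruct (accum_config K a y t m Ha Ky Hne Ht Hm) as [X [HX [Xa [Xy HXy]]]].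
  destruct (config_balls X a y HXy) as [Ba _]. fold t in Ba.
  set (P := nt nil f X). set (Q := nt nil g X).
  assert (HDm : diam X <= 2 * t).
  { replace (2 * t) with ((a + t) - (a - t)) by ring. apply diam_le.
    - intros E; now rewrite E in Xa.
    - intros x Hx; now apply Rabs_le_between, Ba. }
  assert (Hball : forall r, d <= r -> in_ball X a r) by (intros r Hr x Hx; specialize (Ba x Hx); lra).
  assert (Hx : forall x, Rabs (x - a) <= t ->
    Rabs (P O x - jf O a) <= e' /\ Rabs (P 1%nat x - jf 1%nat a) <= e' /\
    Rabs (Q O x - jg O a) <= e' /\ Rabs (Q 1%nat x - jg 1%nat a) <= e').
  { intros x Hxa. repeat split.
    - apply L1; auto; lra.
    - apply L2; auto; lra.
    - apply L3; auto; lra.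
    - apply L4; auto; lra. }
  assert (TP : forall n, tower n P) by (intros; apply tower_nt).
  assert (TQ : forall n, tower n Q) by (intros; apply tower_nt).
  assert (cP : forall k x, continuous (P k) x) by (intros; apply (tower_cont k); auto).
  assert (cQ : forall k x, continuous (Q k) x) by (intros; apply (tower_cont k); auto).
  (* Stated for a general pair because the A/V condition orders its two points, while [y] may lie on
     either side of [a]. *)
  assert (Hseg : forall a' b', a' < b' -> b' - a' = t -> In a' X -> In b' X ->
    (forall x, a' <= x <= b' -> Rabs (x - a) <= t) ->
    Rabs (h b' - h a' - 2 * c * (b' - a')) <= e * t).
  { intros a' b' Hab Habt Xa' Xb' Hin.
    assert (HAq := AV_le f g h m X a' b' 1 Xa' Xb' Hab (HA X a' b' HX Xa' Xb' Hab ltac:(lra))).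
    rewrite A_q_area in HAq. fold P Q in HAq.
    assert (HD0 : 0 <= diam X) by (pose proof (diam_ge X a' b' Xa' Xb'); lra).
    assert (HVq : V_q m f g X a' b' <= e / 2 * t).
    { rewrite V_q_nt. fold P Q.
      assert (HI : RInt (fun x => Rabs (P 1%nat x) + Rabs (Q 1%nat x)) a' b' <= (B + 2) * t).
      { eapply Rle_trans; [apply (RInt_le_cont _ (fun _ => B + 2)); [lra|intros; cont_tower|intros; cont_tower|]|].
        - intros x Hx'. destruct (Hx x (Hin x Hx')) as [_ [Q1 [_ Q2]]].
          pose proof (Rabs_triang_inv (P 1%nat x) (jf 1%nat a)).
          pose proof (Rabs_triang_inv (Q 1%nat x) (jg 1%nat a)).
          pose proof (Rabs_pos (jg O a)); pose proof (Rabs_pos (jf O a)). unfold B. lra.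
        - rewrite RInt_cst, Habt. lra. }
      assert (HI0 := RInt_abs_sum_nonneg f g X a' b' ltac:(lra)). fold P Q in HI0.
      assert (E1 : diam X ^ (2 * m) <= 4 * t * t).
      { eapply Rle_trans; [apply pow_incr; split; [exact HD0|exact HDm]|].
        replace (2 * m)%nat with (2 + (2 * m - 2))%nat by lia. rewrite pow_add.
        assert ((2 * t) ^ (2 * m - 2) <= 1) by (apply pow_le_1; lra).
        assert (0 <= (2 * t) ^ 2) by apply pow2_ge_0. simpl in *. nra. }
      assert (E2 : diam X ^ m <= 2 * t).
      { eapply Rle_trans; [apply pow_incr; split; [exact HD0|exact HDm]|].
        replace m with (S (m - 1)) by lia. simpl.
        assert ((2 * t) ^ (m - 1) <= 1) by (apply pow_le_1; lra). nra. }
      assert (E3 : diam X ^ m * RInt (fun x => Rabs (P 1%nat x) + Rabs (Q 1%nat x)) a' b' <= 2 * t * ((B + 2) * t)).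
      { apply Rmult_le_compat; auto. now apply pow_le. }
      assert (E4 : t * (4 + 2 * (B + 2)) <= e / 2).
      { replace (e / 2) with (d6 * (4 + 2 * (B + 2))) by (unfold d6; field; lra).
        apply Rmult_le_compat_r; lra. }
      assert (t * (4 + 2 * (B + 2)) * t <= e / 2 * t) by (apply Rmult_le_compat_r; lra). nra. }
    assert (HI : Rabs (area P Q a' b' - c * (b' - a')) <= e / 4 * t).
    { rewrite <- (RInt_cst c). unfold area. rewrite <- RInt_sub by (intros; cont_tower).
      eapply Rle_trans; [apply (RInt_abs_le _ (fun _ => e / 4)); [lra|intros; cont_tower|intros; cont_tower|]|].
      - intros x Hx'. destruct (Hx x (Hin x Hx')) as [Q0 [Q1 [Q2 Q3]]].
        pose proof (Rabs_pos (jf 1%nat a)); pose proof (Rabs_pos (jg O a)).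
        pose proof (Rabs_pos (jf O a)); pose proof (Rabs_pos (jg 1%nat a)).
        assert (R1 := prod_close _ _ _ _ B e' Q1 Q2 He1 ltac:(unfold B; lra)).
        assert (R2 := prod_close _ _ _ _ B e' Q0 Q3 He1 ltac:(unfold B; lra)).
        unfold c.
        replace (P 1%nat x * Q O x - P O x * Q 1%nat x - (jf 1%nat a * jg O a - jf O a * jg 1%nat a))
          with ((P 1%nat x * Q O x - jf 1%nat a * jg O a) + - (P O x * Q 1%nat x - jf O a * jg 1%nat a)) by ring.
        eapply Rle_trans; [apply Rabs_triang|]. rewrite Rabs_Ropp. lra.
      - rewrite RInt_cst, Habt. lra. }
    replace (h b' - h a' - 2 * c * (b' - a')) with
      ((h b' - h a' - 2 * area P Q a' b') + 2 * (area P Q a' b' - c * (b' - a'))) by ring.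
    eapply Rle_trans; [apply Rabs_triang|]. rewrite (Rabs_mult 2), (Rabs_pos_eq 2) by lra. lra. }
  destruct (Rlt_le_dec a y) as [Hay|Hay].
  - assert (Hty : t = y - a) by (apply Rabs_pos_eq; lra).
    apply Hseg; auto; try lra. intros x Hx'. rewrite Rabs_pos_eq; lra.
  - assert (Hty : t = a - y) by (unfold t; rewrite Rabs_left1; lra).
    rewrite <- Rabs_Ropp. replace (- (h y - h a - 2 * c * (y - a))) with (h a - h y - 2 * c * (a - y)) by ring.
    apply Hseg; auto; try lra. intros x Hx'. rewrite Rabs_left1; lra.
Qed.

(** Fixes the jet where [jet_of] leaves it free: at isolated points it has the right value, and
    outside [K], where the added rays lie, it is 0. *)
Lemma jet_extend (m : nat) (K : R -> Prop) (phi : R -> R) :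
  dd_unif_conv m K phi ->
  exists J, jet_of m K phi J /\ (forall x, K x -> J O x = phi x) /\ (forall k x, ~ K x -> J k x = 0).
Proof.
  intros Hdd. destruct (jet_exists m K phi Hdd) as [j Hj].
  assert (Hv : forall kx : nat * R, exists v, (accum K (snd kx) -> v = j (fst kx) (snd kx)) /\
     (K (snd kx) -> fst kx = O -> v = phi (snd kx)) /\ (~ K (snd kx) -> v = 0)).
  { intros [k x]; simpl. destruct (classic (accum K x)) as [Ha|Ha].
    - exists (j k x); repeat split; auto.
      + intros _ ->. now apply (jet_0 m K).
      + intros Hn; exfalso; now apply Hn, Ha.
    - destruct (classic (K x)) as [HK|HK].
      (* At an isolated point only order 0 is prescribed; the other orders simply receive the same
         number. *)
      + exists (phi x); repeat split; tauto.
      + exists 0; repeat split; tauto. }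
  destruct (functional_choice _ Hv) as [J HJ]. exists (fun k x => J (k, x)). repeat split.
  - intros e He. destruct (Hj e He) as [d [Hd H]]. exists d; split; [easy|].
    intros a rho X k Ha Hr HX BX Hk. destruct (HJ (k, a)) as [E _]. rewrite (E Ha). now apply H.
  - intros x Hx. now apply (HJ (O, x)).
  - intros k x Hx. now apply (HJ (k, x)).
Qed.

(* Near a point of [E], either [E] consists of accumulation points of [K], or [E] is trivial (a single point or part
   of a ray added outside of [K]) and has no gaps. *)
Definition locally_simple (K E : R -> Prop) : Prop :=
  forall a, E a -> exists r, 0 < r /\
    ((accum K a /\ forall y, E y -> Rabs (y - a) < r -> accum K y) \/
     ((forall y, E y -> Rabs (y - a) < r -> y = a \/ (~ K a /\ ~ K y)) /\
      forall c d, gap E c d -> Rabs (c - a) < r -> Rabs (d - a) < r -> False)).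

(** Finitely many isolated points have a common isolation radius, so distinct points of [K] closer
    than it are accumulation points. Hence short gaps of [K] have controlled jets at both ends. *)
Lemma isolated_separation (K : R -> Prop) :
  (exists l : list R, forall x, isolated_pt K x -> In x l) ->
  exists r, 0 < r /\ forall x y, K x -> K y -> x <> y -> Rabs (x - y) < r -> accum K x.
Proof.
  intros [l Hl].
  assert (H : exists r, 0 < r /\ forall x, In x l -> isolated_pt K x ->
    forall y, K y -> Rabs (y - x) < r -> y = x).
  { clear Hl. induction l as [|z l [r [Hr H]]]; [exists 1; split; [lra|easy]|].
    destruct (classic (isolated_pt K z)) as [[Kz [e [He Hz]]]|Hz].
    - exists (Rmin r e); split; [now apply Rmin_pos|]. intros x [<-|Hx] Hi y Ky Hy.
      + apply Hz; auto. eapply Rlt_le_trans; [apply Hy|apply Rmin_r].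
      + apply H; auto. eapply Rlt_le_trans; [apply Hy|apply Rmin_l].
    - exists r; split; [easy|]. intros x [<-|Hx] Hi; [easy|]. now apply H. }
  destruct H as [r [Hr H]]. exists r; split; [easy|]. intros x y Kx Ky Hxy Hd.
  split; [easy|]. intros Hi. apply Hxy. symmetry; apply (H x); auto. now rewrite Rabs_minus_sym.
Qed.

(** Two rays at distance at least 1 from [K] make all gaps bounded and allow the extension to be 0
    far out. *)
Lemma extended_set (K : R -> Prop) :
  Rtopology.compact K -> (exists l : list R, forall x, isolated_pt K x -> In x l) ->
  exists p q, let E := fun x => K x \/ x <= p \/ q <= x in
    gaps_fill E /\ locally_simple K E /\ (forall x, K x -> p < x < q).
Proof.
  intros HK Hiso.
  destruct (Rtopology.compact_P1 K HK) as [lo [hi Hb]].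
  assert (Hcl := Rtopology.compact_P2 K HK).
  destruct (isolated_separation K Hiso) as [r0 [Hr0 Hsep]].
  set (p := - (Rabs lo + 1)). set (q := Rabs hi + 1).
  assert (Hpq : p + 1 <= 0 /\ 0 <= q - 1).
  { unfold p, q. pose proof (Rabs_pos lo); pose proof (Rabs_pos hi); lra. }
  assert (HKpq : forall x, K x -> p + 1 <= x <= q - 1).
  { intros x Hx; apply Hb in Hx. unfold p, q. pose proof (Rle_abs (- lo)); pose proof (Rle_abs hi).
    rewrite Rabs_Ropp in *. lra. }
  exists p, q. intros E.
  assert (HEc : closed_R E).
  { intros x Hx. assert (Hx1 : ~ K x) by (intros H; apply Hx; now left).
    assert (Hx2 : p < x < q).
    { split; apply Rnot_le_lt; intros H; apply Hx; unfold E; tauto. }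
    destruct (Hcl x Hx1) as [[e He] Hne].
    exists (Rmin e (Rmin (x - p) (q - x))); split; [repeat apply Rmin_pos; lra|].
    intros y Hy. pose proof (Rmin_l e (Rmin (x - p) (q - x))).
    pose proof (Rmin_r e (Rmin (x - p) (q - x))).
    pose proof (Rmin_l (x - p) (q - x)); pose proof (Rmin_r (x - p) (q - x)).
    intros [HyK|HyE].
    - apply (Hne y); [|easy]. unfold Rtopology.disc. simpl. lra.
    - apply Rabs_def2 in Hy. lra. }
  assert (HE : forall x y, E x -> E y -> Rabs (y - x) < 1 -> K x -> K y).
  { intros x y Hx [Hy|Hy] Hd Kx; [easy|]. apply HKpq in Kx. apply Rabs_def2 in Hd. lra. }
  (* Because of the margins around [K] and between the rays, a gap shorter than 1 touches no ray. *)
  assert (Hray : forall a b, gap E a b -> b - a < 1 -> K a /\ K b).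
  { intros a b [Ea [Eb [Hab Hg]]] Hd.
    assert (Hab1 : Rabs (b - a) < 1) by (apply Rabs_def1; lra).
    assert (Hab2 : Rabs (a - b) < 1) by (apply Rabs_def1; lra).
    destruct Ea as [Ka|Ea]; [split; [easy|]; apply (HE a b); auto; now left|].
    destruct Eb as [Kb|Eb]; [split; [|easy]; apply (HE b a); auto; [now left|now right]|].
    exfalso. apply (Hg ((a + b) / 2)); [lra|]. right.
    destruct Ea as [Ea|Ea]; [left|right; lra]. destruct Eb as [Eb|Eb]; lra. }
  split; [|split].
  - intros x Hx. apply (gap_around E p q); auto; unfold E; auto.
  - intros a Ea. destruct (classic (accum K a)) as [Ha|Ha].
    + exists (Rmin r0 1); split; [apply Rmin_pos; lra|]. left; split; [easy|].
      intros y Ey Hy. destruct (Req_dec y a) as [->|Hne]; [easy|].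
      apply (Hsep y a); auto; [|apply Ha|].
      * apply (HE a y); auto; [|apply Ha]. eapply Rlt_le_trans; [apply Hy|apply Rmin_r].
      * eapply Rlt_le_trans; [apply Hy|apply Rmin_l].
    + exists (Rmin r0 (1 / 2)); split; [apply Rmin_pos; lra|]. right.
      assert (Hloc : forall y, E y -> Rabs (y - a) < Rmin r0 (1 / 2) -> y = a \/ (~ K a /\ ~ K y)).
      { intros y Ey Hy. pose proof (Rmin_l r0 (1 / 2)); pose proof (Rmin_r r0 (1 / 2)).
        destruct (classic (K a)) as [Ka|Ka].
        - left. apply NNPP; intros Hne. apply Ha. apply (Hsep a y); auto.
          + apply (HE a y); auto; lra.
          + rewrite Rabs_minus_sym; lra.
        - right; split; [easy|]. intros Ky. apply Ka. apply (HE y a); auto.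
          rewrite Rabs_minus_sym; lra. }
      split; [easy|]. intros c d Hg Hc Hd.
      assert (Hcd : d - c < 1).
      { pose proof (Rmin_r r0 (1 / 2)). apply Rabs_def2 in Hc, Hd. lra. }
      destruct (Hray c d Hg Hcd) as [Kc Kd].
      destruct (Hloc c (or_introl Kc) Hc) as [->|[_ H]]; [|easy].
      destruct (Hloc d (or_introl Kd) Hd) as [->|[_ H]]; [|easy].
      destruct Hg as [_ [_ [Hlt _]]]; lra.
  - intros x Hx; apply HKpq in Hx; lra.
Qed.

(** Inside the gaps only the [m]-th derivative is estimated, against Newton polynomials on nodes
    near the left end; its continuity then yields the lower orders through [glue_derive]. *)
Lemma component_extension (m : nat) (K E : R -> Prop) (phi : R -> R) (J : nat -> R -> R)
    (v : R -> R -> nat -> R -> R) :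
  (0 < m)%nat -> gaps_fill E -> locally_simple K E -> (forall x, K x -> E x) ->
  dd_unif_conv m K phi -> jet_of m K phi J -> (forall k x, ~ K x -> J k x = 0) ->
  (forall a b, gap E a b -> tower m (v a b) /\
     forall k, (k <= m)%nat -> v a b k a = J k a /\ v a b k b = J k b) ->
  (forall e, 0 < e -> exists d, 0 < d /\ forall a b, accum K a -> accum K b -> 0 < b - a < d ->
     exists X, pts_in K (S m) X /\ in_ball X a (b - a) /\
       forall x, a <= x <= b -> Rabs (v a b m x - nt nil phi X m x) <= e) ->
  exists F, tower m F /\ forall k x, (k <= m)%nat ->
    (E x -> F k x = J k x) /\ (forall a b, gap E a b -> a <= x <= b -> F k x = v a b k x).
Proof.
  intros Hm Hfill Hloc HKE Hdd HJ HJ0 Hv Hsmall.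
  assert (HF : forall k, exists w : R -> R, (k <= m)%nat ->
     (forall x, E x -> w x = J k x) /\ forall a b x, gap E a b -> a <= x <= b -> w x = v a b k x).
  { intros k. destruct (le_lt_dec k m) as [Hk|Hk]; [|exists (fun _ => 0); lia].
    destruct (glue_exists E (J k) (fun a b => v a b k)) as [w Hw]; [|now exists w].
    intros a b Hg. destruct (Hv a b Hg) as [_ H]. now apply H. }
  destruct (functional_choice _ HF) as [F HFs]. exists F.
  assert (HFE : forall k x, (k <= m)%nat -> E x -> F k x = J k x) by (intros; now apply HFs).
  assert (HFg : forall k a b x, (k <= m)%nat -> gap E a b -> a <= x <= b -> F k x = v a b k x)
    by (intros; now apply HFs).
  split; [|intros k x Hk; split; [now apply HFE|now intros; apply HFg]].
  assert (Hcont : forall x, continuous (F m) x).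
  { apply (glue_continuous E); auto.
    - intros c d Hg. destruct (Hv c d Hg) as [Tv _]. exists (v c d m); split.
      + intros x; now apply (tower_cont m).
      + intros x Hx. now apply HFg.
    - intros a e Ea He. destruct (Hloc a Ea) as [r [Hr [[Ha Hacc]|[Htriv Hno]]]].
      + destruct (jet_continuous m K phi J a e m Hm Hdd HJ Ha (Nat.le_refl m) He) as [d1 [Hd1 H1]].
        destruct (jet_local m K phi J a (e / 2) m Hdd HJ Ha (Nat.le_refl m) ltac:(lra)) as [d2 [Hd2 H2]].
        destruct (Hsmall (e / 2) ltac:(lra)) as [d3 [Hd3 H3]].
        (* A gap with both ends within [s] of [a] is shorter than [2 s <= d3], and its nodes are
           within [3 s <= d2] of [a]. *)
        set (s := Rmin (Rmin r d1) (Rmin (d2 / 3) (d3 / 2))).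
        assert (Hs : 0 < s) by (repeat apply Rmin_pos; lra).
        assert (S1 : s <= r) by (eapply Rle_trans; [apply Rmin_l|apply Rmin_l]).
        assert (S2 : s <= d1) by (eapply Rle_trans; [apply Rmin_l|apply Rmin_r]).
        assert (S3 : s <= d2 / 3) by (eapply Rle_trans; [apply Rmin_r|apply Rmin_l]).
        assert (S4 : s <= d3 / 2) by (eapply Rle_trans; [apply Rmin_r|apply Rmin_r]).
        exists s; split; [easy|split].
        * intros y Ey Hy. rewrite !HFE by (auto; lia). apply H1; [apply Hacc; auto|]; lra.
        * intros c d x Hg Hc Hd Hx. rewrite (HFE m a (Nat.le_refl m) Ea), (HFg m c d x) by auto.
          assert (Hcd : c < d) by apply Hg.
          assert (Kc : accum K c) by (apply Hacc; [apply Hg|lra]).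
          assert (Kd : accum K d) by (apply Hacc; [apply Hg|lra]).
          assert (Hdc : d - c < 2 * s) by (apply Rabs_def2 in Hc, Hd; lra).
          destruct (H3 c d Kc Kd ltac:(lra)) as [X [HX [BX HXv]]].
          specialize (HXv x Hx). apply Rabs_def2 in Hc, Hd.
          assert (HL := H2 X x HX).
          replace (v c d m x - J m a) with ((v c d m x - nt nil phi X m x) + (nt nil phi X m x - J m a)) by ring.
          eapply Rle_trans; [apply Rabs_triang|].
          assert (Rabs (nt nil phi X m x - J m a) <= e / 2); [|lra].
          apply HL.
          -- intros z Hz. specialize (BX z Hz). apply Rabs_le_between in BX. apply Rabs_le; lra.
          -- apply Rabs_le; lra.
      + exists r; split; [easy|split].
        * intros y Ey Hy. rewrite !HFE by (auto; lia).
          destruct (Htriv y Ey Hy) as [->|[Hka Hky]].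
          -- rewrite Rminus_diag, Rabs_R0; lra.
          -- rewrite !HJ0 by easy. rewrite Rminus_diag, Rabs_R0; lra.
        * intros c d x Hg Hc Hd _. exfalso; now apply (Hno c d). }
  (* Downwards in the order: continuity of [F (S k)] makes it the derivative of [F k], which is
     therefore continuous. *)
  assert (Hder : forall i, (i <= m)%nat -> (forall x, continuous (F (m - i)%nat) x) /\
    forall k x, (m - i <= k)%nat -> (k < m)%nat -> is_derive (F k) x (F (S k) x)).
  { induction i as [|i IH]; intros Hi.
    - rewrite Nat.sub_0_r. split; [easy|intros; lia].
    - destruct (IH ltac:(lia)) as [Hc Hd].
      assert (Hstep : forall x, is_derive (F (m - S i)%nat) x (F (m - i)%nat x)).
      { assert (Ei : (m - i = S (m - S i))%nat) by lia. set (k := (m - S i)%nat) in *.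
        rewrite Ei in *. apply (glue_derive E); auto.
        - intros a b Hg. destruct (Hv a b Hg) as [Tv _]. exists (v a b k), (v a b (S k)). split.
          + intros x; apply (tower_der m); auto; lia.
          + intros x Hx; split; apply HFg; auto; lia.
        - intros a Ea e He. destruct (Hloc a Ea) as [r [Hr [[Ha Hacc]|[Htriv _]]]].
          + destruct (jet_derivative m K phi J a e k Hdd HJ Ha ltac:(lia) He) as [d [Hd' H]].
            exists (Rmin r d); split; [now apply Rmin_pos|]. intros y Ey Hy.
            rewrite !HFE by (auto; lia). pose proof (Rmin_l r d); pose proof (Rmin_r r d).
            apply H; [apply Hacc; auto|]; lra.
          + exists r; split; [easy|]. intros y Ey Hy. rewrite !HFE by (auto; lia).
            destruct (Htriv y Ey Hy) as [->|[Hka Hky]].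
            * rewrite !Rminus_diag, Rmult_0_r, Rminus_diag, Rabs_R0; lra.
            * rewrite !HJ0 by easy. rewrite Rmult_0_l, !Rminus_0_r, Rabs_R0.
              apply Rmult_le_pos; [lra|apply Rabs_pos]. }
      split.
      + intros x; eapply is_derive_cont, Hstep.
      + intros k x Hk1 Hk2. destruct (Nat.eq_dec k (m - S i)) as [->|Hne].
        * replace (S (m - S i)) with (m - i)%nat by lia. apply Hstep.
        * apply Hd; lia. }
  split; [|easy]. intros k x Hk. apply (Hder m (Nat.le_refl m)); lia.
Qed.

(** * Products of towers and assembly of the curve *)

(** Mere existence spares Leibniz's formula: the derivative is a sum of two products of lower order.
    The last clause will make the derivatives of the height vanish on the rays. *)
Lemma tower_mul (m : nat) (p q : nat -> R -> R) :
  tower m p -> tower m q -> exists r, tower m r /\ (forall x, r O x = p O x * q O x) /\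
    forall x, (forall k, (k <= m)%nat -> p k x = 0) -> forall k, (k <= m)%nat -> r k x = 0.
Proof.
  revert p q; induction m as [|m IH]; intros p q Hp Hq.
  - exists (fun _ x => p O x * q O x). split; [split|split].
    + intros; lia.
    + intros x; apply continuous_mul; [apply Hp|apply Hq].
    + easy.
    + intros x H k _. rewrite H by lia; ring.
  - destruct (IH (fun k => p (S k)) q) as [r1 [T1 [E1 Z1]]]; auto using tower_shift.
    { apply tower_le with (S m); auto. }
    destruct (IH p (fun k => q (S k))) as [r2 [T2 [E2 Z2]]]; auto using tower_shift.
    { apply tower_le with (S m); auto. }
    exists (fun k => match k with O => fun x => p O x * q O x | S k => fun x => r1 k x + r2 k x end).
    split; [split|split].
    + intros [|k] x Hk.
      * rewrite E1, E2. apply is_derive_mul; apply (tower_der (S m)); auto.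
      * apply is_derive_add; apply (tower_der m); auto; lia.
    + intros x; apply continuous_add; [apply T1|apply T2].
    + easy.
    + intros x H [|k] Hk; [rewrite H by lia; ring|].
      rewrite Z1, Z2; try lia; [ring| |]; intros; apply H; lia.
Qed.

(** The [m]-th derivative is bounded on [[p, q]] by compactness and vanishes elsewhere. *)
Lemma tower_Cm (m : nat) (F : nat -> R -> R) (p q : R) :
  tower m F -> p <= q -> (forall x, x <= p \/ q <= x -> F m x = 0) -> Cm m (F O).
Proof.
  intros HF Hpq H0. assert (HD := tower_Derive_n m F HF). split; [|split].
  - intros k x Hk. exists (F (S k) x).
    apply (is_derive_ext (F k)); [intros; symmetry; apply HD; lia|]. now apply (tower_der m).
  - intros x. apply (continuous_ext (F m)); [intros; symmetry; now apply HD|apply HF].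
  - destruct (continuity_ab_maj (fun t => Rabs (F m t)) p q Hpq) as [x0 [Hmax _]].
    { intros c _. apply continuity_pt_filterlim, continuous_abs, HF. }
    exists (Rabs (F m x0)). intros x. rewrite HD by easy.
    destruct (Rlt_le_dec p x) as [Hx|Hx]; [destruct (Rlt_le_dec x q) as [Hx'|Hx']|].
    + apply Hmax; lra.
    + rewrite H0, Rabs_R0; [apply Rabs_pos|now right].
    + rewrite H0, Rabs_R0; [apply Rabs_pos|now left].
Qed.

Lemma CmH_of_discrete (m : nat) (K : R -> Prop) (f g h : R -> R) :
  (0 < m)%nat -> Rtopology.compact K -> (exists l : list R, forall x, isolated_pt K x -> In x l) ->
  dd_unif_conv m K f -> dd_unif_conv m K g -> discrete_AV m K f g h -> CmH m K f g h.
Proof.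
  intros Hm HK Hiso Hdf Hdg HAV.
  destruct (extended_set K HK Hiso) as [p [q HE0]].
  set (E := fun x => K x \/ x <= p \/ q <= x) in HE0. cbv zeta in HE0.
  destruct HE0 as [Hfill [Hloc HKpq]].
  destruct (jet_extend m K f Hdf) as [Jf [HJf [Jf0 JfK]]].
  destruct (jet_extend m K g Hdg) as [Jg [HJg [Jg0 JgK]]].
  (* Height 0 off [K]: the outermost gaps lead to the rays and are bridged like all others, to zero
     height and zero jets. *)
  assert (HhE : forall x, exists y, (K x -> y = h x) /\ (~ K x -> y = 0)).
  { intros x; destruct (classic (K x)); [exists (h x)|exists 0]; tauto. }
  destruct (functional_choice _ HhE) as [hE HhE'].
  assert (HhK : forall x, K x -> hE x = h x) by (intros; now apply HhE').
  assert (Hh0 : forall x, ~ K x -> hE x = 0) by (intros; now apply HhE').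
  assert (HKE : forall x, K x -> E x) by (intros; now left).
  destruct (uniform_choice (R * R) ((nat -> R -> R) * (nat -> R -> R))
    (fun i t => bridge m Jf Jg (fst i) (snd i) (hE (snd i) - hE (fst i)) (fst t) (snd t))
    (fun i t e => exists X, pts_in K (S m) X /\ in_ball X (fst i) (snd i - fst i) /\
       forall x, fst i <= x <= snd i -> Rabs (fst t m x - nt nil f X m x) <= e /\
                                        Rabs (snd t m x - nt nil g X m x) <= e)
    (fun i => snd i - fst i) (fun i => accum K (fst i) /\ accum K (snd i))) as [sel [HB HQ]].
  { intros [a b] Hab; simpl in *.
    destruct (gap_exists m Jf Jg a b (hE b - hE a) Hm ltac:(lra)) as [F [G H]]. now exists (F, G). }
  { intros i t e e' [X [HX [BX H]]] He. exists X; split; [easy|split; [easy|]].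
    intros x Hx. specialize (H x Hx). lra. }
  { intros e He. destruct (gap_small m K f g h Jf Jg e Hm HJf HJg HAV He) as [d [Hd H]].
    exists d; split; [easy|]. intros [a b] [Ka Kb] Hab; simpl in *.
    destruct (H a b Ka Kb ltac:(lra)) as [F [G [HFG HX]]]. exists (F, G); split; [|easy]. simpl.
    now rewrite (HhK a (proj1 Ka)), (HhK b (proj1 Kb)). }
  { exact (inhabits (fun _ _ => 0, fun _ _ => 0)). }
  set (vF := fun a b => fst (sel (a, b))). set (vG := fun a b => snd (sel (a, b))).
  assert (Hbr : forall a b, gap E a b -> bridge m Jf Jg a b (hE b - hE a) (vF a b) (vG a b)).
  { intros a b Hg. apply (HB (a, b)). simpl. destruct Hg as [_ [_ [Hab _]]]; lra. }
  destruct (component_extension m K E f Jf vF Hm Hfill Hloc HKE Hdf HJf JfK) as [F [TF HF]].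
  { intros a b Hg. destruct (Hbr a b Hg) as [T1 [_ [HJ _]]]. split; [easy|].
    intros k Hk; destruct (HJ k Hk); tauto. }
  { intros e He. destruct (HQ e He) as [d [Hd H]]. exists d; split; [easy|].
    intros a b Ka Kb Hab. destruct (H (a, b) (conj Ka Kb) Hab) as [X [HX [BX HXx]]]; simpl in *.
    exists X; split; [easy|split; [easy|]]. intros x Hx; now apply HXx. }
  destruct (component_extension m K E g Jg vG Hm Hfill Hloc HKE Hdg HJg JgK) as [G [TG HG]].
  { intros a b Hg. destruct (Hbr a b Hg) as [_ [T2 [HJ _]]]. split; [easy|].
    intros k Hk; destruct (HJ k Hk); tauto. }
  { intros e He. destruct (HQ e He) as [d [Hd H]]. exists d; split; [easy|].
    intros a b Ka Kb Hab. destruct (H (a, b) (conj Ka Kb) Hab) as [X [HX [BX HXx]]]; simpl in *.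
    exists X; split; [easy|split; [easy|]]. intros x Hx; now apply HXx. }
  (* On a gap the height is integrated from the left end; the area of the bridge makes it arrive at
     the prescribed value at the right end. *)
  destruct (glue_exists E hE (fun a b x => hE a + 2 * area (vF a b) (vG a b) a x)) as [H [HHE HHg]].
  { intros a b Hg. destruct (Hbr a b Hg) as [_ [_ [_ HA]]]. split.
    - unfold area. rewrite RInt_point. unfold zero; simpl. ring.
    - rewrite HA. ring. }
  set (V := fun x => 2 * (F 1%nat x * G O x - F O x * G 1%nat x)).
  assert (HV : forall x, continuous V x) by (intros; unfold V; cont_tower).
  assert (HH : forall x, is_derive H x (V x)).
  { apply (glue_derive E); auto.
    - intros a b Hg. destruct (Hbr a b Hg) as [T1 [T2 _]].
      set (w := fun t => vF a b 1%nat t * vG a b O t - vF a b O t * vG a b 1%nat t).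
      assert (Hw : forall x, continuous w x) by (intros; unfold w; cont_tower).
      exists (fun x => hE a + 2 * area (vF a b) (vG a b) a x), (fun x => 2 * w x). split.
      + intros x. eapply is_derive_eq.
        * apply is_derive_add; [apply (is_derive_const (hE a))|]. apply is_derive_scal.
          apply (is_derive_RInt w (fun y => area (vF a b) (vG a b) a y) a x); [|apply Hw].
          apply filter_forall; intros y. apply (RInt_correct w), ex_RInt_cont, Hw.
        * unfold zero; simpl; ring.
      + intros x Hx. split; [now apply HHg|]. unfold V, w.
        destruct (HF O x ltac:(lia)) as [_ E0]. destruct (HF 1%nat x ltac:(lia)) as [_ E1].
        destruct (HG O x ltac:(lia)) as [_ E2]. destruct (HG 1%nat x ltac:(lia)) as [_ E3].
        now rewrite (E0 a b), (E1 a b), (E2 a b), (E3 a b) by auto.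
    - intros a Ea.
      assert (EV : V a = 2 * (Jf 1%nat a * Jg O a - Jf O a * Jg 1%nat a)).
      { unfold V. destruct (HF O a ltac:(lia)) as [E0 _]. destruct (HF 1%nat a ltac:(lia)) as [E1 _].
        destruct (HG O a ltac:(lia)) as [E2 _]. destruct (HG 1%nat a ltac:(lia)) as [E3 _].
        now rewrite E0, E1, E2, E3 by easy. }
      intros e He. destruct (Hloc a Ea) as [r [Hr [[Ha Hacc]|[Htriv _]]]].
      + destruct (h_derivative m K f g h Jf Jg a Hm Hdf Hdg HJf HJg HAV Ha e He) as [d [Hd Hh]].
        exists (Rmin r d); split; [now apply Rmin_pos|]. intros y Ey Hy.
        pose proof (Rmin_l r d); pose proof (Rmin_r r d).
        assert (Ky : accum K y) by (apply Hacc; auto; lra).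
        rewrite EV, !HHE by easy. rewrite (HhK a (proj1 Ha)), (HhK y (proj1 Ky)). apply Hh; [apply Ky|lra].
      + exists r; split; [easy|]. intros y Ey Hy. rewrite EV, !HHE by easy.
        destruct (Htriv y Ey Hy) as [->|[Ka Ky]].
        * rewrite !Rminus_diag, Rmult_0_r, Rminus_diag, Rabs_R0; lra.
        * rewrite (Hh0 a Ka), (Hh0 y Ky).
          rewrite !JfK by easy. rewrite !Rmult_0_l, !Rminus_0_r, Rmult_0_r, Rmult_0_l, Rminus_0_r, Rabs_R0.
          apply Rmult_le_pos; [lra|apply Rabs_pos]. }
  (* [H' = 2 (F' G - F G')] is built from products of towers of order [m - 1], so [H] has a tower of
     order [m]. *)
  assert (HTH : exists TH, tower m TH /\ (forall x, TH O x = H x) /\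
    forall x, (forall k, (k <= m)%nat -> F k x = 0) -> TH m x = 0).
  { destruct m as [|n]; [lia|].
    assert (TF' := tower_le (S n) n F ltac:(lia) TF). assert (TG' := tower_le (S n) n G ltac:(lia) TG).
    destruct (tower_mul n (fun k => F (S k)) G (tower_shift n F TF) TG') as [r1 [T1 [E1 Z1]]].
    destruct (tower_mul n F (fun k => G (S k)) TF' (tower_shift n G TG)) as [r2 [T2 [E2 Z2]]].
    assert (T12 := tower_scal n 2 _ (tower_sub n r1 r2 T1 T2)).
    exists (fun k => match k with O => H | S k => fun x => 2 * (r1 k x - r2 k x) end).
    split; [split|split].
    - intros [|k] x Hk; [|apply (tower_der n _ k x T12); lia].
      rewrite E1, E2. apply HH.
    - intros x; apply T12.
    - easy.
    - intros x Hx. rewrite Z1, Z2; try lia; [ring| |]; intros; apply Hx; lia. }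
  destruct HTH as [TH [TTH [TH0 THz]]].
  (* The order of [p] and [q] is recorded only through points of [K], so [q'] covers the case of an
     empty [K]. *)
  assert (Hpq : exists q', p <= q' /\ q <= q').
  { exists (Rmax p q); split; [apply Rmax_l|apply Rmax_r]. }
  destruct Hpq as [q' [Hpq' Hqq']].
  assert (HnK : forall x, x <= p \/ q' <= x -> E x /\ ~ K x).
  { intros x Hx; split; [right; destruct Hx; lra|]. intros HKx; apply HKpq in HKx. lra. }
  exists (F O), (G O), (TH O).
  split; [|split; [|split; [|split]]].
  - apply (tower_Cm m F p q'); auto. intros x Hx. destruct (HnK x Hx) as [Ex Kx].
    destruct (HF m x (Nat.le_refl m)) as [-> _]; auto.
  - apply (tower_Cm m G p q'); auto. intros x Hx. destruct (HnK x Hx) as [Ex Kx].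
    destruct (HG m x (Nat.le_refl m)) as [-> _]; auto.
  - apply (tower_Cm m TH p q'); auto. intros x Hx. destruct (HnK x Hx) as [Ex Kx].
    apply THz. intros k Hk. destruct (HF k x Hk) as [-> _]; auto.
  - intros x. rewrite (Derive_ext (TH O) H) by easy.
    rewrite (is_derive_unique _ _ _ (HH x)).
    rewrite (is_derive_unique _ _ _ (tower_der m F O x TF Hm)).
    now rewrite (is_derive_unique _ _ _ (tower_der m G O x TG Hm)).
  - intros x Kx. destruct (HF O x ltac:(lia)) as [-> _]; [|now apply HKE].
    destruct (HG O x ltac:(lia)) as [-> _]; [|now apply HKE].
    rewrite TH0, HHE by now apply HKE. rewrite Jf0, Jg0 by easy.
    now rewrite HhK.
Qed.

(** * Necessity *)

Lemma Cm_tower (m : nat) (F : R -> R) : Cm m F -> tower m (Derive_n F).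
Proof.
  intros [H1 [H2 _]]; split; [|easy]. intros k x Hk. apply (Derive_correct (Derive_n F k)), H1, Hk.
Qed.

(** The remainder has [m + 1] zeros, so its [k]-th derivative keeps at least one. For [k = m] this
    is the mean value form of divided differences. *)
Lemma dd_mean_value (m k : nat) (F : nat -> R -> R) (X : list R) (lo hi : R) :
  tower m F -> (k <= m)%nat -> NoDup X -> length X = S m -> (forall x, In x X -> lo <= x <= hi) ->
  exists xi, lo <= xi <= hi /\ F k xi = nt nil (F O) X k xi.
Proof.
  intros HF Hk HN HL HX.
  destruct (rolle_tower k (S (m - k)) m (fun k x => F k x - nt nil (F O) X k x) lo hi X)
    as [l [Hl [_ H]]]; auto.
  - apply tower_sub; [easy|apply tower_nt].
  - lia.
  - intros y Hy; split; [auto|]. rewrite nt_interp by easy. ring.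
  - destruct l as [|xi l]; [easy|]. destruct (H xi (or_introl eq_refl)) as [H1 H2].
    exists xi; split; [easy|lra].
Qed.

Lemma uniform_on_segment (F : R -> R) (lo hi e : R) :
  (forall x, continuous F x) -> 0 < e -> exists d, 0 < d /\
    forall x y, lo <= x <= hi -> lo <= y <= hi -> Rabs (x - y) < d -> Rabs (F x - F y) < e.
Proof.
  intros HF He.
  destruct (Rtopology.Heine F (fun c => lo <= c <= hi) (Rtopology.compact_P3 lo hi)) with (mkposreal e He)
    as [d Hd].
  - intros x _. apply continuity_pt_filterlim, HF.
  - exists d; split; [apply cond_pos|exact Hd].
Qed.

(** An [m]-th divided difference is a value of [F m] in the hull of its nodes, divided by [m!];
    uniform continuity of [F m] does the rest. *)
Lemma dd_unif_of_tower (m : nat) (K : R -> Prop) (F : nat -> R -> R) (phi : R -> R) (lo hi : R) :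
  tower m F -> (forall x, K x -> lo <= x <= hi /\ F O x = phi x) -> dd_unif_conv m K phi.
Proof.
  intros HF HK e He.
  destruct (uniform_on_segment (F m) lo hi e) as [d [Hd H]]; [apply HF|easy|].
  exists d; split; [easy|]. intros X Y [NX [LX KX]] [NY [LY KY]] Hdiam.
  assert (HXY : forall x, In x (X ++ Y) -> lo <= x <= hi).
  { intros x Hx; apply in_app_or in Hx. destruct Hx as [Hx|Hx]; apply HK; auto. }
  assert (Hnil : X ++ Y <> nil) by (destruct X; easy).
  destruct (diam_between (X ++ Y) lo hi Hnil HXY) as [B1 B2].
  assert (Hmv : forall Z, NoDup Z -> length Z = S m -> (forall x, In x Z -> In x (X ++ Y)) ->
    (forall x, In x Z -> K x) ->
    exists xi, lmin (X ++ Y) <= xi <= lmax (X ++ Y) /\ F m xi = INR (fact m) * dd phi Z).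
  { intros Z NZ LZ HZ KZ.
    destruct (dd_mean_value m m F Z (lmin (X ++ Y)) (lmax (X ++ Y))) as [xi [Hxi E]]; auto.
    - intros x Hx; now apply in_lmin_lmax, HZ.
    - exists xi; split; [easy|]. rewrite E, (nt_top _ _ m) by easy. f_equal. apply dd_ext.
      + now destruct Z.
      + intros x Hx; apply HK; auto. }
  destruct (Hmv X NX LX) as [xi [Hxi Exi]]; [intros; apply in_or_app; now left|easy|].
  destruct (Hmv Y NY LY) as [yi [Hyi Eyi]]; [intros; apply in_or_app; now right|easy|].
  assert (Hlt : Rabs (F m xi - F m yi) < e).
  { apply H; try lra. unfold diam in Hdiam. apply Rabs_def1; lra. }
  rewrite Exi, Eyi, <- Rmult_minus_distr_l, Rabs_mult, Rabs_pos_eq in Hlt by apply pos_INR.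
  assert (1 <= INR (fact m)) by (apply (le_INR 1), lt_O_fact).
  pose proof (Rabs_pos (dd phi X - dd phi Y)). nra.
Qed.

(** At order [m] the interpolant is constant and equals a value of [F m]. Going down, each remainder
    has a zero in the hull of the nodes, and the mean value theorem gains a factor [diam X] per
    order. *)
Lemma remainder_bound (m : nat) (F : nat -> R -> R) (X : list R) (e : R) :
  tower m F -> NoDup X -> length X = S m ->
  (forall x y, lmin X <= x <= lmax X -> lmin X <= y <= lmax X -> Rabs (F m x - F m y) <= e) ->
  forall i, (i <= m)%nat -> forall x, lmin X <= x <= lmax X ->
    Rabs (F (m - i)%nat x - nt nil (F O) X (m - i) x) <= e * diam X ^ i.
Proof.
  intros HF HN HL He.
  assert (HX : forall x, In x X -> lmin X <= x <= lmax X) by (intros; now apply in_lmin_lmax).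
  induction i as [|i IH]; intros Hi x Hx.
  - rewrite Nat.sub_0_r. destruct (dd_mean_value m m F X _ _ HF (Nat.le_refl m) HN HL HX) as [xi [Hxi E]].
    rewrite (nt_top _ _ m) in E by easy. rewrite (nt_top _ _ m), <- E, pow_O, Rmult_1_r by easy. now apply He.
  - set (k := (m - S i)%nat). assert (Ek : (m - i = S k)%nat) by lia. rewrite Ek in IH.
    destruct (dd_mean_value m k F X _ _ HF ltac:(lia) HN HL HX) as [xi [Hxi E]].
    destruct (mean_value (fun t => F k t - nt nil (F O) X k t)
      (fun t => F (S k) t - nt nil (F O) X (S k) t) xi x) as [c [Hc Ec]].
    { intros t. apply is_derive_sub; [apply (tower_der m); auto; lia|].
      apply (tower_der (S k)); [apply tower_nt|lia]. }
    replace (F k xi - nt nil (F O) X k xi) with 0 in Ec by lra. rewrite Rminus_0_r in Ec.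
    rewrite Ec, Rabs_mult. simpl pow. rewrite (Rmult_comm (diam X)), <- Rmult_assoc.
    apply Rmult_le_compat; try apply Rabs_pos.
    + apply IH; [lia|]. unfold Rmin, Rmax in Hc; destruct (Rle_dec xi x); lra.
    + unfold diam. apply Rabs_le; lra.
Qed.

Lemma area_horizontal (m : nat) (F G H : nat -> R -> R) (a b : R) :
  (0 < m)%nat -> tower m F -> tower m G -> tower m H ->
  horizontal (F O) (G O) (H O) -> H O b - H O a = 2 * area F G a b.
Proof.
  intros Hm HF HG HH Hhor. unfold area. rewrite <- RInt_mulc by (intros; cont_tower).
  rewrite <- (RInt_der (H O) (H 1%nat)).
  - apply RInt_cong; intros x. rewrite <- (is_derive_unique _ _ _ (tower_der m H O x HH Hm)), Hhor.
    rewrite (is_derive_unique _ _ _ (tower_der m F O x HF Hm)).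
    now rewrite (is_derive_unique _ _ _ (tower_der m G O x HG Hm)).
  - intros x; apply (tower_der m); auto.
  - intros x; apply (tower_cont m); auto.
Qed.

(** The area defect is twice the [cross] term of the remainders. These are of size [e d^m] and their
    derivatives of size [e d^(m-1)], with [d = diam X], which reproduces the two terms of [V_q]. *)
Lemma AV_of_horizontal (m : nat) (K : R -> Prop) (F G H : nat -> R -> R) (f g h : R -> R) (lo hi : R) :
  (0 < m)%nat -> tower m F -> tower m G -> tower m H -> horizontal (F O) (G O) (H O) ->
  (forall x, K x -> lo <= x <= hi /\ F O x = f x /\ G O x = g x /\ H O x = h x) ->
  discrete_AV m K f g h.
Proof.
  intros Hm HF HG HH Hhor HK eps Heps.
  (* The final bound is [4 e V_q], at most [(eps / 2) V_q]; [e <= 1] turns [e^2] into [e]. *)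
  set (e := Rmin 1 (eps / 8)).
  assert (He : 0 < e) by (apply Rmin_pos; lra).
  assert (He1 : e <= 1) by apply Rmin_l. assert (He2 : e <= eps / 8) by apply Rmin_r.
  destruct (uniform_on_segment (F m) lo hi e) as [d1 [Hd1 H1]]; [apply HF|easy|].
  destruct (uniform_on_segment (G m) lo hi e) as [d2 [Hd2 H2]]; [apply HG|easy|].
  exists (Rmin d1 d2); split; [now apply Rmin_pos|].
  intros X a b [NX [LX KX]] Xa Xb Hab Hdiam.
  pose proof (Rmin_l d1 d2); pose proof (Rmin_r d1 d2).
  assert (Hnil : X <> nil) by now destruct X.
  assert (HXb : forall x, In x X -> lo <= x <= hi) by (intros x Hx; now apply HK, KX).
  destruct (diam_between X lo hi Hnil HXb) as [B1 B2].
  set (P := nt nil (F O) X). set (Q := nt nil (G O) X). set (d := diam X).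
  assert (Hd : b - a <= d) by now apply diam_ge.
  assert (RF := remainder_bound m F X e HF NX LX
    ltac:(intros x y Hx Hy; apply Rlt_le, H1; try lra; unfold diam in Hdiam; apply Rabs_def1; lra)).
  assert (RG := remainder_bound m G X e HG NX LX
    ltac:(intros x y Hx Hy; apply Rlt_le, H2; try lra; unfold diam in Hdiam; apply Rabs_def1; lra)).
  fold d in RF, RG. fold P in RF. fold Q in RG.
  set (r := fun k x => F k x - P k x). set (s := fun k x => G k x - Q k x).
  assert (TP : tower m P) by apply tower_nt. assert (TQ : tower m Q) by apply tower_nt.
  assert (Tr : tower m r) by now apply tower_sub. assert (Ts : tower m s) by now apply tower_sub.
  assert (Hr0 : forall x, In x X -> r O x = 0 /\ s O x = 0).
  { intros x Hx. unfold r, s, P, Q. rewrite !nt_interp by easy. lra. }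
  assert (HA : A_q f g h X a b = 2 * cross P Q r s a b).
  { rewrite A_q_area.
    assert (EP : area (nt nil f X) (nt nil g X) a b = area P Q a b).
    { apply RInt_cong; intros t. unfold P, Q.
      rewrite !(nt_ext nil f (F O)), !(nt_ext nil g (G O)); auto; intros y Hy; symmetry; apply HK, KX, Hy. }
    rewrite EP. destruct (HK a (KX a Xa)) as [_ [_ [_ <-]]]. destruct (HK b (KX b Xb)) as [_ [_ [_ <-]]].
    rewrite (area_horizontal m F G H a b Hm HF HG HH Hhor).
    assert (EF : area F G a b = area (fun k x => P k x + r k x) (fun k x => Q k x + s k x) a b).
    { apply RInt_cong; intros t. unfold r, s. ring. }
    rewrite EF, area_perturb; eauto using tower_le; try (now apply Hr0). ring. }
  assert (HV : V_q m f g X a b = d ^ (2 * m) + d ^ m * RInt (fun t => Rabs (P 1%nat t) + Rabs (Q 1%nat t)) a b).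
  { rewrite V_q_nt. fold d. do 2 f_equal. apply RInt_cong; intros t. unfold P, Q.
    rewrite (nt_ext nil f (F O)), (nt_ext nil g (G O)); auto; intros y Hy; symmetry; apply HK, KX, Hy. }
  set (I := RInt (fun t => Rabs (P 1%nat t) + Rabs (Q 1%nat t)) a b) in *.
  assert (HVp := V_q_pos m f g X a b Xa Xb Hab).
  assert (Hdm : 0 < d ^ m) by (apply pow_lt; lra).
  assert (Hdm1 : 0 < d ^ (m - 1)) by (apply pow_lt; lra).
  assert (Edm : d ^ (m - 1) * d = d ^ m).
  { replace m with (S (m - 1)) at 2 by lia. simpl; ring. }
  assert (Hcross : Rabs (cross P Q r s a b) <= 2 * e * d ^ m * I + 2 * (e * d ^ m) * (e * d ^ (m - 1)) * (b - a)).
  { assert (HcI : forall x, continuous (fun t => Rabs (P 1%nat t) + Rabs (Q 1%nat t)) x) by (intros; cont_tower).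
    unfold I. rewrite <- RInt_mulc by easy.
    rewrite <- (RInt_cst (2 * (e * d ^ m) * (e * d ^ (m - 1)))), <- RInt_add by (intros; cont_tower).
    unfold cross. apply RInt_abs_le; [lra|intros; cont_tower|intros; cont_tower|].
    intros x Hx.
    assert (Hxin : lmin X <= x <= lmax X).
    { apply in_lmin_lmax in Xa, Xb. lra. }
    assert (Q0 := RF m (Nat.le_refl m) x Hxin). assert (Q1 := RF (m - 1)%nat ltac:(lia) x Hxin).
    assert (Q2 := RG m (Nat.le_refl m) x Hxin). assert (Q3 := RG (m - 1)%nat ltac:(lia) x Hxin).
    rewrite Nat.sub_diag in Q0, Q2. replace (m - (m - 1))%nat with 1%nat in Q1, Q3 by lia.
    fold (r O x) in Q0. fold (r 1%nat x) in Q1. fold (s O x) in Q2. fold (s 1%nat x) in Q3.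
    assert (E1 : Rabs (P 1%nat x * s O x) <= Rabs (P 1%nat x) * (e * d ^ m))
      by (rewrite Rabs_mult; apply Rmult_le_compat_l; auto using Rabs_pos).
    assert (E2 : Rabs (r O x * Q 1%nat x) <= (e * d ^ m) * Rabs (Q 1%nat x))
      by (rewrite Rabs_mult; apply Rmult_le_compat_r; auto using Rabs_pos).
    assert (E3 : Rabs (r 1%nat x * s O x) <= (e * d ^ (m - 1)) * (e * d ^ m))
      by (rewrite Rabs_mult; apply Rmult_le_compat; auto using Rabs_pos).
    assert (E4 : Rabs (r O x * s 1%nat x) <= (e * d ^ m) * (e * d ^ (m - 1)))
      by (rewrite Rabs_mult; apply Rmult_le_compat; auto using Rabs_pos).
    revert E1 E2 E3 E4.
    generalize (P 1%nat x * s O x) (r O x * Q 1%nat x) (r 1%nat x * s O x) (r O x * s 1%nat x).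
    intros y1 y2 y3 y4 E1 E2 E3 E4.
    assert (Rabs (2 * (y1 - y2) + (y3 - y4)) <= 2 * Rabs y1 + 2 * Rabs y2 + Rabs y3 + Rabs y4)
      by (unfold Rabs; repeat destruct Rcase_abs; lra).
    lra. }
  assert (HI : 0 <= I) by (apply RInt_abs_sum_nonneg; lra).
  assert (Hmain : Rabs (A_q f g h X a b) <= 4 * e * V_q m f g X a b).
  { rewrite HA, HV, Rabs_mult, (Rabs_pos_eq 2) by lra.
    replace (2 * m)%nat with (m + m)%nat by lia. rewrite pow_add.
    (* The length [b - a <= d] restores the power of [d] lost by differentiating a remainder. *)
    assert (Hq : 2 * (e * d ^ m) * (e * d ^ (m - 1)) * (b - a) <= 2 * e * (d ^ m * d ^ m)).
    { replace (2 * e * (d ^ m * d ^ m)) with (2 * (e * d ^ m) * (1 * d ^ (m - 1)) * d)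
        by (rewrite <- Edm; ring).
      assert (0 < e * d ^ m) by now apply Rmult_lt_0_compat.
      apply Rmult_le_compat; try lra.
      - apply Rmult_le_pos; [lra|]. apply Rmult_le_pos; lra.
      - apply Rmult_le_compat_l; [lra|]. apply Rmult_le_compat_r; lra. }
    lra. }
  unfold Rdiv. rewrite Rabs_mult, Rabs_inv, (Rabs_pos_eq (V_q m f g X a b)) by lra.
  apply Rmult_lt_reg_r with (V_q m f g X a b); [easy|].
  rewrite Rmult_assoc, Rinv_l, Rmult_1_r by lra.
  eapply Rle_lt_trans; [apply Hmain|]. apply Rmult_lt_compat_r; lra.
Qed.

Theorem theorem1p5 (m : nat) (K : R -> Prop) (f g h : R -> R) :
  (0 < m)%nat ->
  Rtopology.compact K ->
  (exists l : list R, forall x, isolated_pt K x -> In x l) ->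
  cont_on K f -> cont_on K g -> cont_on K h ->
  (CmH m K f g h <->
   ((dd_unif_conv m K f /\ dd_unif_conv m K g /\ dd_unif_conv m K h) /\
    discrete_AV m K f g h)).
Proof.
  intros Hm HK Hiso _ _ _. split.
  - intros [F [G [H [HF [HG [HH [Hhor Hext]]]]]]].
    apply Cm_tower in HF, HG, HH.
    destruct (Rtopology.compact_P1 K HK) as [lo [hi Hb]].
    split.
    + split; [|split].
      * apply (dd_unif_of_tower m K (Derive_n F) f lo hi HF).
        intros x Kx; split; [auto|]. apply (Hext x Kx).
      * apply (dd_unif_of_tower m K (Derive_n G) g lo hi HG).
        intros x Kx; split; [auto|]. apply (Hext x Kx).
      * apply (dd_unif_of_tower m K (Derive_n H) h lo hi HH).
        intros x Kx; split; [auto|]. apply (Hext x Kx).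
    + apply (AV_of_horizontal m K (Derive_n F) (Derive_n G) (Derive_n H) f g h lo hi); auto.
  - intros [[Hf [Hg _]] HAV]. now apply CmH_of_discrete.
Qed.
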